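(* Fix $1<q<\infty$. For a sequence $f=\{f_i\}_{i\ge1}$ of measurable functions on $\mathbb{R}^n$ let $$\overline{M}_qf(x)=\left(\sum_{i=1}^\infty Mf_i(x)^q\right)^{1/q},$$ where $M$ is the Hardy-Littlewood maximal operator. Let $(u,v)$ be a pair of weights on $\mathbb{R}^n$. (1) Suppose $1<p\le q$ and $B$ is a Young function such that $\bar{B}\in B_p$. If $$\sup_Q\|u^{1/p}\|_{p,Q}\,\|v^{-1/p}\|_{B,Q}<\infty,$$ then there is a constant $C$, independent of $f$, such that $$\|\overline{M}_qf\|_{L^p(u)}\le C\left(\int_{\mathbb{R}^n}\|f(x)\|_{\ell^q}^p\,v(x)\,dx\right)^{1/p}.$$ (2) Suppose $q<p<\infty$ and $A$ and $B$ are Young functions such that $\bar{A}\in B_{(p/q)'}$ and $\bar{B}\in B_p$. If $$\sup_Q\|u^{q/p}\|_{A,Q}^{1/q}\,\|v^{-1/p}\|_{B,Q}<\infty,$$ then there is a constant $C$, independent of $f$, such that $$\|\overline{M}_qf\|_{L^p(u)}\le C\left(\int_{\mathbb{R}^n}\|f(x)\|_{\ell^q}^p\,v(x)\,dx\right)^{1/p}.$$ In both parts the suprema are over all cubes $Q\subset\mathbb{R}^n$.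
   Context: $Mg(x)=\sup_{Q\ni x}\frac{1}{|Q|}\int_Q|g(y)|\,dy$, the supremum being over all cubes $Q\subset\mathbb{R}^n$ (sides parallel to the axes) containing $x$. $\|f(x)\|_{\ell^q}=\left(\sum_i|f_i(x)|^q\right)^{1/q}$. A weight is a non-negative, locally integrable function on $\mathbb{R}^n$; $\|g\|_{L^p(w)}=\left(\int|g|^pw\,dx\right)^{1/p}$; for $1<r<\infty$, $r'=r/(r-1)$. A Young function is a function $A:[0,\infty)\to[0,\infty)$ that is continuous, convex and strictly increasing, with $A(0)=0$ and $A(t)/t\to\infty$ as $t\to\infty$. Its associate function is $\bar{A}(t)=\sup_{s>0}\{st-A(s)\}$. The localized Luxemburg norm on a cube $Q$ is $$\|f\|_{A,Q}=\inf\left\{\lambda>0:\frac{1}{|Q|}\int_Q A\left(\frac{|f(x)|}{\lambda}\right)dx\le 1\right\},$$ and $\|f\|_{p,Q}=\left(\frac{1}{|Q|}\int_Q|f|^p\,dx\right)^{1/p}$. A Young function $A$ satisfies the $B_r$ condition, written $A\in B_r$, if for some $c>0$, $\int_c^\infty \frac{A(t)}{t^r}\frac{dt}{t}<\infty$. *)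

(* Defs.v *)
From HB Require Import structures.
From mathcomp Require Import all_boot all_order all_algebra.
From mathcomp Require Import all_classical all_reals all_analysis.

Set Implicit Arguments.
Unset Strict Implicit.
Unset Printing Implicit Defensive.
Import Order.TTheory GRing.Theory Num.Theory.
Import numFieldNormedType.Exports.

Local Open Scope classical_set_scope.
Local Open Scope ring_scope.
Local Open Scope ereal_scope.

(* Lebesgue measure on the Borel (product) sigma-algebra of R^n, as the
   iterated product of the one-dimensional Lebesgue measure. *)
Section borel_lebesgue.
Variable R : realType.
Local Notation Rn n := (n.-tuple (measurableTypeR R)).

Definition cons_pair n (z : measurableTypeR R * Rn n) : Rn n.+1 :=
  [tuple of z.1 :: z.2].

Fixpoint borel_lebesgue (n : nat) : set (Rn n) -> \bar R :=
  if n is m.+1 return set (Rn n) -> \bar R then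
    pushforward (lebesgue_measure \x (@borel_lebesgue m)) (@cons_pair m)
  else dirac [tuple].
Arguments borel_lebesgue : clear implicits.

Lemma measurable_cons_pair n : measurable_fun [set: _] (@cons_pair n).
Proof. exact: measurable_cons. Qed.

Lemma measurable_box n (A : 'I_n -> set (measurableTypeR R)) :
  (forall i, measurable (A i)) ->
  measurable [set x : Rn n | forall i, A i (tnth x i)].
Proof.
move=> mA.
rewrite (_ : [set x : Rn n | forall i, A i (tnth x i)] =
    \bigcap_(i in [set: 'I_n]) ((@tnth n _ ^~ i) @^-1` A i)); last first.
  by apply/seteqP; split=> x /= Ax i; [move=> _|]; exact: Ax.
apply: fin_bigcap_measurable => [|i _]; first exact: finite_finset.
by rewrite -[X in measurable X]setTI; exact: measurable_tnth.
Qed.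

Lemma preimage_cons_pair n (A : set (measurableTypeR R)) (B : set (Rn n)) :
  @cons_pair n @^-1` [set x | A (thead x) /\ B [tuple of behead x]] = A `*` B.
Proof.
apply/seteqP; split=> -[a t] /=; rewrite theadE /=;
  by rewrite (_ : [tuple of _] = t)//; exact: val_inj.
Qed.

Lemma measurable_thead_behead n (A : set (measurableTypeR R)) (B : set (Rn n)) :
  measurable A -> measurable B ->
  measurable [set x : Rn n.+1 | A (thead x) /\ B [tuple of behead x]].
Proof.
move=> mA mB; apply: measurableI.
  rewrite -[X in measurable X]setTI.
  exact: (@measurable_tnth _ (measurableTypeR R) n.+1 ord0).
rewrite -[X in measurable X]setTI.
exact: (@measurable_behead _ (measurableTypeR R) n).
Qed.

Section cons_product.
Variables (n : nat) (m : {sigma_finite_measure set (Rn n) -> \bar R}).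

Definition cons_product : set (Rn n.+1) -> \bar R :=
  pushforward (lebesgue_measure \x m) (@cons_pair n).

Let cons_product0 : cons_product set0 = 0.
Proof. by rewrite /cons_product /pushforward preimage_set0 measure0. Qed.

Let cons_product_ge0 A : 0 <= cons_product A.
Proof. by rewrite /cons_product /pushforward; apply: integral_ge0. Qed.

Let cons_product_sigma_additive : semi_sigma_additive cons_product.
Proof.
pose push : {measure set (Rn n.+1) -> \bar R} :=
  pushforward (lebesgue_measure \x m) (@cons_pair n).
exact: (@measure_semi_sigma_additive _ _ _ (push (@measurable_cons_pair n))).
Qed.

HB.instance Definition _ := isMeasure.Build _ _ _ cons_product
  cons_product0 cons_product_ge0 cons_product_sigma_additive.

Let cons_product_sigma_finite : sigma_finite setT cons_product.
Proof.
have /sigma_finiteP[F [TF ndF Foo]] := sigma_finiteT (@lebesgue_measure R).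
have /sigma_finiteP[G [TG ndG Goo]] := sigma_finiteT m.
exists (fun k => [set x | F k (thead x) /\ G k [tuple of behead x]]).
  apply/seteqP; split=> // x _.
  have [i _ Fi] : (\bigcup_i F i) (thead x) by rewrite -TF.
  have [j _ Gj] : (\bigcup_i G i) [tuple of behead x] by rewrite -TG.
  exists (maxn i j) => //; split.
  - by move: Fi; exact/subsetPset/ndF/leq_maxl.
  - by move: Gj; exact/subsetPset/ndG/leq_maxr.
move=> k; have [mF Fk] := Foo k; have [mG Gk] := Goo k.
split; first exact: measurable_thead_behead.
rewrite /cons_product /pushforward preimage_cons_pair product_measure1E//.
by rewrite lte_mul_pinfty// ge0_fin_numE.
Qed.

HB.instance Definition _ := Measure_isSigmaFinite.Build _ _ _
  cons_product cons_product_sigma_finite.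

End cons_product.

Lemma borel_lebesgue_sigma_finite_measure n :
  {m : {sigma_finite_measure set (Rn n) -> \bar R} |
    m = borel_lebesgue n :> (set (Rn n) -> \bar R)}.
Proof.
elim: n => [|n [m mE]]; first by exists (dirac [tuple]).
by exists (cons_product m); rewrite /= -mE.
Qed.

Let borel_lebesgue0 n : borel_lebesgue n set0 = 0.
Proof. by have [m <-] := borel_lebesgue_sigma_finite_measure n. Qed.

Let borel_lebesgue_ge0 n A : 0 <= borel_lebesgue n A.
Proof. by have [m <-] := borel_lebesgue_sigma_finite_measure n. Qed.

Let borel_lebesgue_sigma_additive n : semi_sigma_additive (borel_lebesgue n).
Proof.
have [m <-] := borel_lebesgue_sigma_finite_measure n.
exact: measure_semi_sigma_additive.
Qed.

HB.instance Definition _ n := isMeasure.Build _ _ _ (borel_lebesgue n)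
  (borel_lebesgue0 n) (@borel_lebesgue_ge0 n) (@borel_lebesgue_sigma_additive n).

Let borel_lebesgue_sigma_finite n : sigma_finite setT (borel_lebesgue n).
Proof.
have [m <-] := borel_lebesgue_sigma_finite_measure n.
exact: sigma_finiteT.
Qed.

HB.instance Definition _ n := Measure_isSigmaFinite.Build _ _ _
  (borel_lebesgue n) (@borel_lebesgue_sigma_finite n).

Lemma borel_lebesgue_box n (A : 'I_n -> set (measurableTypeR R)) :
  (forall i, measurable (A i)) ->
  borel_lebesgue n [set x | forall i, A i (tnth x i)] =
  \prod_(i < n) lebesgue_measure (A i).
Proof.
elim: n A => [|n IH] A mA.
  by rewrite big_ord0 /= diracE mem_set// => -[].
rewrite big_ord_recl -IH//= /pushforward.
have [m mE] := borel_lebesgue_sigma_finite_measure n; rewrite -mE.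
rewrite -product_measure1E//; last exact: (measurable_box (fun i => mA (lift ord0 i))).
congr (_ \x _); apply/seteqP; split=> -[a t] /=.
  move=> Aat; split; first by have := Aat ord0.
  by move=> i; have := Aat (lift ord0 i); rewrite tnthS.
by move=> [Aa At] i; case: (unliftP ord0 i) => [j|] ->; rewrite ?tnthS.
Qed.

End borel_lebesgue.
Arguments borel_lebesgue : clear implicits.

(* Lebesgue measure on R^n: 'R^n carries the sigma-algebra of Lebesgue
   measurable sets, i.e., the Caratheodory sets of the outer measure induced by
   borel_lebesgue. *)
Section euclidean_space.
Variables (R : realType) (n : nat).

Definition Rn := caratheodory_type (borel_lebesgue R n)^*%mu.
HB.instance Definition _ := Measurable.on Rn.

Definition leb : set Rn -> \bar R :=
  @completed_measure_extension _ _ _ (borel_lebesgue R n).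
HB.instance Definition _ := Measure.on leb.

Let leb_sigma_finite : sigma_finite setT leb.
Proof.
apply: completed_measure_extension_sigma_finite.
exact: (@sigma_finiteT _ _ _ (borel_lebesgue R n)).
Qed.

HB.instance Definition _ := Measure_isSigmaFinite.Build _ _ _
  leb leb_sigma_finite.

Definition coordinate (x : Rn) (i : 'I_n) : R := tnth (x : n.-tuple R) i.

Definition cube (a : 'I_n -> R) (l : R) : set Rn :=
  [set x | forall i, (a i <= coordinate x i <= a i + l)%R].

Definition is_cube (Q : set Rn) : Prop :=
  exists a : 'I_n -> R, exists2 l : R, (0 < l)%R & Q = cube a l.

Lemma leb_cube a l : (0 <= l)%R -> leb (cube a l) = (l ^+ n)%:E.
Proof.
move=> l0.
pose A i : set (measurableTypeR R) := `[a i, (a i + l)%R]%classic.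
have mA i : measurable (A i) by exact: measurable_itv.
have -> : cube a l = [set x | forall i, A i (tnth x i)].
  by apply/seteqP; split=> x /= xA i; have := xA i; rewrite /A /= in_itv.
rewrite /leb /completed_measure_extension measurable_mu_extE; last first.
  exact: measurable_box.
apply: etrans (borel_lebesgue_box mA) _.
rewrite (eq_bigr (fun=> l%:E)) => [|i _].
  by rewrite big_const_ord; elim: {mA A a}n => //= k ->; rewrite exprS EFinM.
rewrite lebesgue_measure_itv /= lte_fin ltrDl -EFinD addrAC subrr add0r.
by case: ltgtP l0 => // <-.
Qed.

(* A set of tuples is compact when its image in the normed space of row vectors
   is; tuples carry no topology in the library. *)
Definition Rn_compact (K : set Rn) : Prop :=
  compact [set (\row_i coordinate x i : 'rV[R]_n) | x in K].

Definition weight (w : Rn -> R) : Prop :=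
  [/\ measurable_fun [set: Rn] w, (forall x, 0 <= w x)%R &
    forall K, Rn_compact K -> \int[leb]_(x in K) `|w x|%:E < +oo].

Definition avg (Q : set Rn) (g : Rn -> \bar R) : \bar R :=
  (leb Q)^-1 * \int[leb]_(x in Q) g x.

Definition hl_maximal (g : Rn -> R) (x : Rn) : \bar R :=
  ereal_sup [set avg Q (fun y => `|g y|%:E) | Q in [set Q | is_cube Q /\ Q x]].

Definition lq_norm (q : R) (a : nat -> \bar R) : \bar R :=
  (\sum_(i <oo) `|a i| `^ q) `^ q^-1.

Definition vv_maximal (q : R) (f : nat -> Rn -> R) (x : Rn) : \bar R :=
  lq_norm q (fun i => hl_maximal (f i) x).

Definition weighted_norm (p : R) (w : Rn -> R) (g : Rn -> \bar R) : \bar R :=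
  (\int[leb]_x (`|g x| `^ p * (w x)%:E)) `^ p^-1.

Definition lp_norm_on (p : R) (Q : set Rn) (g : Rn -> \bar R) : \bar R :=
  avg Q (fun x => `|g x| `^ p) `^ p^-1.

(* g may take the value +oo, where er_map extends A by A(+oo) = +oo; the
   infimum of the empty set is +oo. *)
Definition luxemburg (A : R -> R) (Q : set Rn) (g : Rn -> \bar R) : \bar R :=
  ereal_inf [set l%:E | l in [set l : R | (0 < l)%R /\
    avg Q (fun x => er_map A (`|g x| * (l^-1)%:E)) <= 1]].

(* w^r for a weight w, and w^(-r), which is +oo where w vanishes (whereas
   powR 0 (- r) = 0 for r > 0). *)
Definition wpow (w : Rn -> R) (r : R) (x : Rn) : \bar R := (w x `^ r)%:E.
Definition wpowN (w : Rn -> R) (r : R) (x : Rn) : \bar R := (wpow w r x)^-1.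

End euclidean_space.

Section young.
Variable R : realType.
Implicit Types A : R -> R.

(* Only the restriction of A to [0, +oo[ matters; its values there are
   nonnegative since A 0 = 0 and A is increasing. *)
Definition young A : Prop :=
  [/\ {within `[0%R, +oo[, continuous A},
      convex_function (`[0%R, +oo[ : set R^o) A,
      {in `[0%R, +oo[ &, {homo A : s t / (s < t)%R}},
      A 0%R = 0%R &
      (A t / t)%R @[t --> +oo%R] --> +oo%R].

(* The supremum is over a bounded set when t >= 0 and A is a Young function,
   because A(s)/s tends to infinity. *)
Definition associate A (t : R) : R :=
  sup [set (s * t - A s)%R | s in `]0%R, +oo[].

Definition B_condition (r : R) A : Prop :=
  exists2 c : R, (0 < c)%R &
    \int[lebesgue_measure]_(t in `[c, +oo[) (A t / t `^ r / t)%:E < +oo.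

Definition conj_exponent (r : R) : R := (r / (r - 1))%R.

End young.

(* Main.v *)
Require Import Defs.
From mathcomp Require Import all_boot all_order all_algebra.
From mathcomp Require Import all_classical all_reals all_analysis.
From mathcomp Require Import measurable_realfun.
From mathcomp Require Import ring lra.

(** The theorem rests on a sparse domination of the vector-valued maximal
    operator, carried out on grids of cubes.

    By the one-third trick, every cube lies in a cell of comparable size of one
    of [2 ^ n] shifted triadic grids ([cube_in_cell]). So it suffices to bound,
    uniformly in the grid, the maximal sums [vv_maxlev] over finitely many
    functions and finitely many levels ([vv_maximal_integral_le]); the full
    operator is recovered by monotone convergence.

    On a grid, let [F] be the [l^q] norm of the sequence [f] and, for a cell [Q],
    let [a] be the mean of [F] over [Q]. The Fefferman-Stein weak-type
    inequality [vv_weak] says that the maximal sum restricted to the subcells of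
    [Q] exceeds [L * a ^ q] on at most half of [Q]. It follows from a
    Calderon-Zygmund decomposition and from the [L^q] boundedness of the scalar
    maximal operator. The set where the bound fails is a union of cells, and
    on each of them the maximal sum is at most [L * a ^ q] plus the maximal sum
    that starts anew. Induction on the number of levels turns this into the
    principle [sparse_principle]: if [s <= 1] and, for every cell, the mean of
    [F] to the power [q * s] times the mean of [W] is at most [Phi] on the cell,
    then the integral of the maximal sum to the power [s] against [W] is at most
    a constant times the integral of [Phi]. The half of each cell that escapes
    the exceptional set pays for the cell, so that no family of sparse cubes has
    to be named.

    The hypothesis of this principle is verified with Hoelder's inequality for a
    Young function and its associate ([orlicz_holder]), applied to
    [F = (F * v ^ (1/p)) * v ^ (-1/p)], and with the bump condition on the weights;
    [Phi] is then built from the Orlicz maximal function of [F * v ^ (1/p)], which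
    the [B_p] condition bounds on [L^p] ([orlicz_maximal]). For [p <= q] one takes
    [s = p / q] and [W = u] ([two_weight_below]). For [q < p] one takes [s = 1] and
    [W = g * u ^ (q/p)], where [g] ranges over the dual of [L^(p/q)], and a second
    Orlicz maximal function, that of [g], appears ([two_weight_above]). *)

Set Implicit Arguments.
Unset Strict Implicit.
Unset Printing Implicit Defensive.
Import Order.TTheory GRing.Theory Num.Theory.
Import numFieldNormedType.Exports.

Local Open Scope classical_set_scope.
Local Open Scope ring_scope.
Local Open Scope ereal_scope.

(** * Powers and integrals of extended reals *)

Section ereal_power.
Variable R : realType.
Implicit Types (x y : \bar R) (r s : R).

Lemma le_powR r (a b : R) : (0 <= r)%R -> (0 <= a)%R -> (a <= b)%R ->
  (a `^ r <= b `^ r)%R.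
Proof.
by move=> r0 a0 ab; apply: ge0_ler_powR; rewrite // nnegrE// (le_trans a0).
Qed.

Lemma le_poweR r x y : (0 <= r)%R -> 0 <= x -> x <= y -> x `^ r <= y `^ r.
Proof.
move=> r0 x0 xy; apply: gt0_ler_poweR => //; rewrite in_itv/= leey andbT//.
exact: le_trans xy.
Qed.

Lemma lt_poweR r x y : (0 < r)%R -> 0 <= x -> 0 <= y -> x < y -> x `^ r < y `^ r.
Proof.
move=> r0 x0 y0; case: x y x0 y0 => [x| |] [y| |]//; last first.
  by move=> x0 _ _; rewrite [ltRHS]poweRyr ?gt_eqF// ltry.
rewrite !lee_fin !lte_fin => x0 y0 xy.
by rewrite gt0_ltr_powR.
Qed.

Lemma poweRK r x : (r != 0)%R -> 0 <= x -> (x `^ r) `^ r^-1 = x.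
Proof. by move=> r0 x0; rewrite -poweRrM divff// poweRe1. Qed.

Lemma poweRVK r x : (r != 0)%R -> 0 <= x -> (x `^ r^-1) `^ r = x.
Proof. by move=> r0 x0; rewrite -poweRrM mulVf// poweRe1. Qed.

Lemma powR_subadd r (a b : R) : (0 < r)%R -> (r <= 1)%R ->
  (0 <= a)%R -> (0 <= b)%R -> ((a + b) `^ r <= a `^ r + b `^ r)%R.
Proof.
move=> r0 r1 a0 b0; have [ab0|ab0] := eqVneq (a + b)%R 0%R.
  by rewrite ab0 powR0 ?gt_eqF// addr_ge0// powR_ge0.
have abp : (0 < a + b)%R by rewrite lt_neqAle eq_sym ab0 addr_ge0.
(* each proportion t = c / (a + b) satisfies t <= t ^ r *)
have H c : (0 <= c)%R -> (c <= a + b)%R ->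
    (c / (a + b) * (a + b) `^ r <= c `^ r)%R.
  rewrite le_eqVlt => /predU1P[<-|c0] cab; first by rewrite !mul0r powR_ge0.
  have -> : (c `^ r = (c / (a + b)) `^ r * (a + b) `^ r)%R.
    by rewrite -powRM ?divr_ge0 ?(ltW c0) ?(ltW abp)// divfK.
  rewrite ler_wpM2r ?powR_ge0// ger1_powR// ?divr_gt0//=.
  by rewrite ler_pdivrMr// mul1r.
apply: le_trans (lerD (H a a0 _) (H b b0 _)); rewrite ?lerDl ?lerDr//.
by rewrite -mulrDl -mulrDl divff// mul1r.
Qed.

Lemma poweR_subadd r x y : (0 < r)%R -> (r <= 1)%R -> 0 <= x -> 0 <= y ->
  (x + y) `^ r <= x `^ r + y `^ r.
Proof.
move=> r0 r1; case: x y => [x| |] [y| |]// x0 y0.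
- by rewrite /= lee_fin powR_subadd.
- by rewrite !poweRyr ?gt_eqF// addey ?leey.
- by rewrite addye// !poweRyr ?gt_eqF// addye.
- by rewrite addye// !poweRyr ?gt_eqF// addye.
Qed.

Lemma poweR_sum_le (I : Type) (l : seq I) (F : I -> \bar R) r : (0 < r)%R ->
  (forall i, 0 <= F i) ->
  (\sum_(i <- l) F i) `^ r <=
  ((size l)%:R `^ r)%:E * \sum_(i <- l) (F i) `^ r.
Proof.
move=> r0 F0.
(* the sum is at most its number of terms times its largest term *)
have [M [M0 FM Ml]] : exists M, [/\ 0 <= M,
    \sum_(i <- l) F i <= (size l)%:R%:E * M &
    M `^ r <= \sum_(i <- l) (F i) `^ r].
  elim: l => [|i l [M [M0 FM Ml]]].
    by exists 0; rewrite !big_nil poweR0r ?gt_eqF// mule0.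
  exists (maxe (F i) M); split; first by rewrite le_max F0.
    rewrite big_cons /= -[in leRHS]add1n natrD EFinD ge0_muleDl ?lee_fin//.
    rewrite mul1e leeD ?le_max ?lexx//.
    by apply: le_trans FM _; rewrite lee_wpmul2l ?lee_fin// le_max lexx orbT.
  rewrite big_cons maxEle; case: ifPn => _.
    by rewrite (le_trans Ml)// leeDr ?poweR_ge0.
  by rewrite leeDl// sume_ge0// => j _; rewrite poweR_ge0.
apply: le_trans (le_poweR (ltW r0) _ FM) _; first exact: sume_ge0.
rewrite poweRM// ?lee_fin// poweR_EFin.
by rewrite lee_wpmul2l// lee_fin powR_ge0.
Qed.

End ereal_power.

Section integral_monotone.
Context d (T : measurableType d) (R : realType).
Variable mu : {measure set T -> \bar R}.
Implicit Types (D : set T) (f g : T -> \bar R).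

(** The integral of a nonnegative function is a supremum over the simple
    functions below it. This gives monotonicity for arbitrary nonnegative
    functions, such as the maximal function over all cubes. *)
Lemma le_integral_nonneg D f g : (forall x, D x -> 0 <= f x) ->
  (forall x, D x -> f x <= g x) ->
  \int[mu]_(x in D) f x <= \int[mu]_(x in D) g x.
Proof.
move=> f0 fg; have g0 x : D x -> 0 <= g x.
  by move=> Dx; apply: le_trans (f0 _ Dx) (fg _ Dx).
rewrite !ge0_integralE//; apply: ereal_sup_le => _ [h hf <-].
exists h => // x; apply: le_trans (hf x) _.
by rewrite /patch; case: ifPn => // /set_mem /fg.
Qed.

Lemma integral_sup_le (f_ : nat -> T -> \bar R) g (c : \bar R) :
  (forall m, measurable_fun [set: T] (f_ m)) -> (forall m x, 0 <= f_ m x) ->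
  (forall x m, f_ m x <= f_ m.+1 x) ->
  (forall x, 0 <= g x) ->
  (forall x, g x <= ereal_sup (range (f_ ^~ x))) ->
  (forall m, \int[mu]_x f_ m x <= c) ->
  \int[mu]_x g x <= c.
Proof.
move=> mf f0 nd g0 gf fc.
have ndf x : nondecreasing_seq (f_ ^~ x) by apply/nondecreasing_seqP => m; exact: nd.
apply: (@le_trans _ _ (\int[mu]_x limn (f_ ^~ x))).
  apply: le_integral_nonneg => // x _; apply: le_trans (gf x) _.
  by rewrite (cvg_lim _ (ereal_nondecreasing_cvgn (ndf x))).
rewrite monotone_convergence//; apply: lime_le => //; last exact: nearW.
apply: ereal_nondecreasing_is_cvgn => m m' mm'.
by apply: le_integral_nonneg => // x _; exact: ndf.
Qed.

End integral_monotone.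

Lemma measurable_nneseries d (T : measurableType d) (R : realType) (D : set T)
    (h : nat -> T -> \bar R) :
  (forall k x, 0 <= h k x) -> (forall k, measurable_fun D (h k)) ->
  measurable_fun D (fun x => \sum_(i <oo) h i x).
Proof.
by move=> h0 mh; exact: (@ge0_emeasurable_sum _ _ _ D h xpredT (fun k x _ _ => h0 k x)).
Qed.

(** * Means and nested grids *)

Section mean.
Context d (T : measurableType d) (R : realType).
Variable mu : {measure set T -> \bar R}.
Implicit Types (Q : set T) (f g : T -> \bar R).

Definition mean Q g : \bar R := (mu Q)^-1 * \int[mu]_(x in Q) g x.

Lemma mean_ge0 Q g : (forall x, Q x -> 0 <= g x) -> 0 <= mean Q g.
Proof. by move=> g0; rewrite mule_ge0// ?inve_ge0// integral_ge0. Qed.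

Lemma le_mean Q f g : (forall x, Q x -> 0 <= f x) ->
  (forall x, Q x -> f x <= g x) -> mean Q f <= mean Q g.
Proof.
by move=> f0 fg; rewrite lee_wpmul2l ?inve_ge0// le_integral_nonneg.
Qed.

Lemma mulr_mean Q g : 0 < mu Q -> mu Q < +oo ->
  mu Q * mean Q g = \int[mu]_(x in Q) g x.
Proof.
move=> Q0 Qy; rewrite /mean muleA divee ?mul1e ?gt_eqF//.
by rewrite ge0_fin_numE.
Qed.

Lemma mean_le_lty Q g c : 0 < mu Q -> mu Q < +oo ->
  (mean Q g <= c) = (\int[mu]_(x in Q) g x <= mu Q * c).
Proof.
move=> Q0 Qy; rewrite -[in RHS]mulr_mean// lee_pmul2l//.
by rewrite ge0_fin_numE.
Qed.

Lemma mean_gt_lty Q g c : 0 < mu Q -> mu Q < +oo ->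
  (c < mean Q g) = (mu Q * c < \int[mu]_(x in Q) g x).
Proof. by move=> Q0 Qy; rewrite !ltNge mean_le_lty. Qed.

Lemma mean_cst Q c : measurable Q -> 0 < mu Q -> mu Q < +oo ->
  mean Q (fun=> c) = c.
Proof.
move=> mQ Q0 Qy; rewrite /mean integral_cst// muleC -muleA divee ?mule1 ?gt_eqF//.
by rewrite ge0_fin_numE.
Qed.

Lemma mean_eq Q f g : (forall x, Q x -> f x = g x) -> mean Q f = mean Q g.
Proof.
by move=> fg; congr (_ * _); apply: eq_integral => x /set_mem /fg.
Qed.

Lemma meanZl Q g c : measurable Q -> 0 <= c -> (forall x, Q x -> 0 <= g x) ->
  measurable_fun Q g -> mean Q (fun x => c * g x) = c * mean Q g.
Proof. by move=> mQ c0 g0 mg; rewrite /mean ge0_integralZl// muleCA. Qed.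

Lemma meanD Q f g : measurable Q -> (forall x, Q x -> 0 <= f x) ->
  (forall x, Q x -> 0 <= g x) -> measurable_fun Q f -> measurable_fun Q g ->
  mean Q (fun x => f x + g x) = mean Q f + mean Q g.
Proof.
move=> mQ f0 g0 mf mg; rewrite /mean ge0_integralD// ge0_muleDr//;
  exact: integral_ge0.
Qed.

End mean.

Section grid.
Context d (T : measurableType d) (R : realType).
Variable mu : {measure set T -> \bar R}.

(** A decreasing sequence of countable partitions, encoded by the number of the
    part to which a point belongs: cells are level sets of [idx k], so that being
    in a common cell is an equivalence relation by construction. *)
Record grid (b : R) := Grid {
  idx : nat -> T -> nat;
  measurable_idx : forall k n, measurable [set x | idx k x = n];
  idx_nested : forall k x y, idx k.+1 x = idx k.+1 y -> idx k x = idx k y;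
  grid_gt0 : forall k x, 0 < mu [set y | idx k y = idx k x];
  grid_lty : forall k x, mu [set y | idx k y = idx k x] < +oo;
  grid_doubling : forall k x, mu [set y | idx k y = idx k x] <=
    b%:E * mu [set y | idx k.+1 y = idx k.+1 x] }.

Variables (b : R) (G : grid b).

Definition cell k x : set T := [set y | idx G k y = idx G k x].

Lemma cell_eq k x y : cell k x y -> cell k y = cell k x.
Proof. by rewrite /cell /= => ->. Qed.

Lemma cell_sub k x : cell k.+1 x `<=` cell k x.
Proof. by move=> y; exact: idx_nested. Qed.

Lemma measurable_cell k x : measurable (cell k x).
Proof. exact: measurable_idx. Qed.

Lemma cell_gt0 k x : 0 < mu (cell k x). Proof. exact: grid_gt0. Qed.
Lemma cell_lty k x : mu (cell k x) < +oo. Proof. exact: grid_lty. Qed.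

Lemma cell_fin_num k x : mu (cell k x) \is a fin_num.
Proof. by rewrite ge0_fin_numE// cell_lty. Qed.

(** The sets of the sigma-algebra generated by the cells of level [k]. *)
Definition saturated k (A : set T) := forall x, A x -> cell k x `<=` A.

Lemma saturated_setT k : saturated k setT. Proof. by []. Qed.

Lemma saturated_cell k x : saturated k (cell k x).
Proof. by move=> y /cell_eq ->. Qed.

Lemma saturated_cellS k x : saturated k.+1 (cell k x).
Proof. by move=> y /cell_eq <-; exact: cell_sub. Qed.

Lemma saturatedE k A : saturated k A ->
  A = \bigcup_n (A `&` [set x | idx G k x = n]).
Proof.
move=> sA; apply/seteqP; split=> [x Ax|x [n _ []]//].
by exists (idx G k x).
Qed.

Lemma saturated_slice k A n : saturated k A ->
  A `&` [set x | idx G k x = n] = set0 \/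
  exists2 x, A x & A `&` [set x | idx G k x = n] = cell k x.
Proof.
move=> sA; have [->|/set0P[x [Ax xn]]] := eqVneq (A `&` [set x | idx G k x = n]) set0.
  by left.
right; exists x => //; apply/seteqP; split=> y.
  by move=> [_ yn]; rewrite /cell /= yn.
by move=> xy; split; [exact: sA xy|rewrite /= -xn].
Qed.

Lemma measurable_slice k A n : saturated k A ->
  measurable (A `&` [set x | idx G k x = n]).
Proof.
by move=> /(@saturated_slice k A n)[->//|[x _ ->]]; exact: measurable_cell.
Qed.

Lemma measurable_saturated k A : saturated k A -> measurable A.
Proof.
move=> sA; rewrite (saturatedE sA); apply: bigcupT_measurable => n.
exact: measurable_slice.
Qed.

Definition adapted (U : Type) k (f : T -> U) := forall x y, cell k x y -> f y = f x.

Lemma measurable_adapted k (f : T -> \bar R) : adapted k f ->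
  measurable_fun [set: T] f.
Proof.
move=> af _ Y mY; rewrite setTI; apply: (@measurable_saturated k) => x /= Yx y.
by move=> /af /= fE; rewrite /preimage /= fE.
Qed.

Lemma integral_slices k A (f : T -> \bar R) : saturated k A ->
  measurable_fun [set: T] f -> (forall x, 0 <= f x) ->
  \int[mu]_(x in A) f x =
  \sum_(n <oo) \int[mu]_(x in A `&` [set x | idx G k x = n]) f x.
Proof.
move=> sA mf f0; rewrite [in LHS](saturatedE sA) ge0_integral_bigcup//.
- by move=> n; exact: measurable_slice.
- exact: measurable_funTS.
- apply/trivIsetP => i j _ _ ij; apply/seteqP; split=> // x [[_ /= xi] [_ /= xj]].
  by move: ij; rewrite -xi xj eqxx.
Qed.

(** A saturated set is a countable disjoint union of cells, over which integral
    inequalities add up. *)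
Lemma le_integral_cells k A (f g : T -> \bar R) : saturated k A ->
  measurable_fun [set: T] f -> measurable_fun [set: T] g ->
  (forall x, 0 <= f x) -> (forall x, 0 <= g x) ->
  (forall x, A x -> \int[mu]_(y in cell k x) f y <= \int[mu]_(y in cell k x) g y) ->
  \int[mu]_(x in A) f x <= \int[mu]_(x in A) g x.
Proof.
move=> sA mf mg f0 g0 fg; rewrite !(integral_slices sA)//.
apply: lee_nneseries => [n _ _|n _]; first by apply: integral_ge0.
have [->|[x Ax ->]] := saturated_slice n sA; last exact: fg.
by rewrite !integral_set0.
Qed.

Definition cavg k (f : T -> \bar R) x := mean mu (cell k x) f.

Lemma cavg_adapted k f : adapted k (cavg k f).
Proof. by move=> x y /cell_eq; rewrite /cavg => ->. Qed.

Lemma cavg_eq k f x y : cell k x y -> cavg k f y = cavg k f x.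
Proof. exact: cavg_adapted. Qed.

Lemma cavg_ge0 k f x : (forall y, 0 <= f y) -> 0 <= cavg k f x.
Proof. by move=> f0; rewrite mean_ge0. Qed.

Lemma measurable_cavg k f : measurable_fun [set: T] (cavg k f).
Proof. exact: measurable_adapted (@cavg_adapted k f). Qed.

Lemma mulr_cavg k f x : mu (cell k x) * cavg k f x = \int[mu]_(y in cell k x) f y.
Proof. by rewrite mulr_mean// (cell_gt0, cell_lty). Qed.

Lemma integral_cell_cst k x (c : \bar R) (f : T -> \bar R) :
  (forall y, cell k x y -> f y = c) -> \int[mu]_(y in cell k x) f y = mu (cell k x) * c.
Proof.
move=> fc; rewrite muleC -integral_cst; last exact: measurable_cell.
by apply: eq_integral => y /set_mem /fc.
Qed.

Lemma cavg_doubling k f x : (forall y, 0 <= f y) -> measurable_fun [set: T] f ->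
  cavg k.+1 f x <= b%:E * cavg k f x.
Proof.
move=> f0 mf.
rewrite /cavg mean_le_lty ?cell_gt0 ?cell_lty//.
apply: (@le_trans _ _ (\int[mu]_(y in cell k x) f y)).
  apply: ge0_subset_integral; [exact: measurable_cell..| | |exact: cell_sub] => //.
  exact: measurable_funTS.
rewrite -mulr_cavg [leRHS]muleCA [leRHS]muleA lee_wpmul2r ?cavg_ge0//.
exact: grid_doubling.
Qed.

(** The maximum of [N k x], ..., [N (k + m) x]; the recursion on [m] reflects
    the descent from a cell to its children. *)
Fixpoint maxlev (N : nat -> T -> \bar R) m k x : \bar R :=
  if m is m'.+1 then maxe (N k x) (maxlev N m' k.+1 x) else N k x.

Lemma maxlev_ge0 N m k x : (forall l y, 0 <= N l y) -> 0 <= maxlev N m k x.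
Proof. by case: m => [|m] N0 //=; rewrite le_max N0. Qed.

Lemma le_maxlev N N' m k x : (forall l, N l x <= N' l x) ->
  maxlev N m k x <= maxlev N' m k x.
Proof.
move=> NN'; elim: m k => [//|m IH] k /=.
by rewrite ge_max !le_max NN' IH orbT.
Qed.

Lemma maxlev_ub N m k x l : (l <= m)%N -> N (k + l)%N x <= maxlev N m k x.
Proof.
elim: m k l => [|m IH] k [|l]//= lm; rewrite ?addn0 ?lexx// le_max ?lexx//.
by rewrite -addSnnS IH ?orbT.
Qed.

Lemma measurable_maxlev N m k : (forall l, measurable_fun [set: T] (N l)) ->
  measurable_fun [set: T] (maxlev N m k).
Proof. by move=> mN; elim: m k => [//|m IH] k; exact: measurable_maxe. Qed.

(** On a cell where [N k] exceeds [t] the whole cell is charged to its own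
    integral; on the other cells the maximum is taken over the children. *)
Lemma maxlev_weak N (Psi : T -> \bar R) (t : \bar R) m k x :
  (forall l, adapted l (N l)) ->
  measurable_fun [set: T] Psi -> (forall y, 0 <= Psi y) ->
  (forall l y, t < N l y -> mu (cell l y) <= \int[mu]_(z in cell l y) Psi z) ->
  mu (cell k x `&` [set y | t < maxlev N m k y]) <= \int[mu]_(z in cell k x) Psi z.
Proof.
move=> aN mPsi Psi0 H.
have mN l : measurable_fun setT (N l) by exact: measurable_adapted (aN l).
have mtN m' k' : measurable [set y | t < maxlev N m' k' y].
  rewrite -[X in measurable X]setTI; apply: emeasurable_fun_o_infty => //.
  exact: measurable_maxlev.
have mc k' y := measurable_cell k' y.
have sub k' y m' : mu (cell k' y `&` [set z | t < maxlev N m' k' z]) <= mu (cell k' y).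
  by rewrite le_measure ?inE//; exact: measurableI.
elim: m k x => [|m IH] k x;
  (have [tN|tN] := ltP t (N k x); first exact: le_trans (sub _ _ _) (H _ _ tN)).
  rewrite (_ : _ `&` _ = set0) ?measure0 ?integral_ge0//.
  by apply/seteqP; split=> // y [/aN /= ->]; rewrite ltNge tN.
rewrite (_ : _ `&` _ = cell k x `&` [set y | t < maxlev N m k.+1 y]); last first.
  apply/seteqP; split=> y [xy] /=; rewrite lt_max; last by move=> ->; rewrite orbT.
  by rewrite (aN _ _ _ xy) ltNge tN.
pose S : set T := [set z | t < maxlev N m k.+1 z].
have cE y k' : mu (cell k' y `&` S) = \int[mu]_(z in cell k' y) (\1_S z : R)%:E.
  have -> := integral_indic mu (mc k' y) (mtN m k.+1 : measurable S).
  by rewrite setIC.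
have mS : measurable_fun [set: T] (fun z => (\1_S z : R)%:E).
  by apply/measurable_EFinP; apply: measurable_indic; exact: mtN.
have S0 z : 0 <= (\1_S z : R)%:E by rewrite lee_fin.
rewrite cE; apply: (le_integral_cells (@saturated_cellS k x) mS mPsi S0 Psi0).
by move=> y _; rewrite -cE; exact: IH.
Qed.

End grid.

(** * Dyadic level sets *)

Section dyadic_levels.
Variable R : realType.

(** All the integers, hence all the powers of two, as a sequence. *)
Definition dexp (k : nat) : int := if odd k then Negz k./2 else Posz k./2.

Definition dyad k : R := (2 ^ dexp k)%R.

Lemma dexp_inj : injective dexp.
Proof.
move=> i j; rewrite /dexp => ij; rewrite -(odd_double_half i) -(odd_double_half j).
by move: ij; case: (odd i); case: (odd j) => // -[->].
Qed.

Lemma dyad_gt0 k : (0 < dyad k)%R. Proof. by rewrite /dyad exprz_gt0. Qed.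

Lemma dyad_sep i j : i <> j -> (2 * dyad i <= dyad j)%R \/ (2 * dyad j <= dyad i)%R.
Proof.
have H m n : (dexp m < dexp n)%R -> (2 * dyad m <= dyad n)%R.
  rewrite -lez1D => mn; rewrite /dyad -{1}(expr1z 2%R) -exprzDr ?unitfE ?pnatr_eq0//.
  by rewrite ler_weXz2l// ler1n.
move=> ij; have : dexp i != dexp j by apply/eqP => /dexp_inj.
by rewrite neq_lt => /orP[/H|/H]; [left|right].
Qed.

Lemma dyad_below (z : R) : (0 < z)%R -> exists k, (dyad k < z <= 2 * dyad k)%R.
Proof.
move=> z0; have [z1|z1] := ltP 1%R z.
  have ex : exists j, (z <= 2 ^+ j :> R)%R.
    exists (Num.truncn z).+1; apply: ltW; apply: lt_trans (truncnS_gt z) _.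
    by rewrite -natrX ltr_nat ltn_expl.
  case: (ex_minnP ex) => -[|j] zj jmin; first by move: zj; rewrite expr0 leNgt z1.
  exists j.*2; rewrite /dyad /dexp odd_double doubleK -exprnP -exprS zj andbT.
  by rewrite ltNge; apply/negP => /jmin; rewrite ltnn.
have ex : exists j, ((2 ^+ j)^-1 < z :> R)%R.
  exists (Num.truncn z^-1).+1; rewrite -[ltRHS]invrK ltf_pV2 ?posrE ?invr_gt0//.
  by apply: lt_trans (truncnS_gt z^-1) _; rewrite -natrX ltr_nat ltn_expl.
case: (ex_minnP ex) => -[|j] zj jmin.
  by move: zj; rewrite expr0 invr1 ltNge z1.
exists j.*2.+1; rewrite /dyad /dexp /= odd_double/= uphalf_double NegzE -exprnN zj/=.
rewrite exprS invfM mulrA divff ?pnatr_eq0// mul1r leNgt.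
by apply/negP => /jmin; rewrite ltnn.
Qed.

(** The layer-cake formula over dyadic heights: the power of two just below [y]
    alone contributes [y ^ p] up to a constant. *)
Lemma poweR_layer_le (p : R) (y : \bar R) : (0 < p)%R -> 0 <= y ->
  y `^ p <= (2 `^ p)%:E *
    \sum_(k <oo) ((dyad k `^ p)%:E * ((dyad k)%:E < y)%E%:R%:E).
Proof.
move=> p0 y0.
have T0 k : 0 <= (dyad k `^ p)%:E * ((dyad k)%:E < y)%E%:R%:E.
  by rewrite mule_ge0// lee_fin// powR_ge0.
have H (z : R) : (0 < z)%R -> z%:E <= y -> (z `^ p)%:E <= (2 `^ p)%:E *
    \sum_(k <oo) ((dyad k `^ p)%:E * ((dyad k)%:E < y)%E%:R%:E).
  move=> z0 zy; have [k /andP[kz zk]] := dyad_below z0.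
  apply: (@le_trans _ _ ((2 `^ p)%:E * (dyad k `^ p)%:E)).
    rewrite -EFinM -powRM ?(ltW (dyad_gt0 k))// lee_fin.
    exact: le_powR (ltW p0) (ltW z0) zk.
  rewrite lee_wpmul2l ?lee_fin ?powR_ge0//.
  have -> : (dyad k `^ p)%:E = (dyad k `^ p)%:E * ((dyad k)%:E < y)%E%:R%:E.
    by rewrite (lt_le_trans _ zy) ?mule1// lte_fin.
  apply: le_trans (@nneseries_lim_ge _ _ xpredT 0 k.+1 (fun i _ _ => T0 i)).
  by rewrite big_nat_recr//= leeDr// sume_ge0.
case: y y0 T0 H => [y| |]// y0 T0 H.
  move: y0; rewrite lee_fin le_eqVlt => /predU1P[<-|y0]; last exact: H.
  rewrite poweR0r ?gt_eqF// mule_ge0 ?lee_fin ?powR_ge0// nneseries_ge0// => k _ _.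
  by rewrite mule_ge0// lee_fin ?powR_ge0.
rewrite [X in _ <= X](_ : _ = +oo) ?leey//; apply/eqyP => r r0.
have := H (r `^ p^-1)%R; rewrite powR_gt0// => /(_ isT (leey _)).
by rewrite -powRrM mulVf ?gt_eqF// powRr1// ltW.
Qed.

End dyadic_levels.

Section Bp_series.
Variables (R : realType) (D : R -> R) (p : R).
Hypotheses (D_homo : {homo D : x y / (x <= y)%R}) (D0 : D 0%R = 0%R).
Hypothesis p0 : (0 < p)%R.

Let g (t : R) : \bar R := (D t * t `^ (- (p + 1)))%:E.

Let D_ge0 t : (0 <= t)%R -> (0 <= D t)%R.
Proof. by move=> t0; rewrite -D0 D_homo. Qed.

Let g0 t : (0 <= t)%R -> 0 <= g t.
Proof. by move=> t0; rewrite lee_fin mulr_ge0 ?powR_ge0 ?D_ge0. Qed.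

Let mg : measurable_fun [set: R] g.
Proof.
apply/measurable_EFinP; apply: measurable_funM.
  exact: (nondecreasing_measurable measurableT).
exact: measurable_powR.
Qed.

Let gE t : (0 < t)%R -> (D t / t `^ p / t)%:E = g t.
Proof.
move=> t0; rewrite /g powRN powRD ?(gt_eqF t0)/= ?implybT//.
by rewrite powRr1 ?ltW// invfM mulrA.
Qed.

Lemma B_condition_lty (e : R) : (0 < e)%R -> B_condition p D ->
  \int[lebesgue_measure]_(t in `[e, +oo[) g t < +oo.
Proof.
move=> e0 [c c0 cD].
have {}cD : \int[lebesgue_measure]_(t in `[c, +oo[) g t < +oo.
  apply: le_lt_trans cD; apply: le_integral_nonneg => t /=;
    rewrite in_itv/= andbT => ct; first by rewrite g0// (le_trans _ ct)// ltW.
  by rewrite gE// (lt_le_trans c0).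
have [ce|ec] := leP c e.
  apply: le_lt_trans cD; apply: ge0_subset_integral => //.
  - exact: measurable_funTS.
  - by move=> t /=; rewrite in_itv/= andbT => ct; rewrite g0// (le_trans _ ct)// ltW.
  - by apply: subset_itvr; rewrite bnd_simp.
rewrite (_ : `[e, +oo[%classic = `[e, c[%classic `|` `[c, +oo[%classic); last first.
  apply/seteqP; split=> t /=; rewrite !in_itv/= !andbT.
    by move=> et; have [ct|tc] := leP c t; [right|left; rewrite et].
  by case=> [/andP[]//|ct]; rewrite (le_trans (ltW ec)).
rewrite ge0_integral_setU//; last 3 first.
- exact: measurable_funTS.
- move=> t /= [|]; rewrite in_itv/= ?andbT.
    by move=> /andP[et _]; rewrite g0// (le_trans _ et)// ltW.
  by move=> ct; rewrite g0// (le_trans _ ct)// ltW.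
- rewrite disj_set2E; apply/eqP/seteqP; split=> // t /= []; rewrite !in_itv/= andbT.
  by move=> /andP[_ tc]; rewrite leNgt tc.
rewrite lte_add_pinfty//.
apply: (@le_lt_trans _ _ (\int[lebesgue_measure]_(t in `[e, c[)
    cst (D c * e `^ (- (p + 1)))%:E t)).
  apply: le_integral_nonneg => t /=; rewrite in_itv/= => /andP[et tc].
    by rewrite g0// (le_trans _ et)// ltW.
  have t0 := lt_le_trans e0 et.
  rewrite lee_fin; apply: ler_pM; [exact: D_ge0 (ltW t0)|exact: powR_ge0|exact: D_homo (ltW tc)|].
  rewrite !powRN lef_pV2 ?posrE ?powR_gt0 ?(lt_le_trans e0 et)//.
  exact: le_powR (addr_ge0 (ltW p0) ler01) (ltW e0) et.
rewrite integral_cst//= lebesgue_measure_itv/= lte_fin ec.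
by rewrite -EFinB -EFinM ltry.
Qed.

Let g_lower (s : R) : (0 < s)%R ->
  (2 `^ (- (p + 1)) * (s `^ (- p) * D s))%:E <=
  \int[lebesgue_measure]_(t in `[s, (2 * s)%R[) g t.
Proof.
move=> s0.
apply: (@le_trans _ _ (\int[lebesgue_measure]_(t in `[s, (2 * s)%R[)
    cst (D s * (2 * s) `^ (- (p + 1)))%:E t)).
  rewrite integral_cst//= lebesgue_measure_itv/= lte_fin.
  rewrite (_ : s < 2 * s)%R; last by rewrite ltr_pMl// ltr1n.
  rewrite -EFinB -EFinM lee_fin powRM ?(ltW s0)//.
  rewrite [X in (_ <= X)%R](_ : _ = 2 `^ (- (p + 1)) *
     ((s `^ (- (p + 1)) * s `^ 1) * D s))%R; last by rewrite powRr1 ?ltW//; ring.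
  by rewrite -powRD ?(gt_eqF s0) ?implybT// opprD addrNK.
apply: le_integral_nonneg => t /=; rewrite in_itv/= => /andP[st ts].
  by rewrite lee_fin mulr_ge0 ?powR_ge0 ?D_ge0 ?ltW.
have t0 := lt_le_trans s0 st.
rewrite lee_fin; apply: ler_pM; [exact: D_ge0 (ltW s0)|exact: powR_ge0|exact: D_homo|].
rewrite !powRN lef_pV2 ?posrE ?powR_gt0 ?mulr_gt0//.
exact: le_powR (addr_ge0 (ltW p0) ler01) (ltW t0) (ltW ts).
Qed.

(** The intervals [[s, 2s[] attached to the ratios [s = h / dyad k] are disjoint,
    so that the series is dominated by the integral of the [B_condition]. *)
Lemma Bp_series_le (e : R) : (0 < e)%R -> B_condition p D ->
  exists2 C : R, (0 < C)%R & forall h : \bar R, 0 <= h ->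
    \sum_(k <oo) ((dyad R k `^ p)%:E *
      (if (e * dyad R k)%:E < h then er_map D (h * ((dyad R k)^-1)%:E) else 0))
    <= C%:E * h `^ p.
Proof.
move=> e0 /(B_condition_lty e0); set J := (X in X < +oo) => Joo.
have J0 : 0 <= J.
  apply: integral_ge0 => t /=; rewrite in_itv/= andbT => et.
  by rewrite g0// (le_trans _ et)// ltW.
have Jfin : J \is a fin_num by rewrite ge0_fin_numE.
have F0 : (0 <= fine J)%R by rewrite fine_ge0.
exists (2 `^ (p + 1) * fine J + 1)%R.
  by rewrite ltr_wpDl// mulr_ge0// powR_ge0.
case=> [h| |]// h0; last first.
  rewrite [X in _ <= _ * X]poweRyr ?gt_eqF// mulry gtr0_sg ?mul1e ?leey//.
  by rewrite ltr_wpDl// mulr_ge0// powR_ge0.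
move: h0; rewrite lee_fin le_eqVlt => /predU1P[<-|h0].
  rewrite eseries0 ?poweR0r ?gt_eqF// ?mule0// => k _ _.
  by rewrite lte_fin ltNge mulr_ge0 ?(ltW e0) ?(ltW (dyad_gt0 R k))// mule0.
pose s k := (h / dyad R k)%R.
have s0 k : (0 < s k)%R by rewrite divr_gt0// dyad_gt0.
have ssep i j : (2 * dyad R i <= dyad R j)%R -> (2 * s j <= s i)%R.
  move=> ij; rewrite /s ler_pdivlMr ?dyad_gt0//.
  rewrite (_ : 2 * _ * _ = h * (2 * dyad R i / dyad R j))%R; last by ring.
  by rewrite ler_piMr ?(ltW h0)// ler_pdivrMr ?dyad_gt0// mul1r.
pose F k : set R := `[s k, (2 * s k)%R[%classic `&` `[e, +oo[%classic.
have mF k : measurable (F k) by exact: measurableI.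
have Fg k t : F k t -> 0 <= g t.
  by move=> [_ /=]; rewrite in_itv/= andbT => et; rewrite g0// (le_trans _ et)// ltW.
apply: (@le_trans _ _ ((h `^ p * 2 `^ (p + 1))%:E * \sum_(k <oo)
    \int[lebesgue_measure]_(t in F k) g t)); last first.
  rewrite -(@ge0_integral_bigcup _ _ _ (@lebesgue_measure R) F g)//; last 3 first.
  - exact: measurable_funTS.
  - by move=> t [k _]; exact: Fg.
  - apply/trivIsetP => i j _ _ /eqP ij; apply/seteqP; split=> // t [[/= +  _] [/= + _]].
    rewrite !in_itv/= => /andP[it ti] /andP[jt tj].
    have [/ssep|/ssep] := dyad_sep R ij.
      by move=> /le_trans/(_ it); rewrite leNgt tj.
    by move=> /le_trans/(_ jt); rewrite leNgt ti.
  apply: (@le_trans _ _ ((h `^ p * 2 `^ (p + 1))%:E * J)).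
    rewrite lee_wpmul2l ?lee_fin ?mulr_ge0 ?powR_ge0//.
    apply: ge0_subset_integral => //.
    - exact: bigcupT_measurable.
    - exact: measurable_funTS.
    - by move=> t /=; rewrite in_itv/= andbT => et; rewrite g0// (le_trans _ et)// ltW.
    - by move=> t [k _ []].
  rewrite -(fineK Jfin) /= -!EFinM lee_fin mulrDl mul1r mulrAC [leLHS]mulrC mulrA.
  by rewrite mulrAC lerDl powR_ge0.
rewrite -nneseriesZl; last by move=> k _; apply: integral_ge0; exact: Fg.
apply: lee_nneseries => [k _ _|k _].
  rewrite mule_ge0 ?lee_fin ?powR_ge0//; case: ifPn => // _.
  by rewrite lee_fin D_ge0 ?ltW//; exact: s0.
case: ifPn => [eh|_]; last first.
  rewrite mule0 mule_ge0 ?lee_fin ?mulr_ge0 ?powR_ge0//.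
  by apply: integral_ge0; exact: Fg.
have es : (e < s k)%R by rewrite /s ltr_pdivlMr ?dyad_gt0// -lte_fin.
rewrite (_ : F k = `[s k, (2 * s k)%R[%classic); last first.
  apply/seteqP; split=> [t []//|t /=]; rewrite /F /= !in_itv/= !andbT => /andP[st ts].
  by rewrite st ts (le_trans (ltW es) st).
apply: le_trans (lee_wpmul2l _ (g_lower (s0 k))); last first.
  by rewrite lee_fin mulr_ge0 ?powR_ge0.
rewrite -EFinM lee_fin -/(s k).
have hE : (h `^ p = s k `^ p * dyad R k `^ p)%R.
  by rewrite -powRM ?(ltW (s0 k)) ?(ltW (dyad_gt0 R k))// /s divfK// gt_eqF// dyad_gt0.
have s1 : (s k `^ p != 0)%R by rewrite gt_eqF// powR_gt0.
have d1 : (2 `^ (p + 1) != 0 :> R)%R by rewrite gt_eqF// powR_gt0.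
rewrite hE !powRN le_eqVlt; apply/orP; left; apply/eqP.
by field; rewrite s1 d1.
Qed.

End Bp_series.

(** * The Orlicz maximal theorem *)

Section orlicz.
Context d (T : measurableType d) (R : realType).
Variable mu : {measure set T -> \bar R}.

Lemma le_er_map (D : R -> R) : {homo D : x y / (x <= y)%R} ->
  {homo er_map D : x y / x <= y}.
Proof. by move=> DH [x| |] [y| |]//=; rewrite ?lee_fin ?leey ?leNye//; exact: DH. Qed.

(** The Luxemburg norm for the normalized measure on [Q]. *)
Definition orlicz (D : R -> R) (Q : set T) (h : T -> \bar R) : \bar R :=
  ereal_inf [set l%:E | l in [set l : R | (0 < l)%R /\
    mean mu Q (fun x => er_map D (h x * (l^-1)%:E)) <= 1]].

Lemma orlicz_ge0 D Q h : 0 <= orlicz D Q h.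
Proof. by apply: le_ereal_inf_tmp => _ [l [l0 _] <-]; rewrite lee_fin ltW. Qed.

Lemma orlicz_gt D Q h (t : R) : (0 < t)%R -> t%:E < orlicz D Q h ->
  1 < mean mu Q (fun x => er_map D (h x * (t^-1)%:E)).
Proof.
move=> t0; rewrite !ltNge; apply: contra => tQ; apply: ereal_inf_lbound.
by exists t.
Qed.

Lemma orlicz_lt D Q h (t : \bar R) : orlicz D Q h < t ->
  exists l : R, [/\ (0 < l)%R, l%:E < t &
    mean mu Q (fun x => er_map D (h x * (l^-1)%:E)) <= 1].
Proof. by move=> /ereal_inf_lt[_ [l [l0 lQ] <-] lt]; exists l. Qed.

Section maximal.
Variables (D : R -> R) (p e : R).
Hypotheses (D_homo : {homo D : x y / (x <= y)%R}) (D0 : D 0%R = 0%R).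
Hypotheses (p0 : (0 < p)%R) (e0 : (0 < e)%R) (De : (D e <= 2^-1)%R).

Lemma er_map_ge0 (x : \bar R) : 0 <= x -> 0 <= er_map D x.
Proof. by move=> x0; rewrite -[leLHS]/(0%:E) -D0 -[leLHS]/(er_map D 0%:E) le_er_map. Qed.

Lemma measurable_er_mapM (h : T -> \bar R) (t : R) : measurable_fun [set: T] h ->
  measurable_fun [set: T] (fun x => er_map D (h x * t%:E)).
Proof.
move=> mh.
apply: (@measurableT_comp _ _ _ _ _ _ (er_map D) setT (fun x => h x * t%:E)).
  by apply: (@measurable_er_map _ T R D); exact: (nondecreasing_measurable measurableT).
by apply: emeasurable_funM => //; exact: measurable_cst.
Qed.

Variables (b : R) (G : grid mu b).

Let Psi (h : T -> \bar R) (t : R) x : \bar R :=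
  if (e * t)%:E < h x then er_map D (h x * (t^-1)%:E) else 0.

Let Psi0 h t x : (0 < t)%R -> (forall x, 0 <= h x) -> 0 <= Psi h t x.
Proof.
move=> t0 h0; rewrite /Psi; case: ifPn => // _; rewrite er_map_ge0// mule_ge0//.
by rewrite lee_fin invr_ge0 ltW.
Qed.

Let mPsi h t : measurable_fun [set: T] h -> measurable_fun [set: T] (Psi h t).
Proof.
move=> mh; apply: measurable_fun_ifT => //; last exact: measurable_er_mapM.
by apply: measurable_fun_lte.
Qed.

(** Only the part of [h] above [e * t] contributes, since below it the values
    of [D] average to at most one half. *)
Lemma orlicz_weak (h : T -> \bar R) (t : R) k x : measurable_fun [set: T] h ->
  (forall x, 0 <= h x) -> (0 < t)%R -> t%:E < orlicz D (cell G k x) h ->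
  mu (cell G k x) <= \int[mu]_(y in cell G k x) (2%:E * Psi h t y).
Proof.
move=> mh h0 t0 /(orlicz_gt t0).
have mQ := measurable_cell G k x.
have P0 y : 0 <= Psi h t y by exact: Psi0.
have mP := measurable_funTS (mPsi t mh) : measurable_fun (cell G k x) _.
rewrite mean_gt_lty ?cell_gt0 ?cell_lty// mule1 => /ltW QD.
have : mu (cell G k x) <= \int[mu]_(y in cell G k x) ((2^-1)%:E + Psi h t y).
  apply: le_trans QD _; apply: le_integral_nonneg => y _.
    by rewrite er_map_ge0// mule_ge0// lee_fin invr_ge0 ltW.
  rewrite /Psi; case: ifPn => [_|]; first by rewrite leeDr// lee_fin.
  rewrite -leNgt => het; rewrite adde0 (@le_trans _ _ (er_map D e%:E))//.
  by rewrite le_er_map// lee_pdivrMr// -EFinM.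
rewrite ge0_integralD//.
rewrite integral_cst// ge0_integralZl//.
have Qfin := cell_fin_num G k x.
rewrite -(fineK Qfin) -EFinM.
have : 0 <= \int[mu]_(y in cell G k x) Psi h t y by apply: integral_ge0.
case: (\int[mu]_(y in _) _) => [r| |]//=.
  by rewrite -EFinD -EFinM !lee_fin => _; lra.
by rewrite mulry gtr0_sg ?mul1e ?leey.
Qed.

Lemma maxlev_weak_saturated N (Ps : T -> \bar R) (t : \bar R) m k A :
  saturated G k A -> (forall l, adapted G l (N l)) ->
  measurable_fun [set: T] Ps -> (forall y, 0 <= Ps y) ->
  (forall l y, t < N l y -> mu (cell G l y) <= \int[mu]_(z in cell G l y) Ps z) ->
  mu (A `&` [set y | t < maxlev N m k y]) <= \int[mu]_(z in A) Ps z.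
Proof.
move=> sA aN mPs Ps0 H; pose S : set T := [set y | t < maxlev N m k y].
have mS : measurable S.
  rewrite -[X in measurable X]setTI; apply: emeasurable_fun_o_infty => //.
  by apply: measurable_maxlev => l; exact: measurable_adapted (aN l).
have cE C : measurable C -> mu (C `&` S) = \int[mu]_(z in C) (\1_S z : R)%:E.
  by move=> mC; have -> := integral_indic mu mC mS; rewrite setIC.
rewrite -/S cE; last exact: measurable_saturated sA.
have mi : measurable_fun [set: T] (fun z => (\1_S z : R)%:E).
  by apply/measurable_EFinP; apply: measurable_indic.
have S0 z : 0 <= (\1_S z : R)%:E by rewrite lee_fin.
apply: (le_integral_cells sA mi mPs S0 Ps0) => x _.
by rewrite -cE; [exact: maxlev_weak|exact: measurable_cell].
Qed.

End maximal.

(** The weak-type bounds at dyadic heights are added up by the layer-cake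
    formula. The sum over the heights is the series of [Bp_series_le] at each
    point, so that the constant does not depend on the grid. *)
Lemma orlicz_maximal (D : R -> R) (p e : R) :
  {homo D : x y / (x <= y)%R} -> D 0%R = 0%R -> (0 < p)%R ->
  (0 < e)%R -> (D e <= 2^-1)%R -> B_condition p D ->
  exists2 C : R, (0 < C)%R & forall (b : R) (G : grid mu b) (h : T -> \bar R) m k A,
    measurable_fun [set: T] h -> (forall x, 0 <= h x) -> saturated G k A ->
    \int[mu]_(x in A) (maxlev (fun l y => orlicz D (cell G l y) h) m k x) `^ p
    <= C%:E * \int[mu]_(x in A) (h x `^ p).
Proof.
move=> D_homo D0 p0 e0 De Bp.
have [C C0 HC] := Bp_series_le D_homo D0 p0 e0 Bp.
exists (2 `^ p * (2 * C))%R; first by rewrite !mulr_gt0// powR_gt0.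
move=> b G h m k A mh h0 sA.
pose M := maxlev (fun l y => orlicz D (cell G l y) h) m k.
pose Psi t x : \bar R := if (e * t)%:E < h x then er_map D (h x * (t^-1)%:E) else 0.
have mA := measurable_saturated sA.
have mM : measurable_fun setT M.
  apply: measurable_maxlev => l.
  by apply: (measurable_adapted (G := G) (k := l)) => x y /cell_eq ->.
have mPsi t : measurable_fun setT (Psi t).
  apply: measurable_fun_ifT => //; last exact: measurable_er_mapM.
  exact: measurable_fun_lte.
have Psi0 t x : (0 < t)%R -> 0 <= Psi t x.
  move=> t0; rewrite /Psi; case: ifPn => // _; rewrite er_map_ge0// mule_ge0//.
  by rewrite lee_fin invr_ge0 ltW.
pose dy := dyad R.
have dy0 j : (0 < dy j)%R by exact: dyad_gt0.
have mS t : measurable [set x | t < M x].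
  by rewrite -[X in measurable X]setTI; exact: emeasurable_fun_o_infty.
have weak j : mu (A `&` [set x | (dy j)%:E < M x]) <=
    \int[mu]_(x in A) (2%:E * Psi (dy j) x).
  apply: (@maxlev_weak_saturated b G) => //.
  - by move=> l x y /cell_eq ->.
  - by apply: emeasurable_funM => //; exact: measurable_cst.
  - by move=> y; rewrite mule_ge0// Psi0.
  - by move=> l y; apply: orlicz_weak.
pose S j : set T := [set x | (dy j)%:E < M x].
have indE j x : (((dy j)%:E < M x)%E%:R)%:E = (\1_(S j) x : R)%:E.
  rewrite indicE; congr ((nat_of_bool _)%:R%:E).
  by apply/idP/idP => [jx|/set_mem//]; exact: mem_set.
have mi j : measurable_fun [set: T] (fun x => (((dy j)%:E < M x)%E%:R)%:E : \bar R).
  under eq_fun do rewrite indE; apply/measurable_EFinP; apply: measurable_indic.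
  exact: mS.
apply: (@le_trans _ _ (\int[mu]_(x in A) ((2 `^ p)%:E *
    \sum_(j <oo) ((dy j `^ p)%:E * (((dy j)%:E < M x)%E%:R)%:E)))).
  apply: le_integral_nonneg => x _; first exact: poweR_ge0.
  by apply: poweR_layer_le => //; apply: maxlev_ge0 => l y; exact: orlicz_ge0.
have mind j : measurable_fun A (fun x => (dy j `^ p)%:E * (((dy j)%:E < M x)%E%:R)%:E).
  by apply: emeasurable_funM; [exact: measurable_cst|exact: measurable_funTS].
have ind0 j x : 0 <= (dy j `^ p)%:E * (((dy j)%:E < M x)%E%:R)%:E.
  by rewrite mule_ge0// lee_fin// powR_ge0.
rewrite ge0_integralZl//; last 2 first.
- by apply: measurable_nneseries => // j; exact: measurable_funTS.
- by move=> x _; apply: nneseries_ge0.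
rewrite EFinM -muleA lee_wpmul2l ?lee_fin ?powR_ge0//.
rewrite integral_nneseries//.
apply: (@le_trans _ _ (\sum_(j <oo) \int[mu]_(x in A)
    (2%:E * ((dy j `^ p)%:E * Psi (dy j) x)))).
  apply: lee_nneseries => [j _ _|j _]; first by apply: integral_ge0.
  have tj0 : 0 <= (dy j `^ p)%:E by rewrite lee_fin powR_ge0.
  rewrite ge0_integralZl//; last exact: measurable_funTS.
  under eq_integral do rewrite indE.
  have -> := integral_indic mu mA (mS (dy j)%:E : measurable (S j)).
  rewrite setIC; under [leRHS]eq_integral do rewrite muleCA.
  rewrite ge0_integralZl//; last 2 first.
  + by apply: measurable_funTS; apply: emeasurable_funM => //; exact: measurable_cst.
  + by move=> x _; rewrite mule_ge0// Psi0.
  by rewrite lee_wpmul2l//; exact: weak.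
rewrite -integral_nneseries//; last 2 first.
- move=> j; apply: measurable_funTS; do 2 (apply: emeasurable_funM; first exact: measurable_cst).
  exact: mPsi.
- by move=> j x _; rewrite mule_ge0// mule_ge0 ?lee_fin ?powR_ge0// Psi0.
have mhp : measurable_fun A (fun x => h x `^ p).
  by apply: measurable_funTS; exact: (measurableT_comp (measurable_poweR _)).
rewrite EFinM -muleA -ge0_integralZl//; last 2 first.
- by move=> x _; exact: poweR_ge0.
- by rewrite lee_fin ltW.
rewrite -ge0_integralZl//; last 2 first.
- by apply: emeasurable_funM => //; exact: measurable_cst.
- by move=> x _; rewrite mule_ge0 ?lee_fin ?(ltW C0)// poweR_ge0.
apply: le_integral_nonneg => x _.
  apply: nneseries_ge0 => j _ _.
  by rewrite mule_ge0// mule_ge0 ?lee_fin ?powR_ge0// Psi0.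
rewrite nneseriesZl//; last by move=> j _; rewrite mule_ge0 ?lee_fin ?powR_ge0// Psi0.
by rewrite lee_wpmul2l//; exact: HC.
Qed.

End orlicz.

(** * The Lp inequality for the maximal average *)

Lemma B_condition_id (R : realType) (q : R) : (1 < q)%R -> B_condition q (@idfun R).
Proof.
move=> q1; have q10 : (0 < q - 1)%R by rewrite subr_gt0.
exists 1%R => //.
pose F (x : R) : R := (- (q - 1)^-1 * x `^ (- (q - 1)))%R.
pose f (x : R) : R := (x `^ (- q))%R.
have dF (x : R) : (0 < x)%R -> is_derive x 1%R F (f x).
  move=> x0; have := is_derive1_powR (- (q - 1)) x0.
  move=> /(is_deriveZ (- (q - 1)^-1)%R); rewrite /F /f.
  rewrite (_ : _ *: _ = x `^ (- q))%R//.
  rewrite /GRing.scale/= mulrA mulrNN mulVf ?gt_eqF// mul1r.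
  by congr (_ `^ _)%R; ring.
have cf (x : R) : (0 < x)%R -> {for x, continuous f}.
  move=> x0; apply: differentiable_continuous; apply/derivable1_diffP.
  by apply: derivable_powR; rewrite in_itv/= x0.
have F0 : F x @[x --> +oo%R] --> 0%R.
  rewrite -[X in _ --> X](mulr0 (- (q - 1)^-1)%R); apply: cvgMr.
  apply/cvgrPdist_lt => e e0; near=> x.
  have x1 : (e `^ (- (q - 1)^-1) < x)%R by near: x; exact: nbhs_pinfty_gt.
  have y0 : (0 < e `^ (- (q - 1)^-1))%R by rewrite powR_gt0.
  rewrite sub0r normrN ger0_norm ?powR_ge0//.
  have yE : ((e `^ (- (q - 1)^-1)) `^ (- (q - 1)) = e)%R.
    by rewrite -powRrM mulrNN mulVf ?gt_eqF// powRr1 ?ltW.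
  rewrite -yE; move: (e `^ _)%R x1 y0 => y yx y0.
  rewrite !powRN ltf_pV2 ?posrE ?powR_gt0 ?(lt_trans y0 yx)//.
  by apply: gt0_ltr_powR; rewrite ?nnegrE ?(ltW y0) ?(ltW (lt_trans y0 yx)).
rewrite (_ : \int[_]_(t in _) _ = \int[lebesgue_measure]_(t in `[1%R, +oo[) (f t)%:E).
  rewrite (@ge0_continuous_FTC2y R f F 1%R 0%R)//.
  - by rewrite -EFinB ltry.
  - by move=> x _; exact: powR_ge0.
  - apply/continuous_within_itvcyP; split=> [x|].
      by rewrite in_itv/= andbT => x1; apply: cf; exact: lt_trans x1.
    by apply: cvg_at_right_filter; exact: cf.
  - by move=> x x1; have [] := dF x (lt_trans ltr01 x1).
  - apply: cvg_at_right_filter; apply: differentiable_continuous.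
    by apply/derivable1_diffP; have [] := dF 1%R ltr01.
  - move=> x; rewrite in_itv/= andbT => x1; rewrite derive1E.
    by have [_ ->] := dF x (lt_trans ltr01 x1).
apply: eq_integral => t /set_mem /=; rewrite in_itv/= andbT => t1.
have t0 := lt_le_trans ltr01 t1.
by rewrite /f powRN mulrAC divff ?gt_eqF// mul1r.
Unshelve. all: by end_near. Qed.

Section maximal_average.
Context d (T : measurableType d) (R : realType).
Variable mu : {measure set T -> \bar R}.

Lemma le_cavg_orlicz (b : R) (G : grid mu b) k (h : T -> \bar R) x :
  measurable_fun [set: T] h -> (forall x, 0 <= h x) ->
  cavg G k h x <= orlicz mu idfun (cell G k x) h.
Proof.
move=> mh h0; apply: le_ereal_inf_tmp => _ [l [l0 +] <-].
rewrite (_ : mean _ _ _ = (l^-1)%:E * cavg G k h x).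
  by rewrite lee_pdivrMl// mule1.
rewrite -meanZl//; last 3 first.
- exact: measurable_cell.
- by rewrite lee_fin invr_ge0 ltW.
- exact: measurable_funTS.
apply: mean_eq => y _; rewrite muleC.
by case: (_ * h y).
Qed.

(** Doob's inequality. The average is dominated by the Luxemburg norm of the
    identity, which satisfies the [B_q] condition because [q > 1]. *)
Lemma maximal_average (q : R) : (1 < q)%R ->
  exists2 C : R, (0 < C)%R & forall (b : R) (G : grid mu b) (h : T -> \bar R) m k A,
    measurable_fun [set: T] h -> (forall x, 0 <= h x) -> saturated G k A ->
    \int[mu]_(x in A) (maxlev (fun l => cavg G l h) m k x) `^ q
    <= C%:E * \int[mu]_(x in A) (h x `^ q).
Proof.
move=> q1; have q0 := lt_trans ltr01 q1.
have [||||||C C0 HC] := @orlicz_maximal _ T R mu idfun q (2^-1).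
- by [].
- by [].
- by [].
- by rewrite invr_gt0.
- by [].
- exact: B_condition_id.
exists C => // b G h m k A mh h0 sA; apply: le_trans (HC b G h m k A mh h0 sA).
apply: le_integral_nonneg => x _; first exact: poweR_ge0.
apply: (le_poweR (ltW q0)).
  by apply: maxlev_ge0 => l y; exact: cavg_ge0.
by apply: le_maxlev => l; exact: le_cavg_orlicz.
Qed.

End maximal_average.

(** * The vector-valued weak-type inequality *)

(** Rescaled by [a = c / l] and [b = g / phi], each term obeys
    [a ^ (q - 1) * b <= a ^ q + b ^ q]: this costs a factor 2 compared with
    Hoelder's inequality. *)
Lemma holder_sum_real (R : realType) (q : R) (I : nat) (c g : nat -> R) (l phi : R) :
  (1 < q)%R -> (0 < l)%R -> (0 < phi)%R ->
  (forall i, 0 <= c i)%R -> (forall i, 0 <= g i)%R ->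
  (\sum_(i < I) c i `^ q <= l `^ q)%R -> (\sum_(i < I) g i `^ q <= phi `^ q)%R ->
  (\sum_(i < I) c i `^ (q - 1) * g i <= 2 * l `^ (q - 1) * phi)%R.
Proof.
move=> q1 l0 phi0 c0 g0 cl gphi; have q0 := lt_trans ltr01 q1.
have term i : (c i `^ (q - 1) * g i <=
    l `^ (q - 1) * phi * ((c i / l) `^ q + (g i / phi) `^ q))%R.
  have a0 : (0 <= c i / l)%R by rewrite divr_ge0// ltW.
  have b0 : (0 <= g i / phi)%R by rewrite divr_ge0// ltW.
  have cE : (c i = l * (c i / l))%R by rewrite mulrC divfK// gt_eqF.
  have gE : (g i = phi * (g i / phi))%R by rewrite mulrC divfK// gt_eqF.
  rewrite {1}cE {1}gE powRM ?(ltW l0)// mulrACA ler_wpM2l//.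
    by rewrite mulr_ge0 ?powR_ge0// ltW.
  have [ab|ba] := leP (g i / phi)%R (c i / l)%R.
    apply: (@le_trans _ _ ((c i / l) `^ q)%R); last by rewrite lerDl powR_ge0.
    by rewrite -[leRHS]mulr_powRB1// mulrC ler_wpM2r ?powR_ge0.
  apply: (@le_trans _ _ ((g i / phi) `^ q)%R); last by rewrite lerDr powR_ge0.
  rewrite -[leRHS]mulr_powRB1// mulrC ler_wpM2l//; apply: le_powR => //; last exact: ltW.
  by rewrite subr_ge0 ltW.
apply: (@le_trans _ _ (\sum_(i < I)
    (l `^ (q - 1) * phi * ((c i / l) `^ q + (g i / phi) `^ q)))%R).
  by apply: ler_sum => i _.
rewrite -mulr_sumr big_split/= -[leRHS]mulrA [leRHS]mulrC ler_wpM2l//.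
  by rewrite mulr_ge0 ?powR_ge0// ltW.
have le1 (h : nat -> R) (y : R) : (0 < y)%R -> (forall i, 0 <= h i)%R ->
    (\sum_(i < I) h i `^ q <= y `^ q -> \sum_(i < I) (h i / y) `^ q <= 1)%R.
  move=> y0 h0 hy; rewrite (eq_bigr (fun i : 'I_I => h i `^ q / y `^ q)%R).
    by rewrite -mulr_suml ler_pdivrMr ?powR_gt0// mul1r.
  move=> i _; rewrite powRM ?invr_ge0 ?(ltW y0)// -powR_inv1 ?(ltW y0)//.
  by rewrite powRAC powR_inv1 ?powR_ge0.
by rewrite -[2%R]/(1 + 1)%R lerD ?le1.
Qed.

Lemma holder_sum_ereal (R : realType) (q : R) (I : nat) (c : nat -> R) (g : nat -> \bar R)
    (l : R) (phi : \bar R) :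
  (1 < q)%R -> (0 < l)%R -> 0 <= phi ->
  (forall i, 0 <= c i)%R -> (forall i, 0 <= g i) ->
  (\sum_(i < I) c i `^ q <= l `^ q)%R -> \sum_(i < I) g i `^ q <= phi `^ q ->
  \sum_(i < I) (c i `^ (q - 1))%:E * g i <= (2 * l `^ (q - 1))%:E * phi.
Proof.
move=> q1 l0 + c0 g0 cl; have q0 := lt_trans ltr01 q1.
have l20 : (0 < 2 * l `^ (q - 1))%R by rewrite mulr_gt0 ?powR_gt0.
case: phi => [phi| |]// phi0 gphi; last first.
  by rewrite mulry gtr0_sg ?mul1e ?leey.
have gi (i : 'I_I) : g i <= phi%:E.
  rewrite leNgt; apply/negP => gp.
  have := lt_poweR q0 phi0 (g0 i) gp; rewrite ltNge => /negP; apply.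
  apply: le_trans gphi; rewrite (bigD1 i)//= leeDl// sume_ge0// => j _.
  exact: poweR_ge0.
have gE (i : 'I_I) : g i = (fine (g i))%:E.
  by rewrite fineK// ge0_fin_numE// (le_lt_trans (gi i))// ltry.
move: phi0; rewrite lee_fin le_eqVlt => /predU1P[p0|phi0].
  rewrite big1 ?mule_ge0 ?lee_fin ?(ltW l20) -?p0// => i _.
  have := gi i; rewrite -p0 => gi0.
  by have /eqP -> : g i == 0; rewrite ?mule0// eq_le g0 andbT.
rewrite (eq_bigr (fun i : 'I_I => (c i `^ (q - 1) * fine (g i))%:E)); last first.
  by move=> i _; rewrite gE.
rewrite sumEFin -EFinM lee_fin.
apply: (@holder_sum_real _ q I c (fun i => fine (g i))) => //.
  by move=> i; rewrite fine_ge0.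
move: gphi; rewrite (eq_bigr (fun i : 'I_I => (fine (g i) `^ q)%:E)); last first.
  by move=> i _; rewrite gE.
by rewrite sumEFin lee_fin.
Qed.

Section vector_valued.
Context d (T : measurableType d) (R : realType).
Variable mu : {measure set T -> \bar R}.
Variables (b : R) (G : grid mu b) (q : R) (I : nat).
Variables (f : nat -> T -> \bar R) (F : T -> \bar R).
Hypotheses (q1 : (1 < q)%R) (b1 : (1 <= b)%R).
Hypotheses (mf : forall i, measurable_fun [set: T] (f i)) (f0 : forall i x, 0 <= f i x).
Hypotheses (mF : measurable_fun [set: T] F) (F0 : forall x, 0 <= F x).
Hypothesis fF : forall x, \sum_(i < I) f i x `^ q <= F x `^ q.

Let q0 : (0 < q)%R. Proof. exact: lt_trans q1. Qed.

Let fiF (i : 'I_I) x : f i x <= F x.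
Proof.
rewrite leNgt; apply/negP => /(lt_poweR q0 (F0 x) (f0 i x)).
rewrite ltNge => /negP; apply; apply: le_trans (fF x).
by rewrite (bigD1 i)//= leeDl// sume_ge0// => j _; exact: poweR_ge0.
Qed.

(** Minkowski's integral inequality, up to a factor 2: test the means against
    their own powers. *)
Lemma minkowski_cavg k x :
  \sum_(i < I) (cavg G k (f i) x) `^ q <= (2 `^ q)%:E * (cavg G k F x) `^ q.
Proof.
have mQ := measurable_cell G k x.
set A := cavg G k F x; have A0 : 0 <= A by exact: cavg_ge0.
have [Ay|Afin] := eqVneq A +oo.
  by rewrite Ay poweRyr ?gt_eqF// mulry gtr0_sg ?powR_gt0// mul1e leey.
have {}Afin : A < +oo by rewrite ltey.
pose c i := fine (cavg G k (f i) x).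
have cE (i : 'I_I) : cavg G k (f i) x = (c i)%:E.
  rewrite fineK// ge0_fin_numE ?cavg_ge0// (le_lt_trans _ Afin)//.
  by apply: le_mean => y _.
have c0 i : (0 <= c i)%R by rewrite fine_ge0// cavg_ge0.
rewrite (eq_bigr (fun i : 'I_I => (c i `^ q)%:E)); last first.
  by move=> i _; rewrite cE.
rewrite sumEFin; set S := (\sum_(i < I) _)%R.
have S0 : (0 <= S)%R by rewrite sumr_ge0// => i _; exact: powR_ge0.
have [->|Sn0] := eqVneq S 0%R.
  by rewrite mule_ge0 ?poweR_ge0// lee_fin powR_ge0.
have {}Sn0 : (0 < S)%R by rewrite lt_neqAle eq_sym Sn0.
pose l := (S `^ q^-1)%R.
have l0 : (0 < l)%R by rewrite powR_gt0.
have lq : (l `^ q = S)%R by rewrite /l -powRrM mulVf ?gt_eqF// powRr1.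
have key : S%:E <= (2 * l `^ (q - 1))%:E * A.
  have -> : S%:E = \sum_(i < I) (c i `^ (q - 1))%:E * cavg G k (f i) x.
    rewrite /S -sumEFin; apply: eq_bigr => i _.
    by rewrite cE -EFinM mulrC mulr_powRB1.
  rewrite /A /cavg -meanZl//; last 2 first.
  - by rewrite lee_fin mulr_ge0// powR_ge0.
  - exact: measurable_funTS.
  apply: (@le_trans _ _ (mean mu (cell G k x)
      (fun y => \sum_(i < I) (c i `^ (q - 1))%:E * f i y))).
    rewrite /mean ge0_integral_sum//; last 2 first.
    + by move=> i; apply: emeasurable_funM; [exact: measurable_cst|exact: measurable_funTS].
    + by move=> i y _; rewrite mule_ge0 ?lee_fin ?powR_ge0.
    rewrite ge0_sume_distrr; last first.
      by move=> i _; apply: integral_ge0 => y _; rewrite mule_ge0 ?lee_fin ?powR_ge0.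
    apply: lee_sum => i _; rewrite ge0_integralZl//; last 2 first.
    + exact: measurable_funTS.
    + by rewrite lee_fin powR_ge0.
    by rewrite muleCA.
  apply: le_mean => y _.
    by apply: sume_ge0 => i _; rewrite mule_ge0 ?lee_fin ?powR_ge0.
  by apply: (@holder_sum_ereal _ q I c (fun i => f i y)) => //; rewrite lq.
have lA : l%:E <= 2%:E * A.
  have lq1 : (0 < l `^ (q - 1))%R by rewrite powR_gt0.
  rewrite -(@lee_pmul2l _ (l `^ (q - 1))%:E)// -EFinM mulrC mulr_powRB1 ?(ltW l0)// lq.
  by rewrite muleA -EFinM [(_ * 2)%R]mulrC.
have -> : S%:E = l%:E `^ q by rewrite -lq.
have -> : (2 `^ q)%:E = 2%:E `^ q by [].
by rewrite -poweRM// le_poweR// ?lee_fin ltW.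
Qed.

(** [g] averaged at the first level where the average of [F] exceeds [th], or at
    the last level: the good part of the Calderon-Zygmund decomposition. *)
Fixpoint stopped (th : \bar R) (g : T -> \bar R) m k x : \bar R :=
  if m is m'.+1 then
    if th < cavg G k F x then cavg G k g x else stopped th g m' k.+1 x
  else cavg G k g x.

Lemma stopped_ge0 th g m k x : (forall y, 0 <= g y) -> 0 <= stopped th g m k x.
Proof.
move=> g0; elim: m k => [|m IH] k /=; first exact: cavg_ge0.
by case: ifPn => // _; exact: cavg_ge0.
Qed.

Lemma measurable_stopped th g m k : measurable_fun [set: T] (stopped th g m k).
Proof.
elim: m k => [|m IH] k; first exact: measurable_cavg.
apply: measurable_fun_ifT => //; last exact: measurable_cavg.
by apply: measurable_fun_lte; [exact: measurable_cst|exact: measurable_cavg].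
Qed.

Lemma integral_stopped th g m k x : measurable_fun [set: T] g ->
  (forall y, 0 <= g y) ->
  \int[mu]_(y in cell G k x) stopped th g m k y = \int[mu]_(y in cell G k x) g y.
Proof.
move=> mg g0.
have cst k' x' (h : T -> \bar R) :
    (forall y, cell G k' x' y -> h y = cavg G k' g x') ->
    \int[mu]_(y in cell G k' x') h y = \int[mu]_(y in cell G k' x') g y.
  by move=> hE; rewrite (integral_cell_cst hE) mulr_cavg.
elim: m k x => [|m IH] k x; first by apply: cst => y xy; exact: cavg_eq.
have [thF|Fth] := ltP th (cavg G k F x).
  by apply: cst => y xy /=; rewrite !(cavg_eq _ xy) thF.
transitivity (\int[mu]_(y in cell G k x) stopped th g m k.+1 y).
  apply: eq_integral => y /set_mem xy /=.
  by rewrite !(cavg_eq _ xy) ltNge Fth.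
have mS := measurable_stopped th g m k.+1.
have S0 y : 0 <= stopped th g m k.+1 y by exact: stopped_ge0.
apply/eqP; rewrite eq_le; apply/andP; split.
  by apply: (le_integral_cells (@saturated_cellS _ _ _ _ _ G k x)) => // y _; rewrite IH.
by apply: (le_integral_cells (@saturated_cellS _ _ _ _ _ G k x)) => // y _; rewrite IH.
Qed.

Lemma maxlev_cavg_local m k x (g h : T -> \bar R) :
  (forall y, cell G k x y -> g y = h y) ->
  maxlev (fun l => cavg G l g) m k x = maxlev (fun l => cavg G l h) m k x.
Proof.
elim: m k => [|m IH] k gh /=; first exact: mean_eq.
by rewrite IH; [congr maxe; exact: mean_eq|move=> y /cell_sub; exact: gh].
Qed.

(** Stopping preserves the averages over the cells that contain the stopping
    cells they meet, and these are all the cells around a point where no stop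
    occurs. *)
Lemma maxlev_stopped th g m k x : measurable_fun [set: T] g -> (forall y, 0 <= g y) ->
  maxlev (fun l => cavg G l F) m k x <= th ->
  maxlev (fun l => cavg G l g) m k x =
  maxlev (fun l => cavg G l (stopped th g m k)) m k x.
Proof.
move=> mg g0.
have avE m' k' : cavg G k' (stopped th g m' k') x = cavg G k' g x.
  by rewrite /cavg /mean integral_stopped.
elim: m k => [|m IH] k /= Fth; first by rewrite -[RHS]/(cavg G k (stopped th g 0 k) x) avE.
move: Fth; rewrite ge_max => /andP[Fk Fth].
rewrite -[in RHS]/(stopped th g m.+1 k) avE IH//; congr maxe.
apply: maxlev_cavg_local => y /cell_sub xy /=.
by rewrite (cavg_eq _ xy) ltNge Fk.
Qed.

(** Where the average of [F] first exceeds [th] it is at most [b * th], since the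
    average over the parent cell does not exceed [th]. *)
Lemma stopped_le (th : \bar R) m k x : 0 <= th -> cavg G k F x <= b%:E * th ->
  \sum_(i < I) (stopped th (f i) m k x) `^ q <= (2%:E * (b%:E * th)) `^ q.
Proof.
move=> th0; have b0 : 0 <= b%:E by rewrite lee_fin (le_trans ler01).
have base k' : cavg G k' F x <= b%:E * th ->
    \sum_(i < I) (cavg G k' (f i) x) `^ q <= (2%:E * (b%:E * th)) `^ q.
  move=> Fb; apply: le_trans (minkowski_cavg k' x) _.
  rewrite [leRHS]poweRM ?mule_ge0// lee_wpmul2l// ?lee_fin ?powR_ge0//.
  by rewrite le_poweR ?cavg_ge0// ltW.
elim: m k => [|m IH] k Fb /=; first exact: base.
have [thF|Fth] := ltP th (cavg G k F x); first exact: base.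
by apply: IH; apply: le_trans (cavg_doubling G k x F0 mF) _; rewrite lee_wpmul2l.
Qed.

Definition vv_maxlev m k x := \sum_(i < I) (maxlev (fun l => cavg G l (f i)) m k x) `^ q.

Lemma vv_maxlev_ge0 m k x : 0 <= vv_maxlev m k x.
Proof. by apply: sume_ge0 => i _; exact: poweR_ge0. Qed.

End vector_valued.

Lemma measurable_vv_maxlev d (T : measurableType d) (R : realType)
    (mu : {measure set T -> \bar R}) (b : R) (G : grid mu b) (q : R) (I : nat)
    (f : nat -> T -> \bar R) m k :
  measurable_fun [set: T] (vv_maxlev G q I f m k).
Proof.
apply: emeasurable_sum => i; apply: (measurableT_comp (measurable_poweR _)).
by apply: measurable_maxlev => l; exact: measurable_cavg.
Qed.

Lemma maxlev_cavg0 d (T : measurableType d) (R : realType)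
    (mu : {measure set T -> \bar R}) (b : R) (G : grid mu b) (g : T -> \bar R) m k x :
  measurable_fun [set: T] g -> (forall y, 0 <= g y) -> cavg G k g x <= 0 ->
  maxlev (fun l => cavg G l g) m k x <= 0.
Proof.
move=> mg g0; elim: m k => [//|m IH] k gk /=; rewrite ge_max gk/= IH//.
apply: le_trans (cavg_doubling G k x g0 mg) _.
have /eqP -> : cavg G k g x == 0 by rewrite eq_le gk cavg_ge0.
by rewrite mule0.
Qed.

Section chebyshev.
Context d (T : measurableType d) (R : realType).
Variable mu : {measure set T -> \bar R}.

Lemma ge0_chebyshev (Q : set T) (h : T -> \bar R) (t : \bar R) : measurable Q ->
  measurable_fun [set: T] h -> (forall x, 0 <= h x) -> 0 <= t ->
  t * mu (Q `&` [set x | t < h x]) <= \int[mu]_(x in Q) h x.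
Proof.
move=> mQ mh h0 t0.
have mS : measurable (Q `&` [set x | t < h x]).
  apply: measurableI => //.
  by rewrite -[X in measurable X]setTI; exact: emeasurable_fun_o_infty.
rewrite -integral_cst//.
apply: (@le_trans _ _ (\int[mu]_(x in Q `&` [set x | t < h x]) h x)).
  by apply: le_integral_nonneg => x [_ /= /ltW].
by apply: ge0_subset_integral => //; exact: measurable_funTS.
Qed.

End chebyshev.

Section weak_type.
Context d (T : measurableType d) (R : realType).
Variable mu : {measure set T -> \bar R}.

(** The Fefferman-Stein inequality. The averages of [F] exceed four times the mean
    of [F] on at most a quarter of the cell. Elsewhere the functions may be
    replaced by the stopped ones, which are bounded, and Chebyshev's inequality
    in [L^q] gives another quarter. *)
Lemma vv_weak (b q : R) : (1 <= b)%R -> (1 < q)%R ->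
  exists2 L : R, (2 `^ q <= L)%R & forall (G : grid mu b) (I : nat)
    (f : nat -> T -> \bar R) (F : T -> \bar R) m k x,
    (forall i, measurable_fun [set: T] (f i)) -> (forall i x, 0 <= f i x) ->
    measurable_fun [set: T] F -> (forall x, 0 <= F x) ->
    (forall x, \sum_(i < I) f i x `^ q <= F x `^ q) ->
    2%:E * mu (cell G k x `&`
       [set y | L%:E * (cavg G k F x) `^ q < vv_maxlev G q I f m k y])
    <= mu (cell G k x).
Proof.
move=> b1 q1; have q0 := lt_trans ltr01 q1.
have [C C0 HC] := maximal_average mu q1.
have C8 : (0 <= 4 * C * (8 * b) `^ q)%R by rewrite !mulr_ge0 ?powR_ge0// ltW.
(* stopping at the height [4 * a] bounds the stopped functions by [8 * b * a];
   the term [2 ^ q] makes [L] absorb the constant of [minkowski_cavg] *)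
exists (4 * C * (8 * b) `^ q + 2 `^ q)%R; first by rewrite lerDr.
set L := (_ + _)%R => G I f F m k x mf f0 mF F0 fF.
have L0 : (0 < L)%R by rewrite ltr_wpDl// powR_gt0.
have mQ := measurable_cell G k x.
set a := cavg G k F x; have a0 : 0 <= a by exact: cavg_ge0.
set Q := cell G k x; have Q0 : 0 < mu Q by exact: cell_gt0.
have Qfin : mu Q \is a fin_num by exact: cell_fin_num.
pose S : set T := [set y | L%:E * a `^ q < vv_maxlev G q I f m k y].
rewrite -/S.
have [ay|an] := eqVneq a +oo.
  rewrite (_ : Q `&` S = set0) ?measure0 ?mule0 ?ltW//.
  apply/seteqP; split=> // y [_]; rewrite /S /= ay poweRyr ?gt_eqF// mulry gtr0_sg//.
  by rewrite mul1e ltNge leey.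
have fiF (i : 'I_I) y : f i y <= F y.
  rewrite leNgt; apply/negP => /(lt_poweR q0 (F0 y) (f0 i y)).
  rewrite ltNge => /negP; apply; apply: le_trans (fF y).
  by rewrite (bigD1 i)//= leeDl// sume_ge0// => j _; exact: poweR_ge0.
move: a0; rewrite le_eqVlt => /predU1P[a0|a0].
  rewrite (_ : Q `&` S = set0) ?measure0 ?mule0 ?ltW//.
  apply/seteqP; split=> // y [xy]; rewrite /S /= ltNge.
  move=> /negP; apply; rewrite /vv_maxlev big1.
    by rewrite mule_ge0 ?poweR_ge0// lee_fin ltW.
  move=> i _; rewrite (_ : maxlev _ _ _ _ = 0) ?poweR0r ?gt_eqF//.
  apply/eqP; rewrite eq_le maxlev_ge0 ?andbT; last by move=> l z; exact: cavg_ge0.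
  apply: maxlev_cavg0 => //; rewrite (cavg_eq _ xy) a0 /a /cavg.
  by apply: le_mean => z _.
have {}an : a \is a fin_num by rewrite ge0_fin_numE ?ltey// ltW.
pose th := 4%:E * a.
have th0 : 0 < th by rewrite mule_gt0.
have thfin : th \is a fin_num by rewrite fin_numM.
pose S1 : set T := [set y | th < maxlev (fun l => cavg G l F) m k y].
pose g i := stopped G F th (f i) m k.
have mg i : measurable_fun setT (g i) by exact: measurable_stopped.
have g0 i y : 0 <= g i y by exact: stopped_ge0.
pose S2 : set T := [set y | L%:E * a `^ q < vv_maxlev G q I g m k y].
have SS : Q `&` S `<=` (Q `&` S1) `|` (Q `&` S2).
  move=> y [xy Sy]; have [Fy|Fy] := ltP th (maxlev (fun l => cavg G l F) m k y).
    by left.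
  right; split=> //; move: Sy; rewrite /S /S2 /vv_maxlev /=.
  by under eq_bigr do rewrite (maxlev_stopped (mf _) (f0 _) Fy).
have mS1 : measurable S1.
  rewrite -[X in measurable X]setTI; apply: emeasurable_fun_o_infty => //.
  by apply: measurable_maxlev => l; exact: measurable_cavg.
have mS' h : measurable [set y | L%:E * a `^ q < vv_maxlev G q I h m k y].
  rewrite -[X in measurable X]setTI; apply: emeasurable_fun_o_infty => //.
  exact: measurable_vv_maxlev.
have thE : 2%:E * (b%:E * th) = (8 * b)%:E * a.
  by rewrite /th -(fineK an) -!EFinM; congr EFin; ring.
have H1 : 4%:E * mu (Q `&` S1) <= mu Q.
  apply: (@le_trans _ _ (4%:E * \int[mu]_(y in Q) ((fine th)^-1%:E * F y))).
    rewrite lee_wpmul2l//; apply: maxlev_weak.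
    - by move=> l; exact: cavg_adapted.
    - by apply: emeasurable_funM => //; exact: measurable_cst.
    - by move=> y; rewrite mule_ge0// lee_fin invr_ge0 fine_ge0// ltW.
    - move=> l y; rewrite /cavg mean_gt_lty ?cell_gt0 ?cell_lty// => /ltW.
      rewrite -{1}(fineK thfin) => H.
      rewrite ge0_integralZl//; last 3 first.
      + exact: measurable_cell.
      + exact: measurable_funTS.
      + by rewrite lee_fin invr_ge0 fine_ge0// ltW.
      by rewrite lee_pdivlMl ?fine_gt0 ?th0 ?ltey_eq ?thfin// muleC.
  rewrite ge0_integralZl//; last 2 first.
  + exact: measurable_funTS.
  + by rewrite lee_fin invr_ge0 fine_ge0// ltW.
  rewrite -mulr_cavg -/a -/Q /th fineM//= -(fineK an) -(fineK Qfin) -!EFinM lee_fin.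
  have a'0 : (fine a != 0)%R by rewrite gt_eqF// fine_gt0// a0 ltey_eq an.
  by rewrite le_eqVlt; apply/orP; left; apply/eqP; field.
have H2 : 4%:E * mu (Q `&` S2) <= mu Q.
  have aq0 : 0 < a `^ q by rewrite poweR_gt0.
  have aqfin : a `^ q \is a fin_num by rewrite fin_num_poweR.
  have : L%:E * a `^ q * mu (Q `&` S2) <= (L / 4)%:E * a `^ q * mu Q.
    apply: le_trans (ge0_chebyshev mu _ _ _ _) _ => //.
    - exact: measurable_vv_maxlev.
    - by move=> y; exact: vv_maxlev_ge0.
    - by rewrite mule_ge0 ?lee_fin ?(ltW L0)// ltW.
    rewrite /vv_maxlev ge0_integral_sum//; last 2 first.
    - move=> i; apply: measurable_funTS.
      apply: (measurableT_comp (measurable_poweR _)).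
      by apply: measurable_maxlev => l; exact: measurable_cavg.
    - by move=> i y _; exact: poweR_ge0.
    apply: (@le_trans _ _ (\sum_(i < I) C%:E * \int[mu]_(y in Q) (g i y `^ q))).
      by apply: lee_sum => i _; apply: HC => //; exact: saturated_cell.
    rewrite -ge0_sume_distrr; last first.
      by move=> i _; apply: integral_ge0 => y _; exact: poweR_ge0.
    rewrite -ge0_integral_sum//; last 2 first.
    - by move=> i; apply: measurable_funTS; apply: (measurableT_comp (measurable_poweR _)).
    - by move=> i y _; exact: poweR_ge0.
    apply: (@le_trans _ _ (C%:E * \int[mu]_(y in Q) cst ((2%:E * (b%:E * th)) `^ q) y)).
      rewrite lee_wpmul2l ?lee_fin ?(ltW C0)//; apply: le_integral_nonneg => y xy.
        by apply: sume_ge0 => i _; exact: poweR_ge0.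
      apply: (stopped_le (G := G) (F := F)) => //; first exact: ltW.
      rewrite (cavg_eq _ xy) -/a /th muleA -[leLHS]mul1e lee_wpmul2r ?(ltW a0)//.
      by rewrite -EFinM lee_fin; lra.
    rewrite integral_cst// thE poweRM ?lee_fin ?(ltW a0)//; last by lra.
    rewrite muleA lee_wpmul2r ?measure_ge0// muleA lee_wpmul2r ?(ltW aq0)//.
    rewrite poweR_EFin -EFinM lee_fin ler_pdivlMr// /L.
    by rewrite mulrC mulrA lerDl powR_ge0.
  rewrite [X in X * mu Q](_ : _ = (L%:E * a `^ q) * 4^-1%:E); last first.
    by rewrite EFinM muleAC.
  rewrite -[X in _ <= X -> _]muleA lee_pmul2l; last 2 first.
  - by rewrite fin_numM.
  - by rewrite mule_gt0.
  by rewrite lee_pdivlMl.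
have U : mu (Q `&` S) <= mu (Q `&` S1) + mu (Q `&` S2).
  have mQ1 := measurableI _ _ mQ mS1; have mQ2 := measurableI _ _ mQ (mS' g).
  apply: le_trans (measureU2 mu mQ1 mQ2).
  rewrite le_measure ?inE//; first by apply: measurableI => //; exact: mS'.
  exact: measurableU.
have fin_sub A : measurable A -> mu (Q `&` A) \is a fin_num.
  move=> mA; rewrite ge0_fin_numE//; apply: le_lt_trans (_ : mu Q < +oo).
    by rewrite le_measure ?inE//; exact: measurableI.
  by rewrite ltey_eq Qfin.
move: H1 H2 U; rewrite -(fineK Qfin) -(fineK (fin_sub S1 _))// -(fineK (fin_sub S2 _))//.
  rewrite -(fineK (fin_sub S _)); last exact: mS'.
  rewrite -EFinD -!EFinM !lee_fin => H1 H2 U; lra.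
exact: mS'.
Qed.

End weak_type.

(** * The sparse principle *)

Section sparse.
Context d (T : measurableType d) (R : realType).
Variable mu : {measure set T -> \bar R}.
Variables (b : R) (G : grid mu b) (q s L : R) (I N : nat).
Variables (f : nat -> T -> \bar R) (F W Phi : T -> \bar R).
Hypotheses (q1 : (1 < q)%R) (s0 : (0 < s)%R) (s1 : (s <= 1)%R).
Hypothesis L2 : (2 `^ q <= L)%R.
Hypotheses (mf : forall i, measurable_fun [set: T] (f i)) (f0 : forall i x, 0 <= f i x).
Hypotheses (mF : measurable_fun [set: T] F) (F0 : forall x, 0 <= F x).
Hypotheses (mW : measurable_fun [set: T] W) (W0 : forall x, 0 <= W x).
Hypotheses (mPhi : measurable_fun [set: T] Phi) (Phi0 : forall x, 0 <= Phi x).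
Hypothesis fF : forall x, \sum_(i < I) f i x `^ q <= F x `^ q.
Hypothesis weak : forall m k x, 2%:E * mu (cell G k x `&`
  [set y | L%:E * (cavg G k F x) `^ q < vv_maxlev G q I f m k y]) <= mu (cell G k x).
Hypothesis FW : forall k x, (k <= N)%N ->
  (cavg G k F x `^ q) `^ s * cavg G k W x <= Phi x.

Let q0 : (0 < q)%R. Proof. exact: lt_trans q1. Qed.
Let L0 : (0 < L)%R. Proof. by apply: lt_le_trans L2; rewrite powR_gt0. Qed.

Let K : R := (2 * L `^ s)%R.
Let K0 : (0 < K)%R. Proof. by rewrite mulr_gt0// powR_gt0. Qed.

Let mx (i : nat) m k x := maxlev (fun l => cavg G l (f i)) m k x.

(** The maximal sum from level [j] downwards, completed by the maxima [y] of the
    levels above. *)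
Let Zp (y : nat -> \bar R) m j x := \sum_(i < I) (maxe (y i) (mx i m j x)) `^ q.

Let mZp y m j : measurable_fun [set: T] (Zp y m j).
Proof.
apply: emeasurable_sum => i; apply: (measurableT_comp (measurable_poweR _)).
apply: measurable_maxe; first exact: measurable_cst.
by apply: measurable_maxlev => l; exact: measurable_cavg.
Qed.

Let Zp0 y m j x : 0 <= Zp y m j x.
Proof. by apply: sume_ge0 => i _; exact: poweR_ge0. Qed.

Let Z m k x := vv_maxlev G q I f m k x.

Let mZ m k : measurable_fun [set: T] (Z m k). Proof. exact: measurable_vv_maxlev. Qed.
Let Z0 m k x : 0 <= Z m k x. Proof. exact: vv_maxlev_ge0. Qed.

Let msW (h : T -> \bar R) : measurable_fun [set: T] h ->
  measurable_fun [set: T] (fun x => h x `^ s * W x).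
Proof.
by move=> mh; apply: emeasurable_funM => //; exact: (measurableT_comp (measurable_poweR _)).
Qed.

Let claim m := forall k x, (k + m = N)%N ->
  \int[mu]_(z in cell G k x) (Z m k z `^ s * W z) <=
  K%:E * \int[mu]_(z in cell G k x) Phi z.

Let bound (th : \bar R) (h : T -> \bar R) z : \bar R :=
  th `^ s * W z + K%:E * (if th < h z then Phi z else 0).

Let mif th (h : T -> \bar R) : measurable_fun [set: T] h ->
  measurable_fun [set: T] (fun z => if th < h z then Phi z else 0).
Proof.
move=> mh; apply: measurable_fun_ifT => //.
by apply: measurable_fun_lte => //; exact: measurable_cst.
Qed.

Let if0 th (h : T -> \bar R) z : 0 <= (if th < h z then Phi z else 0).
Proof. by case: ifP. Qed.

Let mbound th h : measurable_fun [set: T] h -> measurable_fun [set: T] (bound th h).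
Proof.
move=> mh; apply: emeasurable_funD; apply: emeasurable_funM => //.
exact: mif.
Qed.

Let bound0 th h z : 0 <= bound th h z.
Proof. by rewrite adde_ge0// mule_ge0 ?poweR_ge0// lee_fin ltW. Qed.

(** The induction hypothesis inside a cell that has not been stopped: the maxima
    of the levels above stay below the threshold [th], and what exceeds [th]
    later on is charged to [Phi] on the stopping cells. *)
Let claim_prefix m := forall j x (y : nat -> \bar R) (th : \bar R), (j + m = N)%N ->
  (forall i, 0 <= y i) -> \sum_(i < I) (y i) `^ q <= th ->
  \int[mu]_(z in cell G j x) (Zp y m j z `^ s * W z) <=
  \int[mu]_(z in cell G j x) bound th (Zp y m j) z.

(** If the prefix maxima pass the threshold at level [j], the cell is a stopping
    cell: the maximal sum splits into the threshold and the maximal sum that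
    starts anew at this cell. *)
Let prefix_stop m j x (y : nat -> \bar R) (th : \bar R) : claim m -> (j + m = N)%N ->
  (forall i, 0 <= y i) -> \sum_(i < I) (y i) `^ q <= th ->
  th < \sum_(i < I) (maxe (y i) (cavg G j (f i) x)) `^ q ->
  \int[mu]_(z in cell G j x) (Zp y m j z `^ s * W z) <=
  \int[mu]_(z in cell G j x) bound th (Zp y m j) z.
Proof.
move=> cl jm y0 yth thy; have mQ := measurable_cell G j x.
have th0 : 0 <= th by apply: le_trans yth; apply: sume_ge0 => i _; exact: poweR_ge0.
have big z : cell G j x z -> th < Zp y m j z.
  move=> xz; apply: lt_le_trans thy _; apply: lee_sum => i _.
  apply: (le_poweR (ltW q0)); first by rewrite le_max y0.
  rewrite ge_max !le_max lexx/= -(cavg_eq _ xz).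
  have := maxlev_ub (fun l => cavg G l (f i)) j z (leq0n m).
  by rewrite addn0 => ->; rewrite orbT.
apply: (@le_trans _ _ (\int[mu]_(z in cell G j x) (th `^ s * W z + Z m j z `^ s * W z))).
  apply: le_integral_nonneg => z xz; first by rewrite mule_ge0 ?poweR_ge0.
  rewrite -ge0_muleDl ?poweR_ge0// lee_wpmul2r//.
  apply: le_trans (poweR_subadd s0 s1 th0 (Z0 m j z)); apply: (le_poweR (ltW s0)) => //.
  apply: le_trans (leeD yth (lexx _)); rewrite /Z /vv_maxlev -big_split/=.
  apply: lee_sum => i _; rewrite maxEle; case: ifP => _.
    by rewrite leeDr// poweR_ge0.
  by rewrite leeDl// poweR_ge0.
have mth : measurable_fun [set: T] (fun z => th `^ s * W z).
  by apply: emeasurable_funM => //; exact: measurable_cst.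
have thW0 z : 0 <= th `^ s * W z by rewrite mule_ge0 ?poweR_ge0.
rewrite ge0_integralD//; last 3 first.
- exact: measurable_funTS.
- by move=> z _; rewrite mule_ge0 ?poweR_ge0.
- by apply: measurable_funTS; exact: msW.
apply: (@le_trans _ _ (\int[mu]_(z in cell G j x) (th `^ s * W z) +
    \int[mu]_(z in cell G j x) (K%:E * Phi z))).
  rewrite leeD2l// ge0_integralZl//; last 2 first.
  - exact: measurable_funTS.
  - by rewrite lee_fin ltW.
  exact: cl.
rewrite -ge0_integralD//; last 3 first.
- exact: measurable_funTS.
- by move=> z _; rewrite mule_ge0// lee_fin ltW.
- by apply: measurable_funTS; apply: emeasurable_funM => //; exact: measurable_cst.
apply: le_integral_nonneg => z xz.
  by rewrite adde_ge0// mule_ge0// lee_fin ltW.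
by rewrite /bound big.
Qed.

Let prefix0 : claim 0 -> claim_prefix 0.
Proof.
move=> cl j x y th jm y0 yth.
have [thy|thy] := ltP th (\sum_(i < I) (maxe (y i) (cavg G j (f i) x)) `^ q).
  exact: prefix_stop thy.
apply: le_integral_nonneg => z xz; first by rewrite mule_ge0 ?poweR_ge0.
apply: (@le_trans _ _ (th `^ s * W z)).
  rewrite lee_wpmul2r//; apply: (le_poweR (ltW s0)) => //.
  apply: le_trans thy; apply: lee_sum => i _.
  by rewrite /mx /= (cavg_eq _ xz).
by rewrite /bound leeDl// mule_ge0// lee_fin ltW.
Qed.

Let prefixS m : claim_prefix m -> claim m.+1 -> claim_prefix m.+1.
Proof.
move=> IH cl j x y th jm y0 yth.
have [thy|thy] := ltP th (\sum_(i < I) (maxe (y i) (cavg G j (f i) x)) `^ q).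
  exact: prefix_stop thy.
pose y' i := maxe (y i) (cavg G j (f i) x).
have ZE z : cell G j x z -> Zp y m.+1 j z = Zp y' m j.+1 z.
  move=> xz; apply: eq_bigr => i _; rewrite /y' /mx /= (cavg_eq _ xz).
  by rewrite maxA.
rewrite (_ : \int[mu]_(z in _) (Zp y m.+1 j z `^ s * W z) =
    \int[mu]_(z in cell G j x) (Zp y' m j.+1 z `^ s * W z)); last first.
  by apply: eq_integral => z /set_mem xz; rewrite ZE.
rewrite (_ : \int[mu]_(z in _) bound th (Zp y m.+1 j) z =
    \int[mu]_(z in cell G j x) bound th (Zp y' m j.+1) z); last first.
  by apply: eq_integral => z /set_mem xz; rewrite /bound ZE.
apply: (le_integral_cells (@saturated_cellS _ _ _ _ _ G j x)).
- exact: msW.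
- exact: mbound.
- by move=> z; rewrite mule_ge0 ?poweR_ge0.
- by move=> z; exact: bound0.
move=> z xz; apply: IH => //; first by rewrite addSnnS.
by move=> i; rewrite /y' le_max y0.
Qed.

Let claim0 : claim 0.
Proof.
move=> k x; rewrite addn0 => kN; have mQ := measurable_cell G k x.
rewrite -ge0_integralZl//; last 2 first.
- exact: measurable_funTS.
- by rewrite lee_fin ltW.
set a := cavg G k F x.
apply: (@le_trans _ _ (\int[mu]_(z in cell G k x) ((L%:E * a `^ q) `^ s * W z))).
  apply: le_integral_nonneg => z xz; first by rewrite mule_ge0 ?poweR_ge0.
  rewrite lee_wpmul2r//; apply: (le_poweR (ltW s0)) => //.
  rewrite /Z /vv_maxlev /=.
  apply: le_trans (minkowski_cavg G q1 mf f0 mF F0 fF k z) _.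
  by rewrite (cavg_eq _ xz) -/a lee_wpmul2r ?poweR_ge0.
rewrite ge0_integralZl//; last 2 first.
- exact: measurable_funTS.
- exact: poweR_ge0.
rewrite -mulr_cavg muleCA.
rewrite -(@integral_cell_cst _ _ _ _ _ G k x _
  (fun=> (L%:E * a `^ q) `^ s * cavg G k W x))//.
apply: le_integral_nonneg => z xz.
  by rewrite mule_ge0 ?poweR_ge0// cavg_ge0.
rewrite poweRM ?lee_fin ?(ltW L0) ?poweR_ge0// -muleA poweR_EFin.
apply: (@le_trans _ _ ((L `^ s)%:E * Phi z)).
  rewrite lee_wpmul2l ?lee_fin ?powR_ge0// /a -(cavg_eq F xz) -(cavg_eq W xz).
  by apply: FW; rewrite kN.
by rewrite lee_wpmul2r// lee_fin /K ler_peMl ?powR_ge0// ler1n.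
Qed.

Let claimS m : claim_prefix m -> claim m.+1.
Proof.
move=> IH k x km; have mQ := measurable_cell G k x.
set a := cavg G k F x; set Q := cell G k x.
have a0 : 0 <= a by exact: cavg_ge0.
pose th := L%:E * a `^ q.
pose y i := cavg G k (f i) x.
have y0 i : 0 <= y i by exact: cavg_ge0.
have ZE z : Q z -> Z m.+1 k z = Zp y m k.+1 z.
  by move=> xz; apply: eq_bigr => i _; rewrite /y /mx /= (cavg_eq _ xz).
have yth : \sum_(i < I) (y i) `^ q <= th.
  apply: le_trans (minkowski_cavg G q1 mf f0 mF F0 fF k x) _.
  by rewrite lee_wpmul2r ?poweR_ge0.
apply: (@le_trans _ _ (\int[mu]_(z in Q) bound th (Z m.+1 k) z)).
  rewrite (_ : \int[mu]_(z in _) bound th _ z =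
      \int[mu]_(z in Q) bound th (Zp y m k.+1) z); last first.
    by apply: eq_integral => z /set_mem xz; rewrite /bound ZE.
  rewrite (_ : \int[mu]_(z in _) _ =
      \int[mu]_(z in Q) (Zp y m k.+1 z `^ s * W z)); last first.
    by apply: eq_integral => z /set_mem xz; rewrite ZE.
  apply: (le_integral_cells (@saturated_cellS _ _ _ _ _ G k x)).
  - exact: msW.
  - exact: mbound.
  - by move=> z; rewrite mule_ge0 ?poweR_ge0.
  - by move=> z; exact: bound0.
  by move=> z xz; apply: IH => //; rewrite addSnnS.
rewrite /bound ge0_integralD//; last 4 first.
- by move=> z _; rewrite mule_ge0 ?poweR_ge0.
- by apply: measurable_funTS; apply: emeasurable_funM => //; exact: measurable_cst.
- by move=> z _; rewrite mule_ge0// lee_fin ltW.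
- apply: measurable_funTS; apply: emeasurable_funM; first exact: measurable_cst.
  exact: mif.
rewrite [X in _ + X]ge0_integralZl//; last 2 first.
- by apply: measurable_funTS; exact: mif.
- by rewrite lee_fin ltW.
rewrite ge0_integralZl//; last 2 first.
- exact: measurable_funTS.
- exact: poweR_ge0.
rewrite -mulr_cavg -/Q.
pose S : set T := [set z | th < Z m.+1 k z].
have mS : measurable S.
  by rewrite -[X in measurable X]setTI; exact: emeasurable_fun_o_infty.
have mQS : measurable (Q `\` S) by exact: measurableD.
pose h z := if th < Z m.+1 k z then 0 else Phi z.
have mh : measurable_fun [set: T] h.
  apply: measurable_fun_ifT => //.
  by apply: measurable_fun_lte => //; exact: measurable_cst.
have h0 z : 0 <= h z by rewrite /h; case: ifP.
(* the part of the cell outside the stopping set carries half of its measure *)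
have half : mu Q <= 2%:E * mu (Q `\` S).
  have := weak m.+1 k x; rewrite -/a -/Q -/S.
  have Qfin : mu Q \is a fin_num by exact: cell_fin_num.
  have fin A : measurable A -> A `<=` Q -> mu A \is a fin_num.
    move=> mA AQ; rewrite ge0_fin_numE//; apply: le_lt_trans (_ : mu Q < +oo).
      by rewrite le_measure ?inE.
    by rewrite ltey_eq Qfin.
  have fI : mu (Q `&` S) \is a fin_num by apply: fin; [exact: measurableI|exact: subIsetl].
  have fD : mu (Q `\` S) \is a fin_num by apply: fin => //; exact: subDsetl.
  have QE : mu Q = mu (Q `\` S) + mu (Q `&` S) by exact: measureDI.
  rewrite QE -(fineK fI) -(fineK fD) -EFinD -!EFinM !lee_fin; lra.
have c0 : 0 <= (a `^ q) `^ s * cavg G k W x by rewrite mule_ge0 ?poweR_ge0// cavg_ge0.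
have outer : th `^ s * (mu Q * cavg G k W x) <= K%:E * \int[mu]_(z in Q) h z.
  rewrite /th poweRM ?lee_fin ?(ltW L0) ?poweR_ge0// poweR_EFin muleCA -!muleA.
  rewrite /K mulrC EFinM -muleA muleCA lee_wpmul2l ?lee_fin ?powR_ge0//.
  apply: (@le_trans _ _ (2%:E * mu (Q `\` S) * ((a `^ q) `^ s * cavg G k W x))).
    by rewrite lee_wpmul2r.
  rewrite -muleA lee_wpmul2l// muleC -integral_cst//.
  apply: (@le_trans _ _ (\int[mu]_(z in Q `\` S) h z)).
    apply: le_integral_nonneg => // z [xz Sz].
    rewrite /h ifF; last by apply/negbTE/negP.
    rewrite /a -(cavg_eq F xz) -(cavg_eq W xz); apply: FW.
    by rewrite -km leq_addr.
  by apply: ge0_subset_integral => //; exact: measurable_funTS.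
apply: le_trans (leeD outer (lexx _)) _.
rewrite -ge0_muleDr; [|by apply: integral_ge0|by apply: integral_ge0].
rewrite lee_wpmul2l ?lee_fin ?(ltW K0)// -ge0_integralD//; last 2 first.
- exact: measurable_funTS.
- by apply: measurable_funTS; exact: mif.
apply: le_integral_nonneg => z _; first by rewrite adde_ge0.
by rewrite /h; case: ifP => _; rewrite ?add0e ?adde0.
Qed.

(** Descending induction on the cells. In each cell the maximal sum exceeds its
    threshold on at most half of the measure; there it is compared with the
    maximal sums of the stopping cells, and elsewhere it is controlled by [Phi]. *)
Lemma sparse_principle :
  \int[mu]_x (vv_maxlev G q I f N 0 x `^ s * W x) <=
  (2 * L `^ s)%:E * \int[mu]_x Phi x.
Proof.
have H m : claim m /\ claim_prefix m.
  elim: m => [|m [_ IH]]; first by split; [exact: claim0|exact: prefix0 claim0].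
  by split; [exact: claimS|exact: prefixS IH (claimS IH)].
rewrite -ge0_integralZl//; last by rewrite lee_fin ltW.
apply: (le_integral_cells (@saturated_setT _ _ _ _ _ G 0)).
- exact: msW.
- by apply: emeasurable_funM => //; exact: measurable_cst.
- by move=> x; rewrite mule_ge0 ?poweR_ge0.
- by move=> x; rewrite mule_ge0// lee_fin ltW.
move=> x _; rewrite ge0_integralZl//; last 3 first.
- exact: measurable_cell.
- exact: measurable_funTS.
- by rewrite lee_fin ltW.
by have [+ _] := H N; apply.
Qed.

End sparse.

(** * Associate Young functions and Hoelder's inequality *)

Section associate.
Variables (R : realType) (B : R -> R).
Hypothesis yB : young B.
Local Notation D := (associate B).

Lemma young0 : B 0%R = 0%R. Proof. by have [] := yB. Qed.

Lemma young_homo (s t : R) : (0 <= s)%R -> (s <= t)%R -> (B s <= B t)%R.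
Proof.
have [_ _ B_homo _ _] := yB; move=> s0; rewrite le_eqVlt => /predU1P[->//|st].
by rewrite ltW// B_homo// in_itv/= andbT// (le_trans s0)// ltW.
Qed.

Lemma young_ge0 (s : R) : (0 <= s)%R -> (0 <= B s)%R.
Proof. by move=> s0; rewrite -young0 young_homo. Qed.

Let vals (t : R) : set R := [set (s * t - B s)%R | s in `]0%R, +oo[].

Let has_sup_vals t : has_sup (vals t).
Proof.
split; first by exists (1 * t - B 1)%R, 1%R => //=; rewrite in_itv/= ltr01.
have [_ _ _ _ /cvgryPgt/(_ t)[M [_ HM]]] := yB.
exists (Num.max M 1 * `|t|)%R => _ [s /= + <-]; rewrite in_itv/= andbT => s0.
have [Ms|sM] := ltP (Num.max M 1%R) s.
  have := HM s (le_lt_trans _ Ms); rewrite le_max lexx => /(_ isT).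
  rewrite ltr_pdivlMr// => /ltW tB.
  rewrite (@le_trans _ _ 0%R)// ?subr_le0 1?mulrC// mulr_ge0//.
  by rewrite le_max ler01 orbT.
rewrite lerBlDr (@le_trans _ _ (Num.max M 1 * `|t|))%R ?lerDl ?young_ge0 ?(ltW s0)//.
by rewrite (@le_trans _ _ (s * `|t|))%R ?ler_wpM2r// ler_wpM2l ?ler_norm// ltW.
Qed.

Lemma associate_homo : {homo D : x y / (x <= y)%R}.
Proof.
move=> x y xy; apply: ge_sup; first by have [] := has_sup_vals x.
move=> _ [s /= s0 <-]; apply: (@le_trans _ _ (s * y - B s)%R).
  by rewrite lerD2r ler_wpM2l//; move: s0; rewrite in_itv/= andbT => /ltW.
by apply: ub_le_sup; [have [] := has_sup_vals y|exists s].
Qed.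

Lemma associate0 : D 0%R = 0%R.
Proof.
apply/eqP; rewrite eq_le; apply/andP; split.
  apply: ge_sup; first by have [] := has_sup_vals 0%R.
  move=> _ [s /= + <-]; rewrite in_itv/= andbT => s0.
  by rewrite mulr0 sub0r oppr_le0 young_ge0// ltW.
apply/ler_addgt0Pr => e e0.
have [/continuous_within_itvcyP[_ B0] _ _ _ _] := yB.
have : \forall s \near 0%R^'+, (B s < e)%R.
  by apply: (cvgr_lt _ B0); rewrite young0.
move=> Be; have [s [s0 Bse]] := filter_ex (filterI (nbhs_right_gt (0%R : R)) Be).
rewrite -lerBlDr sub0r; apply: (@le_trans _ _ (s * 0 - B s)%R).
  by rewrite mulr0 sub0r lerN2 ltW.
by apply: ub_le_sup; [have [] := has_sup_vals 0%R|exists s; rewrite //= in_itv/= s0].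
Qed.

Lemma associate_ge0 (t : R) : (0 <= t)%R -> (0 <= D t)%R.
Proof. by move=> t0; rewrite -associate0 associate_homo. Qed.

Lemma young_associate (s t : R) : (0 <= s)%R -> (0 <= t)%R -> (t * s <= D t + B s)%R.
Proof.
rewrite le_eqVlt => /predU1P[<- t0|s0 t0].
  by rewrite mulr0 young0 addr0 associate_ge0.
rewrite -lerBlDr mulrC; apply: ub_le_sup; first by have [] := has_sup_vals t.
by exists s => //=; rewrite in_itv/= s0.
Qed.

Lemma associate_small : exists2 e : R, (0 < e)%R & (D e <= 2^-1)%R.
Proof.
have D1 : (0 <= D 1)%R by rewrite associate_ge0.
have D10 : (0 < D 1 + 1)%R by rewrite ltr_wpDl.
pose e : R := (2^-1 / (D 1 + 1))%R.
have e0 : (0 < e)%R by rewrite divr_gt0// invr_gt0.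
have e1 : (e <= 1)%R.
  by rewrite ler_pdivrMr// mul1r (@le_trans _ _ 1%R) ?lerDr// invf_le1// ler1n.
(* [s * e - B s <= e * (s * 1 - B s)] because [e <= 1] and [B] is nonnegative *)
exists e => //; apply: (@le_trans _ _ (e * D 1)%R); last first.
  rewrite -mulrA ler_piMr ?invr_ge0// mulrC ler_pdivrMr// mul1r lerDl//.
apply: ge_sup; first by have [] := has_sup_vals e.
move=> _ [s /= s0 <-]; apply: (@le_trans _ _ (e * (s * 1 - B s))%R).
  rewrite mulr1 mulrBr [(s * e)%R]mulrC lerD2l lerN2 ler_piMl// young_ge0//.
  by move: s0; rewrite in_itv/= andbT => /ltW.
rewrite ler_wpM2l ?(ltW e0)//.
by apply: ub_le_sup; [have [] := has_sup_vals 1%R|exists s].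
Qed.

Lemma young_ereal (h k : \bar R) (al be : R) : 0 <= h -> 0 <= k ->
  (0 < al)%R -> (0 < be)%R ->
  h * k <= (al * be)%:E * (er_map D (h * (al^-1)%:E) + er_map B (k * (be^-1)%:E)).
Proof.
move=> + + al0 be0; have ab0 : (0 < al * be)%R by rewrite mulr_gt0.
have Dp (x : \bar R) : 0 <= x -> er_map D x != -oo by case: x.
have Bp (x : \bar R) : 0 <= x -> er_map B x != -oo by case: x.
have ge0 (x : \bar R) (y : R) : 0 <= x -> (0 < y)%R -> 0 <= x * (y^-1)%:E.
  by move=> x0 y0; rewrite mule_ge0// lee_fin invr_ge0 ltW.
have yE (y : R) : (0 < y)%R -> +oo * (y^-1)%:E = +oo :> \bar R.
  by move=> y0; rewrite mulyr gtr0_sg ?invr_gt0// mul1e.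
case: h => [h| |]// h0; last first.
  by move=> k0; rewrite yE// addye ?Bp ?ge0// mulry gtr0_sg// mul1e leey.
case: k => [k| |]// k0; last first.
  by rewrite yE// addey ?Dp ?ge0// [leRHS]mulry gtr0_sg// mul1e leey.
rewrite lee_fin (_ : h * k = al * be * ((h / al) * (k / be)))%R.
  by rewrite ler_wpM2l ?(ltW ab0)// young_associate// divr_ge0// ltW.
by field; rewrite !gt_eqF.
Qed.

Section holder.
Context d (T : measurableType d).
Variable mu : {measure set T -> \bar R}.
Implicit Types (Q : set T) (F h k : T -> \bar R).

Let measurable_young (k : T -> \bar R) (t : R) : (0 < t)%R ->
  measurable_fun [set: T] k -> (forall x, 0 <= k x) ->
  measurable_fun [set: T] (fun x => er_map B (k x * (t^-1)%:E)).
Proof.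
move=> t0 mk k0.
rewrite (_ : (fun _ => _) =
    (fun x => er_map (fun r => B (Num.max r 0%R)) (k x * (t^-1)%:E))).
  apply: measurable_er_mapM => // x y xy; apply: young_homo.
    by rewrite le_max lexx orbT.
  by rewrite ge_max !le_max xy lexx orbT.
apply/funext => x.
have : 0 <= k x * (t^-1)%:E by rewrite mule_ge0// lee_fin invr_ge0 ltW.
by case: (k x * _) => //= r r0; rewrite max_l.
Qed.

(** Hoelder's inequality for the pair [B], [associate B]; the disjunction allows
    for [k = v^(-1/p)] at the zeros of [v], where [F] need not equal [h * k]. *)
Lemma orlicz_holder Q F h k : measurable Q -> 0 < mu Q -> mu Q < +oo ->
  measurable_fun [set: T] F -> measurable_fun [set: T] h -> measurable_fun [set: T] k ->
  (forall x, 0 <= F x) -> (forall x, 0 <= h x) -> (forall x, 0 <= k x) ->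
  (forall x, F x <= h x * k x \/ k x = +oo) ->
  orlicz mu D Q h < +oo -> orlicz mu B Q k < +oo ->
  mean mu Q F <= 2%:E * orlicz mu D Q h * orlicz mu B Q k.
Proof.
move=> mQ Q0 Qy mF mh mk F0 h0 k0 Fhk hy ky.
have aF0 : 0 <= mean mu Q F by rewrite mean_ge0.
have D_homo := associate_homo; have D0 := associate0.
have adm (al be : R) : (0 < al)%R -> (0 < be)%R ->
    mean mu Q (fun x => er_map D (h x * (al^-1)%:E)) <= 1 ->
    mean mu Q (fun x => er_map B (k x * (be^-1)%:E)) <= 1 ->
    mean mu Q F <= (2 * be)%:E * al%:E.
  move=> al0 be0 ha kb.
  have Da0 x : 0 <= er_map D (h x * (al^-1)%:E).
    by rewrite er_map_ge0// mule_ge0// lee_fin invr_ge0 ltW.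
  have Bb0 x : 0 <= er_map B (k x * (be^-1)%:E).
    have : 0 <= k x * (be^-1)%:E by rewrite mule_ge0// lee_fin invr_ge0 ltW.
    by case: (k x * _) => //= r; rewrite !lee_fin; exact: young_ge0.
  have mDa : measurable_fun [set: T] (fun x => er_map D (h x * (al^-1)%:E)).
    exact: measurable_er_mapM.
  have mBb := measurable_young be0 mk k0.
  have ab0 : 0 <= (al * be)%:E by rewrite lee_fin mulr_ge0 ?ltW.
  apply: (@le_trans _ _ (mean mu Q (fun x => (al * be)%:E *
      (er_map D (h x * (al^-1)%:E) + er_map B (k x * (be^-1)%:E))))).
    apply: le_mean => // x _; have [Fx|kx] := Fhk x.
      exact: le_trans Fx (young_ereal (h0 x) (k0 x) al0 be0).
    have -> : er_map B (k x * (be^-1)%:E) = +oo.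
      by rewrite kx mulyr gtr0_sg ?invr_gt0// mul1e.
    have Dn : er_map D (h x * (al^-1)%:E) != -oo.
      by rewrite gt_eqF// (lt_le_trans _ (Da0 x))// ltNyr.
    by rewrite addey// mulry gtr0_sg ?mulr_gt0// mul1e leey.
  rewrite meanZl//; last 2 first.
  - by move=> x _; rewrite adde_ge0.
  - by apply: measurable_funTS; exact: emeasurable_funD.
  rewrite meanD//; [|exact: measurable_funTS..].
  apply: le_trans (lee_wpmul2l ab0 (leeD ha kb)) _.
  by rewrite -EFinD -!EFinM lee_fin; lra.
have step (be : R) : (0 < be)%R ->
    mean mu Q (fun x => er_map B (k x * (be^-1)%:E)) <= 1 ->
    mean mu Q F <= (2 * be)%:E * orlicz mu D Q h.
  move=> be0 kb; have b20 : (0 < 2 * be)%R by rewrite mulr_gt0.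
  rewrite -lee_pdivrMl//; apply: le_ereal_inf_tmp => _ [al [al0 ha] <-].
  by rewrite lee_pdivrMl// adm.
have [h00|hn0] := eqVneq (orlicz mu D Q h) 0.
  have [be [be0 _ kb]] := orlicz_lt ky.
  by have := step be be0 kb; rewrite h00 !mule0 mul0e.
have hp : (0 < 2 * fine (orlicz mu D Q h))%R.
  by rewrite mulr_gt0// fine_gt0// hy lt_neqAle eq_sym hn0 orlicz_ge0.
have hfin : orlicz mu D Q h \is a fin_num by rewrite ge0_fin_numE// orlicz_ge0.
rewrite -(fineK hfin) -EFinM -lee_pdivrMl//.
apply: le_ereal_inf_tmp => _ [be [be0 kb] <-].
rewrite lee_pdivrMl// -EFinM; apply: le_trans (step be be0 kb) _.
by rewrite -(fineK hfin) -EFinM lee_fin mulrAC.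
Qed.

Lemma orlicz_bounded Q h (M : R) : (0 < M)%R -> measurable Q -> 0 < mu Q ->
  mu Q < +oo -> (forall x, 0 <= h x) -> (forall x, h x <= M%:E) ->
  orlicz mu D Q h < +oo.
Proof.
move=> M0 mQ Q0 Qy h0 hM; have [e e0 De] := associate_small.
have Me0 : (0 < M / e)%R by rewrite divr_gt0.
apply: (@le_lt_trans _ _ (M / e)%:E); last by rewrite ltry.
apply: ereal_inf_lbound; exists (M / e)%R => //; split=> //.
apply: (@le_trans _ _ (mean mu Q (cst (2^-1)%:E))).
  apply: le_mean => x _.
    apply: er_map_ge0; [exact: associate_homo|exact: associate0|].
    by rewrite mule_ge0// lee_fin invr_ge0 ltW.
  apply: (@le_trans _ _ (er_map D e%:E)); last by rewrite lee_fin.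
  apply: le_er_map; first exact: associate_homo.
  rewrite lee_pdivrMr// -EFinM mulrCA divff ?gt_eqF// mulr1.
  exact: hM.
by rewrite mean_cst// lee_fin invf_le1// ler1n.
Qed.

Lemma orlicz_eq0_mean Q k : measurable Q -> 0 < mu Q -> mu Q < +oo ->
  measurable_fun [set: T] k -> (forall x, 0 <= k x) ->
  orlicz mu B Q k = 0 -> mean mu Q k = 0.
Proof.
move=> mQ Q0 Qy mk k0 kE; apply/eqP; rewrite eq_le mean_ge0// andbT.
have m1 : measurable_fun [set: T] (cst (1 : \bar R)) by exact: measurable_cst.
apply: (le_trans (orlicz_holder (h := cst 1) (k := k) mQ Q0 Qy mk m1 mk k0 _ k0 _ _ _)).
- by move=> x.
- by move=> x; left; rewrite mul1e.
- by apply: (@orlicz_bounded _ _ 1%R).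
- by rewrite kE ltry.
by rewrite kE mule0.
Qed.

Lemma orlicz_gt0 Q k : measurable Q -> 0 < mu Q -> mu Q < +oo ->
  measurable_fun [set: T] k -> (forall x, 0 < k x) -> 0 < orlicz mu B Q k.
Proof.
move=> mQ Q0 Qy mk k0; rewrite lt_neqAle orlicz_ge0 andbT eq_sym; apply/eqP.
have k0' x : 0 <= k x by exact: ltW.
move=> /(orlicz_eq0_mean mQ Q0 Qy mk k0') kE.
have : \int[mu]_(x in Q) `|k x| = 0.
  under eq_integral do rewrite gee0_abs//.
  by rewrite -mulr_mean// kE mule0.
move=> /(ae_eq_integral_abs mu mQ (measurable_funTS mk)) [N [mN N0 QN]].
have : mu Q <= mu N.
  rewrite le_measure ?inE// => x Qx; apply: QN => /= /(_ Qx) kx.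
  by have := k0 x; rewrite kx ltxx.
by rewrite N0 leNgt Q0.
Qed.

End holder.
End associate.

(** * The two-weight inequalities on a grid *)

Section ereal_products.
Variable R : realType.
Implicit Types a h k U : \bar R.

(** The product of the Hoelder bound for [a] and the bump condition [U * k <= K].
    If [k] is infinite, which happens when [v] vanishes on part of the cell, the
    bump condition forces [U = 0]. *)
Lemma bump_product (K : R) a U h k : (0 < K)%R -> 0 <= a -> 0 <= U -> 0 <= h -> 0 <= k ->
  U * k <= K%:E -> (h < +oo -> k < +oo -> a <= 2%:E * h * k) ->
  a * U <= (2 * K)%:E * h.
Proof.
move=> K0 a0 U0 h0 k0 UkK Hh.
have K20 : (0 < 2 * K)%R by rewrite mulr_gt0.
have [ky|ky] := eqVneq k +oo.
  move: U0; rewrite le_eqVlt => /predU1P[<-|U0].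
    by rewrite mule0 mule_ge0// lee_fin ltW.
  by move: UkK; rewrite ky gt0_muley// leNgt ltry.
have [->|hy] := eqVneq h +oo; first by rewrite mulry gtr0_sg// mul1e leey.
have {Hh} aE : a <= 2%:E * h * k by apply: Hh; rewrite ltey.
apply: le_trans (lee_wpmul2r U0 aE) _.
rewrite -!muleA [k * U]muleC EFinM -muleA lee_wpmul2l// muleC lee_wpmul2r//.
Qed.

(** With [r'] the conjugate exponent: either [a <= dl * h ^ (r' - 1)], or [h] is at
    most [(a / dl) ^ (r - 1)]. *)
Lemma young_small (r dl : R) a h : (1 < r)%R -> (0 < dl)%R -> 0 <= a -> 0 <= h ->
  a * h <= dl%:E * h `^ (conj_exponent r) + (dl `^ (1 - r))%:E * a `^ r.
Proof.
move=> r1 dl0; have r0 := lt_trans ltr01 r1; have r10 : (0 < r - 1)%R by rewrite subr_gt0.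
have rE : (conj_exponent r - 1 = (r - 1)^-1)%R.
  by rewrite /conj_exponent; field; rewrite gt_eqF.
have c0 : (0 < conj_exponent r)%R by rewrite divr_gt0.
have dlr0 : (0 < dl `^ (1 - r))%R by rewrite powR_gt0.
case: a => [a| |]// a0; last first.
  move=> h0; rewrite [X in _ <= _ + _ * X]poweRyr ?gt_eqF// [X in _ <= _ + X]mulry gtr0_sg//.
  rewrite mul1e addey ?leey// gt_eqF// (@lt_le_trans _ _ 0) ?ltNyr//.
  by rewrite mule_ge0 ?poweR_ge0// lee_fin ltW.
case: h => [h| |]// h0; last first.
  rewrite [X in _ <= _ * X + _]poweRyr ?gt_eqF// [X in _ <= X + _]mulry gtr0_sg//.
  by rewrite mul1e addye ?leey.
rewrite !lee_fin in a0 h0; rewrite !poweR_EFin -!EFinM -EFinD lee_fin.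
have [ah|ha] := leP a (dl * h `^ (conj_exponent r - 1))%R.
  apply: (@le_trans _ _ (dl * h `^ (conj_exponent r)))%R; last first.
    by rewrite lerDl mulr_ge0 ?powR_ge0// ltW.
  by rewrite -(mulr_powRB1 h0 c0) [(h * _)%R]mulrC mulrA ler_wpM2r.
apply: (@le_trans _ _ (dl `^ (1 - r) * a `^ r))%R; last first.
  by rewrite lerDr mulr_ge0 ?powR_ge0// ltW.
rewrite -(mulr_powRB1 a0 r0) mulrCA ler_wpM2l//.
move: ha; rewrite rE => /ltW ha.
have : ((dl * h `^ (r - 1)^-1) `^ (r - 1) <= a `^ (r - 1))%R.
  by apply: le_powR => //; [exact: ltW|rewrite mulr_ge0 ?powR_ge0// ltW].
rewrite powRM ?powR_ge0 ?(ltW dl0)// -powRrM mulVf ?gt_eqF// powRr1//.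
move=> da; rewrite -[X in (dl `^ X)%R]opprB powRN mulrC ler_pdivlMr ?powR_gt0//.
by rewrite mulrC.
Qed.

End ereal_products.

Lemma measurable_nondecreasing_cover d (T : measurableType d) (R : realType)
    (mu : {measure set T -> \bar R}) : sigma_finite setT mu ->
  exists E : nat -> set T, [/\ forall x, exists m, E m x,
    forall m, E m `<=` E m.+1, forall m, measurable (E m) & forall m, mu (E m) < +oo].
Proof.
move=> /sigma_finiteP[E [ET ndE Eoo]]; exists E; split.
- by move=> x; have [m _ Em] : (\bigcup_m E m) x by [rewrite -ET]; exists m.
- by move=> m; apply/subsetPset/ndE.
- by move=> m; have [] := Eoo m.
- by move=> m; have [] := Eoo m.
Qed.

Section two_weight.
Context d (T : measurableType d) (R : realType).
Variable mu : {measure set T -> \bar R}.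
Variables (b p q : R) (B : R -> R) (u v : T -> R) (K : R).
Hypotheses (b1 : (1 <= b)%R) (q1 : (1 < q)%R) (p1 : (1 < p)%R).
Hypotheses (yB : young B) (Bp : B_condition p (associate B)).
Hypotheses (mu_ : measurable_fun [set: T] u) (u0 : forall x, (0 <= u x)%R).
Hypotheses (mv : measurable_fun [set: T] v) (v0 : forall x, (0 <= v x)%R).
Hypothesis K0 : (0 < K)%R.
Local Notation D := (associate B).

Let p0 : (0 < p)%R. Proof. exact: lt_trans p1. Qed.
Let q0 : (0 < q)%R. Proof. exact: lt_trans q1. Qed.

(** The function [v ^ (-1/p)], infinite at the zeros of [v]. *)
Let kv x : \bar R := ((v x `^ p^-1)%:E)^-1.
Let hF (F : T -> \bar R) x : \bar R := F x * (v x `^ p^-1)%:E.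

Let mpow (w : T -> R) (r : R) : measurable_fun [set: T] w ->
  measurable_fun [set: T] (fun x => (w x `^ r)%:E).
Proof.
by move=> mw; apply/measurable_EFinP; exact: (measurableT_comp (measurable_powR _)).
Qed.

Let kvE x : kv x = if v x == 0%R then +oo else (v x `^ (- p^-1))%:E.
Proof.
have p1n : (p^-1 != 0)%R by rewrite invr_neq0// gt_eqF.
by rewrite /kv inver powR_eq0 p1n andbT powRN.
Qed.

Let mkv : measurable_fun [set: T] kv.
Proof.
rewrite (_ : kv = fun x => if v x == 0%R then +oo else (v x `^ (- p^-1))%:E); last first.
  by apply/funext => x; exact: kvE.
apply: measurable_fun_ifT; [|exact: measurable_cst|exact: mpow].
by apply: measurable_fun_eqr => //; exact: measurable_cst.
Qed.

Let kv_gt0 x : 0 < kv x.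
Proof.
rewrite kvE; case: ifPn => // vx; rewrite lte_fin powR_gt0//.
by rewrite lt_neqAle eq_sym vx v0.
Qed.

Let kv0 x : 0 <= kv x. Proof. exact: ltW. Qed.

Section fixed_function.
Variable F : T -> \bar R.
Hypotheses (mF : measurable_fun [set: T] F) (F0 : forall x, 0 <= F x).

Let mh : measurable_fun [set: T] (hF F).
Proof. by apply: emeasurable_funM => //; exact: mpow. Qed.

Let h0 x : 0 <= hF F x.
Proof. by rewrite mule_ge0// lee_fin powR_ge0. Qed.

Let Fhk x : F x <= hF F x * kv x \/ kv x = +oo.
Proof.
have [vx|vx] := eqVneq (v x) 0%R; first by right; rewrite kvE vx eqxx.
left; rewrite kvE (negbTE vx) /hF -muleA -EFinM powRN divff ?mule1//.
by rewrite powR_eq0 negb_and vx.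
Qed.

Lemma cavg_le_orlicz (G : grid mu b) k x :
  orlicz mu D (cell G k x) (hF F) < +oo -> orlicz mu B (cell G k x) kv < +oo ->
  cavg G k F x <=
  2%:E * orlicz mu D (cell G k x) (hF F) * orlicz mu B (cell G k x) kv.
Proof.
by apply: orlicz_holder => //; [exact: measurable_cell|exact: cell_gt0|exact: cell_lty].
Qed.

Lemma integral_hF : \int[mu]_x (hF F x `^ p) = \int[mu]_x (F x `^ p * (v x)%:E).
Proof.
apply: eq_integral => x _; rewrite /hF poweRM ?lee_fin ?powR_ge0// poweR_EFin.
by rewrite -powRrM mulVf ?gt_eqF// powRr1.
Qed.

End fixed_function.

Let measurable_hF (F : T -> \bar R) : measurable_fun [set: T] F ->
  measurable_fun [set: T] (hF F).
Proof. by move=> mF; apply: emeasurable_funM => //; exact: mpow. Qed.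

Let hF0 (F : T -> \bar R) x : (forall x, 0 <= F x) -> 0 <= hF F x.
Proof. by move=> F0; rewrite mule_ge0// lee_fin powR_ge0. Qed.

Definition dominated (I : nat) (f : nat -> T -> \bar R) (F : T -> \bar R) :=
  [/\ forall i, measurable_fun [set: T] (f i), forall i x, 0 <= f i x,
    measurable_fun [set: T] F, forall x, 0 <= F x &
    forall x, \sum_(i < I) f i x `^ q <= F x `^ q].

Let MO (A : R -> R) (G : grid mu b) N h x :=
  maxlev (fun l y => orlicz mu (associate A) (cell G l y) h) N 0 x.

Let MO0 A G N h x : 0 <= MO A G N h x.
Proof. by apply: maxlev_ge0 => l y; exact: orlicz_ge0. Qed.

Let mMO A G N h : measurable_fun [set: T] (MO A G N h).
Proof.
apply: measurable_maxlev => l.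
by apply: (measurable_adapted (G := G) (k := l)) => x y /cell_eq ->.
Qed.

Let le_MO A G N h k x : (k <= N)%N ->
  orlicz mu (associate A) (cell G k x) h <= MO A G N h x.
Proof.
exact: (maxlev_ub (fun l y => orlicz mu (associate A) (cell G l y) h) 0 x).
Qed.

(** Since [p <= q], the power [p / q] is subadditive and the sparse principle
    applies with [W = u]. *)
Theorem two_weight_below : (p <= q)%R ->
  exists2 C : R, (0 < C)%R & forall (G : grid mu b),
    (forall k x, (cavg G k (fun y => (u y)%:E) x) `^ p^-1 *
       orlicz mu B (cell G k x) kv <= K%:E) ->
    forall I N f F, dominated I f F ->
    \int[mu]_x (vv_maxlev G q I f N 0 x `^ (p / q) * (u x)%:E) <=
    C%:E * \int[mu]_x (F x `^ p * (v x)%:E).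
Proof.
move=> pq; have [L L2 HL] := vv_weak mu b1 q1.
have [e e0 De] := associate_small yB.
have [C C0 HC] := orlicz_maximal mu (associate_homo yB) (associate0 yB) p0 e0 De Bp.
have L0 : (0 < L)%R by apply: lt_le_trans L2; rewrite powR_gt0.
exists (2 * L `^ (p / q) * ((2 * K) `^ p * C))%R.
  by rewrite !mulr_gt0// powR_gt0// mulr_gt0.
move=> G HG I N f F [mf f0 mF F0 fF].
pose Phi x := ((2 * K) `^ p)%:E * MO B G N (hF F) x `^ p.
have mpM : measurable_fun [set: T] (fun x => MO B G N (hF F) x `^ p).
  exact: (measurableT_comp (measurable_poweR _)).
apply: (@le_trans _ _ ((2 * L `^ (p / q))%:E * \int[mu]_x Phi x)).
  apply: (sparse_principle (F := F) q1 _ _ L2) => //.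
  - by rewrite divr_gt0.
  - by rewrite ler_pdivrMr// mul1r.
  - exact/measurable_EFinP.
  - by apply: emeasurable_funM => //; exact: measurable_cst.
  - by move=> x; rewrite mule_ge0 ?poweR_ge0// lee_fin powR_ge0.
  - by move=> m k x; apply: HL.
  move=> k x kN; set a := cavg G k F x; set U := cavg G k _ x.
  have a0 : 0 <= a by exact: cavg_ge0.
  have U0 : 0 <= U by apply: cavg_ge0 => y; rewrite lee_fin.
  rewrite -poweRrM mulrCA divff ?gt_eqF// mulr1.
  rewrite -{1}(poweRVK (r := p) _ U0) ?gt_eqF// -poweRM ?poweR_ge0//.
  rewrite /Phi -poweR_EFin -poweRM//; last by rewrite lee_fin mulr_ge0// ltW.
  apply: (le_poweR (ltW p0)); first by rewrite mule_ge0 ?poweR_ge0.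
  apply: (@le_trans _ _ ((2 * K)%:E * orlicz mu D (cell G k x) (hF F))).
    apply: (bump_product K0 a0 _ _ _ (HG k x)); rewrite ?poweR_ge0 ?orlicz_ge0//.
    exact: cavg_le_orlicz.
  by rewrite lee_wpmul2l ?le_MO// lee_fin mulr_ge0// ltW.
rewrite /Phi ge0_integralZl//; last 2 first.
- by move=> x _; exact: poweR_ge0.
- by rewrite lee_fin powR_ge0.
rewrite [X in _ <= X * _]EFinM -muleA lee_wpmul2l ?lee_fin ?mulr_ge0 ?powR_ge0//.
rewrite [X in _ <= X * _]EFinM -muleA lee_wpmul2l ?lee_fin ?powR_ge0// -integral_hF//.
by apply: HC => //; [exact: measurable_hF|move=> x; exact: hF0].
Qed.

(** Duality: the sparse principle bounds the integral of the maximal sum against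
    [g * u ^ (q/p)] for a bounded [g]. For [g] a truncated power of the maximal sum
    itself, half of the left-hand side is absorbed. *)
Theorem two_weight_above (A : R -> R) : (q < p)%R -> young A ->
  B_condition (conj_exponent (p / q)) (associate A) -> sigma_finite setT mu ->
  exists2 C : R, (0 < C)%R & forall (G : grid mu b),
    (forall k x,
       (orlicz mu A (cell G k x) (fun y => (u y `^ (q / p))%:E)) `^ q^-1 *
       orlicz mu B (cell G k x) kv <= K%:E) ->
    forall I N f F, dominated I f F ->
    \int[mu]_x (vv_maxlev G q I f N 0 x `^ (p / q) * (u x)%:E) <=
    C%:E * \int[mu]_x (F x `^ p * (v x)%:E).
Proof.
move=> qp yA Ar /measurable_nondecreasing_cover[E [ET ndE mE Eoo]].
set r := (p / q)%R in Ar *.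
have r1 : (1 < r)%R by rewrite /r ltr_pdivlMr// mul1r.
have r0 := lt_trans ltr01 r1; have r10 : (0 < r - 1)%R by rewrite subr_gt0.
set r' := conj_exponent r in Ar *.
have r'0 : (0 < r')%R by rewrite divr_gt0.
have rr' : ((r - 1) * r' = r)%R by rewrite mulrC /r' /conj_exponent divfK// gt_eqF.
have [L L2 HL] := vv_weak mu b1 q1.
have L0 : (0 < L)%R by apply: lt_le_trans L2; rewrite powR_gt0.
have [eB eB0 DeB] := associate_small yB.
have [CB CB0 HCB] := orlicz_maximal mu (associate_homo yB) (associate0 yB) p0 eB0 DeB Bp.
have [eA eA0 DeA] := associate_small yA.
have [CA CA0 HCA] := orlicz_maximal mu (associate_homo yA) (associate0 yA) r'0 eA0 DeA Ar.
pose K2 : R := (2 * (2 * K) `^ q)%R.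
have K20 : (0 < K2)%R by rewrite mulr_gt0 ?powR_gt0 ?mulr_gt0.
pose C1 : R := (2 * L `^ 1 * K2)%R.
have C10 : (0 < C1)%R by rewrite mulr_gt0// mulr_gt0// powR_gt0.
(* with this [dl] the maximal function of [g] contributes half of the integral of
   [g ^ r'] *)
pose dl : R := (2 * (C1 * CA))^-1%R.
have dl0 : (0 < dl)%R by rewrite invr_gt0 mulr_gt0// mulr_gt0.
have dlr0 : (0 < dl `^ (1 - r))%R by rewrite powR_gt0.
exists (2 * (C1 * (dl `^ (1 - r) * CB)))%R; first by rewrite mulr_gt0// mulr_gt0// mulr_gt0.
move=> G HG I N f F [mf f0 mF F0 fF].
pose w x : \bar R := (u x `^ (q / p))%:E.
have mw : measurable_fun [set: T] w by exact: mpow.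
have w0 x : 0 <= w x by rewrite lee_fin powR_ge0.
pose Z x := vv_maxlev G q I f N 0 x.
have mZ : measurable_fun [set: T] Z by exact: measurable_vv_maxlev.
have Z0 x : 0 <= Z x by exact: vv_maxlev_ge0.
pose MB x := MO B G N (hF F) x.
have MB0 x : 0 <= MB x by exact: MO0.
have mMB : measurable_fun [set: T] MB by exact: mMO.
have mMBp s : measurable_fun [set: T] (fun x => MB x `^ s).
  exact: (measurableT_comp (measurable_poweR s) mMB).
set X := \int[mu]_x (F x `^ p * (v x)%:E).
have HB : \int[mu]_x (MB x `^ p) <= CB%:E * X.
  rewrite /X -integral_hF//; apply: HCB => //; first exact: measurable_hF.
  by move=> x; exact: hF0.
have X0 : 0 <= X.
  by apply: integral_ge0 => x _; rewrite mule_ge0 ?poweR_ge0// lee_fin.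
have key (g : T -> \bar R) (M : R) : measurable_fun [set: T] g -> (forall x, 0 <= g x) ->
    (0 < M)%R -> (forall x, g x <= M%:E) ->
    \int[mu]_x (Z x * (g x * w x)) <=
    (2^-1)%:E * \int[mu]_x (g x `^ r') + (C1 * (dl `^ (1 - r) * CB))%:E * X.
  move=> mg g0 M0 gM.
  pose MA x := MO A G N g x.
  have mMA : measurable_fun [set: T] MA by exact: mMO.
  have mMAp s : measurable_fun [set: T] (fun x => MA x `^ s).
    exact: (measurableT_comp (measurable_poweR s) mMA).
  have MA0 x : 0 <= MA x by exact: MO0.
  pose Phi x := K2%:E * (MB x `^ q * MA x).
  have mBA : measurable_fun [set: T] (fun x => MB x `^ q * MA x).
    exact: emeasurable_funM.
  have BA0 x : 0 <= MB x `^ q * MA x by rewrite mule_ge0 ?poweR_ge0.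
  apply: (@le_trans _ _ ((2 * L `^ 1)%:E * \int[mu]_x Phi x)).
    rewrite (_ : \int[mu]_x _ = \int[mu]_x (Z x `^ 1 * (g x * w x))); last first.
      by apply: eq_integral => x _; rewrite poweRe1.
    apply: (sparse_principle (F := F) q1 _ _ L2) => //.
    - exact: emeasurable_funM.
    - by move=> x; rewrite mule_ge0.
    - by apply: emeasurable_funM => //; exact: measurable_cst.
    - by move=> x; rewrite mule_ge0// lee_fin ltW.
    - by move=> m k x; apply: HL.
    move=> k x kN; set a := cavg G k F x; set c := cavg G k _ x.
    have mQ := measurable_cell G k x.
    have [Q0 Qy] := (cell_gt0 G k x, cell_lty G k x).
    have a0 : 0 <= a by exact: cavg_ge0.
    rewrite poweRe1 ?poweR_ge0//.
    set nw := orlicz mu A (cell G k x) w.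
    have nw0 : 0 <= nw by exact: orlicz_ge0.
    have nk0 : 0 < orlicz mu B (cell G k x) kv by exact: orlicz_gt0.
    have nwy : nw < +oo.
      rewrite ltey; apply/eqP => nwE.
      have := HG k x; rewrite -/w -/nw nwE poweRyr ?invr_neq0 ?gt_eqF//.
      by rewrite gt0_mulye// leNgt ltry.
    have aU : a * nw `^ q^-1 <= (2 * K)%:E * orlicz mu D (cell G k x) (hF F).
      apply: (bump_product K0 a0 _ _ _ (HG k x)); rewrite ?poweR_ge0 ?orlicz_ge0//.
      exact: cavg_le_orlicz.
    have aqw : a `^ q * nw <= ((2 * K) `^ q)%:E * MB x `^ q.
      rewrite -{1}(poweRVK (r := q) _ nw0) ?gt_eqF// -poweRM ?poweR_ge0//.
      rewrite -poweR_EFin -poweRM//; last by rewrite lee_fin mulr_ge0// ltW.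
      apply: (le_poweR (ltW q0)); first by rewrite mule_ge0 ?poweR_ge0.
      apply: le_trans aU _.
      by rewrite lee_wpmul2l ?le_MO// lee_fin mulr_ge0// ltW.
    have cE : c <= 2%:E * MA x * nw.
      apply: (@le_trans _ _ (2%:E * orlicz mu (associate A) (cell G k x) g * nw)).
        apply: (orlicz_holder yA) => //.
        - exact: emeasurable_funM.
        - by move=> y; rewrite mule_ge0.
        - by move=> y; left.
        - exact: (orlicz_bounded yA M0).
      by rewrite lee_wpmul2r// lee_wpmul2l// le_MO.
    apply: (@le_trans _ _ (a `^ q * (2%:E * MA x * nw))).
      by rewrite lee_wpmul2l ?poweR_ge0.
    rewrite [2%:E * _ * _]muleC muleA; apply: le_trans (lee_wpmul2r _ aqw) _.
      by rewrite mule_ge0.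
    by rewrite /Phi /K2 EFinM -!muleA [MB x `^ q * (2%:E * _)]muleCA [leLHS]muleCA.
  rewrite /Phi ge0_integralZl//; last by rewrite lee_fin ltW.
  rewrite muleA -EFinM -/C1.
  have XA : \int[mu]_x (MA x `^ r') <= CA%:E * \int[mu]_x (g x `^ r').
    exact: HCA.
  apply: (@le_trans _ _ (C1%:E * (dl%:E * \int[mu]_x (MA x `^ r') +
      (dl `^ (1 - r))%:E * \int[mu]_x (MB x `^ p)))).
    rewrite lee_wpmul2l ?lee_fin ?(ltW C10)//.
    rewrite -ge0_integralZl//; last 2 first.
    - by move=> x _; exact: poweR_ge0.
    - by rewrite lee_fin ltW.
    rewrite -ge0_integralZl//; last 2 first.
    - by move=> x _; exact: poweR_ge0.
    - by rewrite lee_fin ltW.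
    rewrite -ge0_integralD//; last 4 first.
    - by move=> x _; rewrite mule_ge0 ?poweR_ge0// lee_fin ltW.
    - by apply: emeasurable_funM => //; exact: measurable_cst.
    - by move=> x _; rewrite mule_ge0 ?poweR_ge0// lee_fin ltW.
    - by apply: emeasurable_funM => //; exact: measurable_cst.
    apply: le_integral_nonneg => x _; first exact: BA0.
    have -> : MB x `^ p = (MB x `^ q) `^ r.
      by rewrite -poweRrM /r mulrCA divff ?mulr1// gt_eqF.
    by apply: young_small => //; exact: poweR_ge0.
  have g'0 : 0 <= \int[mu]_x (g x `^ r') by apply: integral_ge0 => x _; exact: poweR_ge0.
  apply: (@le_trans _ _ (C1%:E * (dl%:E * (CA%:E * \int[mu]_x (g x `^ r')) +
      (dl `^ (1 - r))%:E * (CB%:E * X)))).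
    rewrite lee_wpmul2l ?lee_fin ?(ltW C10)// leeD// lee_wpmul2l// lee_fin ltW//.
  rewrite ge0_muleDr; last 2 first.
  - by rewrite !mule_ge0// lee_fin ltW.
  - by rewrite !mule_ge0// lee_fin ltW.
  rewrite !muleA -!EFinM (_ : C1 * dl * CA = 2^-1)%R ?[(C1 * (_ * _))%R]mulrA//.
  have half (x y : R) : (0 < x)%R -> (0 < y)%R -> (x * (2 * (x * y))^-1 * y = 2^-1)%R.
    by move=> x0 y0; field; rewrite !gt_eqF.
  exact: half.
pose Y x := Z x * w x.
have Y0 x : 0 <= Y x by rewrite mule_ge0.
have mY : measurable_fun [set: T] Y by exact: emeasurable_funM.
pose cut m x := mine (Y x) m%:R%:E.
have cut0 m x : 0 <= cut m x by rewrite le_min Y0 lee_fin ler0n.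
have mcut m s : measurable_fun [set: T] (fun x => cut m x `^ s).
  apply: (measurableT_comp (measurable_poweR _)); exact: (measurable_mine mY (measurable_cst _)).
pose ind m x : \bar R := (\1_(E m) x : R)%:E.
have mind m : measurable_fun [set: T] (ind m).
  by apply/measurable_EFinP; apply: measurable_indic.
have ind0 m x : 0 <= ind m x by rewrite lee_fin.
have ind1 m x : ind m x <= 1 by rewrite lee_fin indicE; case: (_ \in _).
pose h m x := cut m x `^ r * ind m x.
have mh m : measurable_fun [set: T] (h m) by exact: emeasurable_funM.
have h0 m x : 0 <= h m x by rewrite mule_ge0 ?poweR_ge0.
have cutm m x : cut m x <= m%:R%:E by rewrite ge_min lexx orbT.
(* the truncation makes the integral to be absorbed finite *)
have hfin m : \int[mu]_x h m x \is a fin_num.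
  rewrite ge0_fin_numE; last exact: integral_ge0.
  apply: (@le_lt_trans _ _ (\int[mu]_x ((m%:R `^ r)%:E * ind m x))).
    apply: le_integral_nonneg => x _; first exact: h0.
    by rewrite lee_wpmul2r// -poweR_EFin le_poweR// ltW.
  rewrite ge0_integralZl//.
  rewrite (integral_indic mu measurableT (mE m)) setIT.
  rewrite -[mu (E m)]fineK; last by rewrite ge0_fin_numE.
  by rewrite -EFinM ltry.
have hX m : \int[mu]_x h m x <= (2 * (C1 * (dl `^ (1 - r) * CB)))%:E * X.
  pose g x := cut m x `^ (r - 1) * ind m x.
  have mg : measurable_fun [set: T] g by exact: emeasurable_funM.
  have g0 x : 0 <= g x by rewrite mule_ge0 ?poweR_ge0.
  have gM x : g x <= (m%:R `^ (r - 1) + 1)%:E.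
    apply: (@le_trans _ _ (m%:R `^ (r - 1))%:E); last by rewrite lee_fin lerDl.
    rewrite -[leRHS]mule1 lee_pmul ?poweR_ge0//.
    by rewrite -poweR_EFin le_poweR// ltW.
  have M0 : (0 < m%:R `^ (r - 1) + 1 :> R)%R by rewrite ltr_wpDl ?powR_ge0.
  have := key g _ mg g0 M0 gM.
  have -> : \int[mu]_x (g x `^ r') = \int[mu]_x h m x.
    apply: eq_integral => x _; rewrite /g /h poweRM ?poweR_ge0// -poweRrM rr'.
    congr (_ * _); rewrite /ind indicE; case: (_ \in _) => /=.
      by rewrite powR1.
    by rewrite powR0// gt_eqF.
  have gh : \int[mu]_x h m x <= \int[mu]_x (Z x * (g x * w x)).
    apply: le_integral_nonneg => x _; first exact: h0.
    rewrite muleCA muleC -/(Y x) [leRHS]muleC /h /g muleAC muleA lee_wpmul2r//.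
    have -> : cut m x `^ r = cut m x `^ (r - 1) * cut m x.
      rewrite -[X in _ = _ * X](poweRe1 (cut0 m x)) -poweRD ?addrNK//.
      by rewrite add_neq0_poweRD_def// addrNK gt_eqF.
    by rewrite -muleA lee_wpmul2l ?poweR_ge0// ge_min lexx.
  move=> /(le_trans gh).
  rewrite -(fineK (hfin m)); case: (X) X0 => [X'| |]// _.
    by rewrite -!EFinM -EFinD !lee_fin => H; lra.
  by rewrite [X in _ -> _ <= X]mulry gtr0_sg ?mul1e ?leey// mulr_gt0// mulr_gt0// mulr_gt0.
have ndE' m m' : (m <= m')%N -> E m `<=` E m'.
  move=> /subnKC <-; elim: (m' - m)%N => [|j IH]; first by rewrite addn0.
  by rewrite addnS; apply: subset_trans IH (ndE _).
apply: (integral_sup_le mh h0 _ _ _ hX).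
- move=> x m; rewrite lee_pmul ?poweR_ge0//.
    apply: (le_poweR (ltW r0)) => //; rewrite le_min ge_min lexx/=.
    by rewrite (le_trans (cutm m x))// lee_fin ler_nat.
  rewrite lee_fin !indicE ler_nat; case: (boolP (x \in E m)) => // /set_mem Ex.
  by rewrite mem_set//; exact: ndE Ex.
- by move=> x; rewrite mule_ge0 ?poweR_ge0// lee_fin.
move=> x; have [m0 Em0] := ET x.
have -> : Z x `^ r * (u x)%:E = Y x `^ r.
  rewrite /Y poweRM// /w poweR_EFin -powRrM /r mulf_div [(p * q)%R]mulrC divff ?powRr1//.
  by rewrite mulf_neq0// gt_eqF.
have H (z : R) : (0 <= z)%R -> z%:E <= Y x -> (z `^ r)%:E <= ereal_sup (range (h ^~ x)).
  move=> z0 zY; pose m := maxn m0 (Num.truncn z).+1.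
  apply: le_trans (ereal_sup_ubound (ex_intro2 _ _ m Logic.I erefl)).
  rewrite /h /ind indicE mem_set ?mule1; last exact: ndE' (leq_maxl _ _) _ Em0.
  rewrite -poweR_EFin; apply: (le_poweR (ltW r0)); rewrite ?lee_fin// le_min zY lee_fin.
  by apply: le_trans (ltW (truncnS_gt z)) _; rewrite ler_nat leq_maxr.
case: (Y x) (Y0 x) H => [y| |]// y0 H; first exact: H.
rewrite [X in _ <= X](_ : _ = +oo) ?leey//; apply/eqyP => t t0.
have := H (t `^ r^-1)%R (powR_ge0 _ _) (leey _).
by rewrite -powRrM mulVf ?gt_eqF// powRr1// ltW.
Qed.


End two_weight.

(** * Triadic grids in the Euclidean space *)

Section floors.
Variable R : realType.
Implicit Types z w : R.

Lemma floor_mul3_inj z w (e : int) :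
  Num.floor (3 * z + e%:~R) = Num.floor (3 * w + e%:~R) -> Num.floor z = Num.floor w.
Proof.
have H (x y : R) : Num.floor (3 * x + e%:~R) = Num.floor (3 * y + e%:~R) ->
    (Num.floor x <= Num.floor y)%R.
  move=> xy; rewrite leNgt; apply/negP; rewrite -lezD1 => yx.
  have y1 := floorD1_gt y; have x1 := floor_le x.
  have yx' : ((Num.floor y + 1)%:~R <= (Num.floor x)%:~R :> R)%R by rewrite ler_int.
  have : (3 * (Num.floor y + 1) + e <= Num.floor (3 * x + e%:~R))%R.
    rewrite floor_ge_int rmorphD rmorphM/= lerD2r ler_wpM2l//.
    exact: le_trans yx' x1.
  rewrite leNgt => /negP; apply.
  rewrite xy -(ltr_int R); apply: le_lt_trans (floor_le _) _.
  by rewrite rmorphD rmorphM/= ltrD2r ltr_pM2l.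
by move=> zw; apply/eqP; rewrite eq_le !H.
Qed.

(** A point of [Z] and a point of [Z + 1/2] are at distance at least [1/2], so
    that an interval shorter than [1/2] avoids one of the two sets. *)
Lemma floor_shift z (l : R) : (0 <= l)%R -> (l < 2^-1)%R ->
  Num.floor z = Num.floor (z + l) \/
  Num.floor (z - 2^-1) = Num.floor (z + l - 2^-1).
Proof.
move=> l0 l2; have [|zl] := eqVneq (Num.floor z) (Num.floor (z + l)); first by left.
have {}zl : (Num.floor z < Num.floor (z + l))%R.
  by rewrite lt_neqAle zl le_floor// lerDl.
right; set m := Num.floor (z + l) in zl *.
have zm : (z < m%:~R)%R.
  apply: lt_le_trans (floorD1_gt z) _; rewrite ler_int lezD1//.
have mz : (m%:~R <= z + l)%R by exact: floor_le.
have zm2 : (z + l < m%:~R + 2^-1)%R by rewrite ltrD.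
transitivity (m - 1)%R.
  by apply: floor_def; rewrite subrK rmorphB/=; apply/andP; split; lra.
by apply/esym/floor_def; rewrite subrK rmorphB/=; apply/andP; split; lra.
Qed.

End floors.

Section euclidean_grid.
Variables (R : realType) (n : nat).
Local Notation E := (Rn R n).

Lemma measurable_Rn_box (A : 'I_n -> set (measurableTypeR R)) :
  (forall i, measurable (A i)) ->
  measurable [set x : E | forall i, A i (coordinate x i)].
Proof.
move=> mA; apply: caratheodory_measurable_mu_ext.
exact: (measurable_box mA).
Qed.

Lemma leb_box (A : 'I_n -> set (measurableTypeR R)) :
  (forall i, measurable (A i)) ->
  leb [set x : E | forall i, A i (coordinate x i)] =
  \prod_(i < n) lebesgue_measure (A i).
Proof.
move=> mA; rewrite /leb /completed_measure_extension measurable_mu_extE; last first.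
  exact: measurable_box.
exact: (borel_lebesgue_box mA).
Qed.

Variables (tau : {ffun 'I_n -> bool}) (rho : R).
Hypothesis rho0 : (0 < rho)%R.

(** The side of the cells of level [k] is [1 / (rho * 3 ^ k)]; for each coordinate
    they start at the origin or half a side away from it. With ratio 3, half a
    side of one level differs from half a side of the next one by a full side of
    the latter, so that the cells are nested in both cases. *)
Definition shift (i : 'I_n) : R := if tau i then (2^-1)%R else 0%R.
Definition scale (k : nat) : R := (rho * 3 ^+ k)%R.
Definition corner k (x : E) (i : 'I_n) : int :=
  Num.floor (scale k * coordinate x i - shift i)%R.
Definition tidx k (x : E) : nat := pickle [ffun i => corner k x i].

Lemma scale_gt0 k : (0 < scale k)%R. Proof. by rewrite mulr_gt0// exprn_gt0. Qed.

Lemma tidx_eqP k x y : tidx k x = tidx k y <-> forall i, corner k x i = corner k y i.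
Proof.
split=> [/(pcan_inj pickleK)/ffunP xy i|xy]; first by have := xy i; rewrite !ffunE.
by congr pickle; apply/ffunP => i; rewrite !ffunE.
Qed.

Let side k (x : E) (i : 'I_n) : set (measurableTypeR R) :=
  `[(((corner k x i)%:~R + shift i) / scale k)%R,
    (((corner k x i)%:~R + shift i) / scale k + (scale k)^-1)%R[%classic.

Lemma tidx_box k x :
  [set y | tidx k y = tidx k x] = [set y : E | forall i, side k x i (coordinate y i)].
Proof.
have s0 := scale_gt0 k; apply/seteqP; split=> y /=.
  move=> /tidx_eqP yx i; rewrite /side /= in_itv/= -yx.
  have /andP[] := floor_itv (scale k * coordinate y i - shift i)%R.
  rewrite -/(corner k y i) rmorphD/= => h1 h2.
  rewrite ler_pdivrMr// -[X in (_ < _ + X)%R]div1r -mulrDl ltr_pdivlMr//.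
  by rewrite [(coordinate y i * _)%R]mulrC; apply/andP; split; lra.
move=> yx; apply/tidx_eqP => i; apply: floor_def.
have := yx i; rewrite /side /= in_itv/=.
rewrite ler_pdivrMr// -[X in (_ < _ + X)%R]div1r -mulrDl ltr_pdivlMr//.
rewrite [(coordinate y i * _)%R]mulrC rmorphD/= => /andP[h1 h2].
by apply/andP; split; lra.
Qed.

Let measurable_side k x i : measurable (side k x i).
Proof. exact: measurable_itv. Qed.

Lemma leb_tidx k x : leb [set y | tidx k y = tidx k x] = ((scale k)^-1 ^+ n)%:E.
Proof.
rewrite tidx_box leb_box// (eq_bigr (fun=> ((scale k)^-1)%:E)) => [|i _].
  by rewrite big_const_ord; elim: (n) => //= m ->; rewrite exprS EFinM.
rewrite lebesgue_measure_itv /= lte_fin ltrDl invr_gt0 scale_gt0.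
by rewrite -EFinD addrAC subrr add0r.
Qed.

Lemma measurable_tidx k m : measurable [set x | tidx k x = m].
Proof.
have [->//|/set0P[x xm]] := eqVneq [set x | tidx k x = m] set0.
rewrite -xm tidx_box; exact: measurable_Rn_box.
Qed.

Lemma tidx_nested k x y : tidx k.+1 x = tidx k.+1 y -> tidx k x = tidx k y.
Proof.
move=> /tidx_eqP xy; apply/tidx_eqP => i.
pose e : int := if tau i then 1%R else 0%R.
have sE z : (scale k.+1 * coordinate z i - shift i =
    3 * (scale k * coordinate z i - shift i) + e%:~R)%R.
  rewrite /scale exprS /e /shift; case: (tau i); last by rewrite !subr0 addr0; ring.
  by field.
by apply: (@floor_mul3_inj _ _ _ e); rewrite -!sE; exact: xy.
Qed.

Lemma tidx_gt0 k x : 0 < leb [set y | tidx k y = tidx k x].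
Proof. by rewrite leb_tidx lte_fin exprn_gt0// invr_gt0 scale_gt0. Qed.

Lemma tidx_lty k x : leb [set y | tidx k y = tidx k x] < +oo.
Proof. by rewrite leb_tidx ltry. Qed.

Lemma tidx_doubling k x : leb [set y | tidx k y = tidx k x] <=
  (3 ^+ n)%:E * leb [set y | tidx k.+1 y = tidx k.+1 x].
Proof.
rewrite !leb_tidx -EFinM lee_fin -exprMn /scale exprS le_eqVlt; apply/orP; left.
apply/eqP; congr (_ ^+ _)%R; field.
by rewrite expf_neq0//= gt_eqF.
Qed.

Definition tgrid : grid (leb (R:=R) (n:=n)) (3 ^+ n)%R :=
  Grid measurable_tidx tidx_nested tidx_gt0 tidx_lty tidx_doubling.

(** The closure of a cell is a cube of the same measure, through which conditions
    on cubes pass to cells. *)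
Lemma cell_in_cube k x : exists Q : set E, [/\ is_cube Q, cell tgrid k x `<=` Q &
  leb (cell tgrid k x) = leb Q].
Proof.
have s0 := scale_gt0 k.
exists (cube (fun i => ((corner k x i)%:~R + shift i) / scale k)%R (scale k)^-1%R).
split.
- by exists (fun i => ((corner k x i)%:~R + shift i) / scale k)%R, (scale k)^-1%R;
    rewrite ?invr_gt0.
- rewrite /cell /= tidx_box => y yx i; have := yx i; rewrite /side /= in_itv/=.
  by move=> /andP[-> /ltW].
- by rewrite leb_cube ?invr_ge0 ?ltW// -(leb_tidx k x).
Qed.

End euclidean_grid.

Section cubes.
Variables (R : realType) (n : nat).
Local Notation E := (Rn R n).

(** The one-third trick: the shift is chosen in each coordinate by
    [floor_shift]. *)
Lemma cube_in_cell (rho : R) (rho0 : (0 < rho)%R) k (a : 'I_n -> R) (l : R) :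
  (0 < l)%R -> (scale rho k * l < 2^-1)%R ->
  exists tau : {ffun 'I_n -> bool}, forall x : E, cube a l x ->
    cube a l `<=` cell (tgrid tau rho0) k x.
Proof.
move=> l0 sl; set c := scale rho k; have c0 : (0 < c)%R by exact: scale_gt0.
pose tau := [ffun i => Num.floor (c * a i) != Num.floor (c * a i + c * l)].
exists tau => x Qx y Qy; rewrite /cell /=; apply/tidx_eqP => i.
have ends : Num.floor (c * a i - shift R tau i) =
    Num.floor (c * a i + c * l - shift R tau i).
  have cl0 : (0 <= c * l)%R by rewrite mulr_ge0 ?ltW.
  rewrite /shift ffunE; have [H|H] := eqVneq (Num.floor (c * a i)) (Num.floor (c * a i + c * l)).
    by rewrite !subr0.
  by have [/eqP|] := floor_shift (c * a i) cl0 sl; first by rewrite (negbTE H).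
have inside (z : E) : cube a l z -> corner tau rho k z i = Num.floor (c * a i - shift R tau i).
  move=> /(_ i) /andP[az za]; apply/eqP; rewrite eq_le; apply/andP; split.
    by rewrite ends le_floor// lerD2r -mulrDr ler_wpM2l// ltW.
  by rewrite le_floor// lerD2r ler_wpM2l// ltW.
by rewrite !inside.
Qed.

Definition triadic (K : nat) : R := (3 ^+ K)^-1%R.

Lemma triadic_gt0 K : (0 < triadic K)%R. Proof. by rewrite invr_gt0 exprn_gt0. Qed.

(** The grids with cells of side [3 ^ K], [3 ^ (K - 1)], etc. *)
Definition tgridK (tau : {ffun 'I_n -> bool}) (K : nat) := tgrid tau (triadic_gt0 K).

Lemma scale_triadicS K k : scale (triadic K) k = scale (triadic K.+1) k.+1.
Proof.
by rewrite /scale /triadic !exprS; field; rewrite expf_neq0.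
Qed.

Lemma cell_tgridKS tau K k x : cell (tgridK tau K) k x = cell (tgridK tau K.+1) k.+1 x.
Proof.
by rewrite /cell /= /tidx /corner -scale_triadicS.
Qed.

Lemma triadic_level (l : R) : (0 < l)%R -> exists K k, [/\ (k <= 2 * K)%N,
  (scale (triadic K) k * l < 2^-1)%R & (6^-1 <= scale (triadic K) k * l)%R].
Proof.
move=> l0.
have big (z : R) : (0 <= z)%R -> (z < 3 ^+ (Num.truncn z).+1)%R.
  move=> z0; apply: lt_trans (truncnS_gt z) _.
  by rewrite -natrX ltr_nat ltn_expl.
pose K := maxn (Num.truncn (2 * l)).+1 (Num.truncn (6 * l)^-1).+1.
have mono a : (a <= K)%N -> (3 ^+ a <= 3 ^+ K :> R)%R by move=> aK; rewrite ler_eXn2l ?ltr1n.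
have K1 : (2 * l < 3 ^+ K)%R.
  by apply: lt_le_trans (big _ _) (mono _ (leq_maxl _ _)); rewrite mulr_ge0// ltW.
have K2 : ((6 * l)^-1 < 3 ^+ K)%R.
  apply: lt_le_trans (big _ _) (mono _ (leq_maxr _ _)).
  by rewrite invr_ge0 mulr_ge0// ltW.
have K0 : (0 < 3 ^+ K :> R)%R by rewrite exprn_gt0.
have ex : exists k, (6^-1 <= scale (triadic K) k * l)%R && (k <= 2 * K)%N.
  exists (2 * K)%N; rewrite leqnn andbT /scale /triadic mul2n -addnn exprD mulKf ?gt_eqF//.
  rewrite -ler_pdivrMr// ltW//; apply: le_lt_trans K2.
  by rewrite invfM lexx.
case: (ex_minnP ex) => -[|k] /andP[kl kK] kmin; exists K.
  exists 0%N; split => //; rewrite /scale expr0 mulr1 /triadic mulrC ltr_pdivrMr//.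
  by rewrite mulrC ltr_pdivlMr// mulrC.
exists k.+1; split => //.
have : (scale (triadic K) k * l < 6^-1)%R.
  rewrite ltNge; apply/negP => kl'.
  by have := kmin k; rewrite kl' (ltnW kK) => /(_ isT); rewrite ltnn.
have -> : (scale (triadic K) k.+1 = 3 * scale (triadic K) k)%R.
  by rewrite /scale exprS; ring.
by move=> H; lra.
Qed.

End cubes.

(** * From the grids to all cubes *)

Section suprema.
Variable R : realType.
Implicit Types a b : nat -> \bar R.

Lemma ereal_sup_add_le a b : nondecreasing_seq a -> nondecreasing_seq b ->
  (forall k, 0 <= a k) -> (forall k, 0 <= b k) ->
  ereal_sup (range a) + ereal_sup (range b) <= ereal_sup (range (fun k => a k + b k)).
Proof.
move=> nda ndb a0 b0.
have sa0 : 0 <= ereal_sup (range a).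
  by apply: le_trans (a0 0%N) _; apply: ereal_sup_ubound; exists 0%N.
have sb0 : 0 <= ereal_sup (range b).
  by apply: le_trans (b0 0%N) _; apply: ereal_sup_ubound; exists 0%N.
have ab : a k + b k @[k --> \oo] --> ereal_sup (range a) + ereal_sup (range b).
  apply: cvgeD; [exact: ge0_adde_def|exact: ereal_nondecreasing_cvgn..].
have ndab : nondecreasing_seq (fun k => a k + b k).
  by move=> k l kl; rewrite leeD ?nda ?ndb.
by rewrite -(cvg_lim _ ab)// -(cvg_lim _ (ereal_nondecreasing_cvgn ndab)).
Qed.

Lemma ereal_sup_sum_le (c : nat -> nat -> \bar R) I :
  (forall i, nondecreasing_seq (c i)) -> (forall i k, 0 <= c i k) ->
  \sum_(i < I) ereal_sup (range (c i)) <= ereal_sup (range (fun k => \sum_(i < I) c i k)).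
Proof.
move=> ndc c0; elim: I => [|I IH].
  rewrite big_ord0; apply: ereal_sup_ubound; exists 0%N => //.
  by rewrite big_ord0.
rewrite big_ord_recr/=; apply: le_trans (leeD IH (lexx _)) _.
apply: le_trans (ereal_sup_add_le _ _ _ _) _ => //.
- by move=> k l kl; apply: lee_sum => i _; exact: ndc.
- by move=> k; exact: sume_ge0.
apply: ereal_sup_le => _ [k _ <-]; exists k => //.
by rewrite big_ord_recr.
Qed.

Lemma ereal_sup_powM_le (V : nat -> \bar R) (s u : R) : (0 < s)%R -> (0 <= u)%R ->
  (forall k, 0 <= V k) ->
  ereal_sup (range V) `^ s * u%:E <= ereal_sup (range (fun k => V k `^ s * u%:E)).
Proof.
move=> s0 + V0; set c := (X in _ -> _ <= X).
have c0 : u%:E >= 0 -> 0 <= c.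
  move=> u0; apply: (@le_trans _ _ (V 0%N `^ s * u%:E)); first by rewrite mule_ge0 ?poweR_ge0.
  by apply: ereal_sup_ubound; exists 0%N.
rewrite le_eqVlt => /predU1P[u0|u0]; first by rewrite -u0 mule0 c0// -u0.
have s1 : (s != 0)%R by rewrite gt_eqF.
have uc0 : 0 <= c * (u^-1)%:E by rewrite mule_ge0 ?c0 ?lee_fin ?invr_ge0 ?ltW.
rewrite -lee_pdivlMr//; rewrite -[leRHS](poweRVK s1)//.
apply: (le_poweR (ltW s0)).
  by apply: le_trans (V0 0%N) _; apply: ereal_sup_ubound; exists 0%N.
apply: ge_ereal_sup => _ [k _ <-]; rewrite -[leLHS](poweRK s1)//.
apply: le_poweR; rewrite ?invr_ge0 ?(ltW s0) ?poweR_ge0// lee_pdivlMr//.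
by apply: ereal_sup_ubound; exists k.
Qed.

Lemma sume_const (I : Type) (l : seq I) (X : \bar R) : 0 <= X ->
  \sum_(i <- l) X = (size l)%:R%:E * X.
Proof.
move=> X0; elim: l => [|i l IH]; first by rewrite big_nil mul0e.
by rewrite big_cons IH /= -[in RHS]add1n natrD EFinD ge0_muleDl ?lee_fin// mul1e.
Qed.

End suprema.

Lemma measurable_powM d (T : measurableType d) (R : realType) (s : R)
    (h w : T -> \bar R) : measurable_fun [set: T] h -> measurable_fun [set: T] w ->
  measurable_fun [set: T] (fun x => h x `^ s * w x).
Proof.
move=> mh mw; apply: emeasurable_funM => //.
exact: (measurableT_comp (measurable_poweR _)).
Qed.

Section all_cubes.
Variables (R : realType) (n : nat).
Local Notation E := (Rn R n).
Local Notation mu := (leb (R:=R) (n:=n)).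
Local Notation shifts := {ffun 'I_n -> bool}.

Lemma integral_subset_le (A B : set E) (g : E -> \bar R) : A `<=` B ->
  (forall x, 0 <= g x) -> \int[mu]_(x in A) g x <= \int[mu]_(x in B) g x.
Proof.
move=> AB g0; rewrite integral_mkcond [leRHS]integral_mkcond.
have gp0 x : point <= g x by exact: g0.
apply: le_integral_nonneg => x _; rewrite /patch; case: ifPn => //.
  by move=> /set_mem /AB Bx; rewrite mem_set.
by move=> _; case: ifP.
Qed.

Definition shifted_max (g : E -> \bar R) (tau : shifts) K x :=
  maxlev (fun l => cavg (tgridK R tau K) l g) (2 * K) 0 x.

Lemma shifted_max_ge0 g tau K x : (forall x, 0 <= g x) -> 0 <= shifted_max g tau K x.
Proof. by move=> g0; apply: maxlev_ge0 => l y; exact: cavg_ge0. Qed.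

Lemma shifted_maxS g tau K x : shifted_max g tau K x <= shifted_max g tau K.+1 x.
Proof.
have H N m k (c : \bar R) : (forall l, (l <= m)%N -> N (k + l)%N x <= c) -> maxlev N m k x <= c.
  elim: m k => [|m IH] k Nc /=; first by have := Nc 0%N isT; rewrite addn0.
  rewrite ge_max; have := Nc 0%N isT; rewrite addn0 => -> /=.
  by apply: IH => l lm; rewrite addSnnS Nc.
apply: H => l lm; rewrite add0n.
have -> : cavg (tgridK R tau K) l g x = cavg (tgridK R tau K.+1) l.+1 g x.
  by rewrite /cavg cell_tgridKS.
have lm' : (l.+1 <= 2 * K.+1)%N by rewrite mulnS addSn ltnS (leq_trans lm)// leq_addl.
exact: (maxlev_ub (fun l => cavg (tgridK R tau K.+1) l g) 0 x lm').
Qed.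

(** A cube of side [l] lies in a cell of side at most [6 * l]. *)
Lemma avg_le_shifted_max (Q : set E) (g : E -> \bar R) x : is_cube Q -> Q x ->
  (forall y, 0 <= g y) ->
  exists tau K, avg Q g <= (6 ^+ n)%:E * shifted_max g tau K x.
Proof.
move=> [a [l l0 ->]] Qx g0.
have [K [k [kK sl2 sl6]]] := triadic_level l0.
have [tau Qcell] := cube_in_cell (triadic_gt0 R K) a l0 sl2.
exists tau, K; set c := scale (triadic R K) k in sl2 sl6.
have c0 : (0 < c)%R by exact: scale_gt0 (triadic_gt0 R K) k.
have cl0 : (0 < c * l)%R by rewrite mulr_gt0.
have ln0 : (0 < l ^+ n)%R by rewrite exprn_gt0.
apply: (@le_trans _ _ ((6 ^+ n)%:E * cavg (tgridK R tau K) k g x)); last first.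
  rewrite lee_wpmul2l ?lee_fin ?exprn_ge0//.
  exact: (maxlev_ub (fun l => cavg (tgridK R tau K) l g) 0 x kK).
rewrite /avg leb_cube ?(ltW l0)// inver gt_eqF// lee_pdivrMl//.
apply: le_trans (integral_subset_le (Qcell x Qx) g0) _.
have -> : \int[mu]_(y in cell (tgrid tau (triadic_gt0 R K)) k x) g y =
    (c^-1 ^+ n)%:E * cavg (tgridK R tau K) k g x.
  by rewrite -(leb_tidx tau (triadic_gt0 R K) k x) -(mulr_cavg (tgridK R tau K)).
rewrite [leRHS]muleA -EFinM lee_wpmul2r ?cavg_ge0// lee_fin -exprMn.
apply: lerXn2r; rewrite ?nnegrE; [by rewrite invr_ge0 ltW|by rewrite mulr_ge0// ltW|].
by rewrite -div1r ler_pdivrMr//; move: sl6; rewrite -/c; lra.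
Qed.

Variables (p q : R) (u : E -> R).
Hypotheses (p0 : (0 < p)%R) (q0 : (0 < q)%R).
Hypotheses (meas_u : measurable_fun [set: E] u) (u0 : forall x, (0 <= u x)%R).

Let M : R := ((6 ^+ n) `^ q)%R.
Let M0 : (0 < M)%R. Proof. by rewrite powR_gt0// exprn_gt0. Qed.

Lemma hl_maximal_le (f : E -> R) x :
  hl_maximal f x `^ q <= M%:E *
    ereal_sup (range (fun K => \sum_(tau : shifts) shifted_max (fun y => `|f y|%:E) tau K x `^ q)).
Proof.
set g := fun y => `|f y|%:E; set c := ereal_sup _.
have g0 y : 0 <= g y by rewrite lee_fin.
have s0 tau K : 0 <= shifted_max g tau K x by exact: shifted_max_ge0.
have cK tau K : shifted_max g tau K x `^ q <= c.
  apply: (@le_trans _ _ (\sum_(tau : shifts) shifted_max g tau K x `^ q)).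
    by rewrite (bigD1 tau)//= leeDl// sume_ge0// => t _; exact: poweR_ge0.
  by apply: ereal_sup_ubound; exists K.
have c0 : 0 <= c by apply: le_trans (cK [ffun=> true] 0%N); exact: poweR_ge0.
have qn : (q != 0)%R by rewrite gt_eqF.
rewrite -[c](poweRVK qn)// /M -poweR_EFin -poweRM ?poweR_ge0 ?lee_fin ?exprn_ge0//.
have mean0 (Q : set E) : 0 <= avg Q g.
  by rewrite mule_ge0 ?inve_ge0//; apply: integral_ge0.
have [c1 c2] : exists a : 'I_n -> R, cube a 1 x.
  by exists (coordinate x) => i; rewrite lexx lerDl ler01.
apply: (le_poweR (ltW q0)).
  apply: le_trans (mean0 (cube c1 1%R)) _; apply: ereal_sup_ubound.
  by exists (cube c1 1%R) => //; split=> //; exists c1, 1%R.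
apply: ge_ereal_sup => _ [Q [cQ Qx] <-].
have [tau [K H]] := avg_le_shifted_max cQ Qx g0.
apply: le_trans H _; rewrite lee_wpmul2l ?lee_fin ?exprn_ge0//.
rewrite -[leLHS](poweRK qn)//; apply: le_poweR; rewrite ?invr_ge0 ?(ltW q0) ?poweR_ge0//.
Qed.

Variable f : nat -> E -> R.
Hypothesis mf : forall i, measurable_fun [set: E] (f i).

Let g i x : \bar R := `|f i x|%:E.
Let g0 i x : 0 <= g i x. Proof. by rewrite lee_fin. Qed.

Let V K x := \sum_(tau : shifts) vv_maxlev (tgridK R tau K) q K g (2 * K) 0 x.
Let V0 K x : 0 <= V K x.
Proof. by apply: sume_ge0 => tau _; exact: vv_maxlev_ge0. Qed.

Let W i K x := \sum_(tau : shifts) shifted_max (g i) tau K x `^ q.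
Let W0 i K x : 0 <= W i K x.
Proof. by apply: sume_ge0 => tau _; exact: poweR_ge0. Qed.

Let WS i x : nondecreasing_seq (fun K => W i K x).
Proof.
apply/nondecreasing_seqP => K; apply: lee_sum => tau _.
by apply: (le_poweR (ltW q0)); [exact: shifted_max_ge0|exact: shifted_maxS].
Qed.

Let VE K x : V K x = \sum_(i < K) W i K x.
Proof. by rewrite /V /W exchange_big. Qed.

Let sum_W_le I K K' x : (I <= K')%N -> (K <= K')%N -> \sum_(i < I) W i K x <= V K' x.
Proof.
move=> IK KK; rewrite VE; apply: (@le_trans _ _ (\sum_(i < I) W i K' x)).
  by apply: lee_sum => i _; exact: WS.
rewrite -(subnKC IK) big_split_ord/= leeDl// sume_ge0// => i _.
Qed.

Let VS K x : V K x <= V K.+1 x.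
Proof. by rewrite {1}VE; apply: sum_W_le. Qed.

Let sum_maximal_le x : \sum_(i <oo) hl_maximal (f i) x `^ q <=
  M%:E * ereal_sup (range (V ^~ x)).
Proof.
apply: lime_le; first by apply: is_cvg_nneseries => i _ _; exact: poweR_ge0.
apply: nearW => I; rewrite big_mkord.
apply: (@le_trans _ _ (\sum_(i < I) M%:E * ereal_sup (range (fun K => W i K x)))).
  by apply: lee_sum => i _; exact: hl_maximal_le.
rewrite -ge0_sume_distrr; last first.
  by move=> i _; apply: le_trans (W0 i 0 x) _; apply: ereal_sup_ubound; exists 0%N.
rewrite lee_wpmul2l ?lee_fin ?(ltW M0)//.
apply: le_trans (@ereal_sup_sum_le R (fun i K => W i K x) I _ _) _ => //.
apply: ge_ereal_sup => _ [K _ <-].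
apply: (@le_trans _ _ (V (maxn I K) x)); last by apply: ereal_sup_ubound; exists (maxn I K).
by apply: sum_W_le; rewrite ?leq_maxl ?leq_maxr.
Qed.

Let s : R := (p / q)%R.
Let s0 : (0 < s)%R. Proof. by rewrite divr_gt0. Qed.

Let vvE x : `|vv_maximal q f x| `^ p = (\sum_(i <oo) hl_maximal (f i) x `^ q) `^ s.
Proof.
rewrite gee0_abs ?poweR_ge0// /vv_maximal /lq_norm -poweRrM /s [(q^-1 * p)%R]mulrC.
congr (_ `^ _); apply: eq_eseriesr => i _.
rewrite gee0_abs//; have [a xa] : exists a : 'I_n -> R, cube a 1 x.
  by exists (coordinate x) => i'; rewrite lexx lerDl ler01.
apply: le_trans (_ : 0 <= avg (cube a 1%R) (g i)) _.
  by rewrite mule_ge0 ?inve_ge0//; apply: integral_ge0.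
by apply: ereal_sup_ubound; exists (cube a 1%R) => //; split=> //; exists a, 1%R.
Qed.

(** Monotone convergence in [K]: larger and smaller cells and more functions enter
    together, and every cube is eventually seen by one of the grids. *)
Lemma vv_maximal_integral_le (X : \bar R) : 0 <= X ->
  (forall tau K, \int[mu]_x (vv_maxlev (tgridK R tau K) q K g (2 * K) 0 x `^ (p / q) * (u x)%:E)
    <= X) ->
  \int[mu]_x (`|vv_maximal q f x| `^ p * (u x)%:E) <=
  (((6 ^+ n) `^ q) `^ (p / q) * (#|{: shifts}|%:R `^ (p / q) * #|{: shifts}|%:R))%:E * X.
Proof.
move=> X0 HX; rewrite -/M -/s.
have mu_ : measurable_fun [set: E] (fun x => (u x)%:E) by exact/measurable_EFinP.
have mZ tau K : measurable_fun [set: E]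
    (fun x => vv_maxlev (tgridK R tau K) q K g (2 * K) 0 x `^ s * (u x)%:E).
  exact: measurable_powM (measurable_vv_maxlev _ _ _ _ _ _) mu_.
have mV K : measurable_fun [set: E] (V K).
  by apply: emeasurable_sum => tau; exact: measurable_vv_maxlev.
have mVs K : measurable_fun [set: E] (fun x => V K x `^ s * (u x)%:E).
  exact: measurable_powM (mV K) mu_.
have Ms : 0 <= (M `^ s)%:E by rewrite lee_fin powR_ge0.
have Vu0 K x : 0 <= V K x `^ s * (u x)%:E by rewrite mule_ge0 ?poweR_ge0 ?lee_fin.
apply: (@integral_sup_le _ _ _ mu (fun K x => (M `^ s)%:E * (V K x `^ s * (u x)%:E))).
- by move=> K; exact: emeasurable_funM (measurable_cst _) (mVs K).
- by move=> K x; rewrite mule_ge0.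
- move=> x K; rewrite lee_wpmul2l// lee_wpmul2r ?lee_fin//.
  exact: (le_poweR (ltW s0)).
- by move=> x; rewrite mule_ge0 ?poweR_ge0 ?lee_fin.
- move=> x; rewrite vvE.
  have supV0 : 0 <= ereal_sup (range (V ^~ x)).
    by apply: le_trans (V0 0 x) _; apply: ereal_sup_ubound; exists 0%N.
  apply: (@le_trans _ _ ((M%:E * ereal_sup (range (V ^~ x))) `^ s * (u x)%:E)).
    rewrite lee_wpmul2r ?lee_fin//; apply: (le_poweR (ltW s0)); last exact: sum_maximal_le.
    by apply: nneseries_ge0 => i _ _; exact: poweR_ge0.
  rewrite poweRM ?lee_fin ?(ltW M0)// -muleA.
  apply: le_trans (lee_wpmul2l _ (ereal_sup_powM_le s0 (u0 x) (fun K => V0 K x))) _ => //.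
  rewrite muleC -lee_pdivlMr ?powR_gt0//; apply: ge_ereal_sup => _ [K _ <-].
  rewrite lee_pdivlMr ?powR_gt0// muleC.
  by apply: ereal_sup_ubound; exists K.
move=> K; rewrite ge0_integralZl// EFinM -muleA lee_wpmul2l//.
pose N : R := #|{: shifts}|%:R.
have sz : size (index_enum {: shifts}) = #|{: shifts}| by rewrite cardE enumT.
have N0 : 0 <= (N `^ s)%:E by rewrite lee_fin powR_ge0.
pose Z t x := vv_maxlev (tgridK R t K) q K g (2 * K) 0 x `^ s * (u x)%:E.
have Z0 t x : 0 <= Z t x by rewrite mule_ge0 ?poweR_ge0 ?lee_fin.
pose H t x := (N `^ s)%:E * Z t x.
have mH t : measurable_fun [set: E] (H t).
  exact: emeasurable_funM (measurable_cst _) (mZ t K).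
have H0 t x : 0 <= H t x by rewrite mule_ge0.
apply: (@le_trans _ _ (\int[mu]_x \sum_(t <- index_enum shifts) H t x)).
  apply: le_integral_nonneg => x _; first exact: Vu0.
  rewrite -ge0_sume_distrr; last by move=> t _; exact: Z0.
  rewrite -ge0_sume_distrl; last by move=> t _; exact: poweR_ge0.
  rewrite muleA lee_wpmul2r ?lee_fin// /N -sz; apply: poweR_sum_le => // t.
  exact: vv_maxlev_ge0.
rewrite (ge0_integral_sum mu measurableT mH (fun t x _ => H0 t x)).
rewrite EFinM -muleA -/N {2}/N -sz -(sume_const _ X0) ge0_sume_distrr; last by [].
apply: lee_sum => t _.
rewrite (ge0_integralZl mu measurableT (mZ t K) (fun x _ => Z0 t x) N0).
by rewrite lee_wpmul2l//; exact: HX.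
Qed.

End all_cubes.

(** * The two-weight theorem *)

Lemma measurable_lq_norm d (T : measurableType d) (R : realType) (q : R)
    (f : nat -> T -> \bar R) : (forall i, measurable_fun [set: T] (f i)) ->
  measurable_fun [set: T] (fun x => lq_norm q (f ^~ x)).
Proof.
move=> mf; apply: (measurableT_comp (measurable_poweR _)).
apply: measurable_nneseries => [i x|i]; first exact: poweR_ge0.
by apply: (measurableT_comp (measurable_poweR q)); exact: measurableT_comp.
Qed.

Lemma lq_norm_sum_le (R : realType) (q : R) (a : nat -> \bar R) I : (0 < q)%R ->
  \sum_(i < I) `|a i| `^ q <= lq_norm q a `^ q.
Proof.
move=> q0; have a0 i : 0 <= `|a i| `^ q by exact: poweR_ge0.
rewrite /lq_norm poweRVK ?gt_eqF ?nneseries_ge0//.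
rewrite -(big_mkord xpredT (fun i => `|a i| `^ q)).
exact: nneseries_lim_ge.
Qed.

Section from_cubes_to_cells.
Variables (R : realType) (n : nat).
Local Notation E := (Rn R n).
Local Notation mu := (leb (R:=R) (n:=n)).

Lemma mean_le_avg (A Q : set E) (g : E -> \bar R) : A `<=` Q -> mu A = mu Q ->
  (forall x, 0 <= g x) -> mean mu A g <= avg Q g.
Proof.
move=> AQ muAQ g0; have -> : mean mu A g = (mu Q)^-1 * \int[mu]_(x in A) g x by rewrite -muAQ.
by rewrite lee_wpmul2l ?inve_ge0//; exact: integral_subset_le.
Qed.

Lemma orlicz_le_luxemburg (B : R -> R) (A Q : set E) (h : E -> \bar R) : young B ->
  A `<=` Q -> mu A = mu Q -> (forall x, 0 <= h x) ->
  orlicz mu B A h <= luxemburg B Q h.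
Proof.
move=> yB AQ muAQ h0; apply: ereal_inf_le_tmp => _ [l [l0 lQ] <-]; exists l; last by [].
split; [exact: l0|]; apply: le_trans lQ; apply: le_trans (mean_le_avg AQ muAQ _) _.
  move=> x; have : 0 <= h x * (l^-1)%:E by rewrite mule_ge0// lee_fin invr_ge0 ltW.
  by case: (h x * _) => //= r; rewrite !lee_fin; exact: young_ge0.
rewrite le_eqVlt; apply/orP; left; apply/eqP; congr (_ * _).
by apply: eq_integral => x _; rewrite gee0_abs.
Qed.

Lemma ereal_sup_cubes_bound (P : set E -> \bar R) : (forall Q, 0 <= P Q) ->
  ereal_sup [set P Q | Q in [set Q | is_cube Q]] < +oo ->
  exists2 K : R, (0 < K)%R & forall Q, is_cube Q -> P Q <= K%:E.
Proof.
move=> P0; set s := ereal_sup _ => sy.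
have Ps Q : is_cube Q -> P Q <= s by move=> cQ; apply: ereal_sup_ubound; exists Q.
have s0 : 0 <= s.
  apply: le_trans (P0 (cube (fun=> 0%R) 1%R)) (Ps _ _).
  by exists (fun=> 0%R), 1%R.
have sfin : s \is a fin_num by rewrite ge0_fin_numE.
exists (fine s + 1)%R; first by rewrite ltr_wpDl// fine_ge0.
by move=> Q /Ps /le_trans; apply; rewrite -{1}(fineK sfin) lee_fin lerDl.
Qed.

Variables (p q : R) (u v : E -> R).
Hypotheses (q1 : (1 < q)%R) (p1 : (1 < p)%R).
Hypotheses (mu_ : measurable_fun [set: E] u) (u0 : forall x, (0 <= u x)%R).
Hypotheses (mv : measurable_fun [set: E] v) (v0 : forall x, (0 <= v x)%R).

Let p0 : (0 < p)%R. Proof. exact: lt_trans p1. Qed.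
Let q0 : (0 < q)%R. Proof. exact: lt_trans q1. Qed.

Lemma dominated_lq_norm (f : nat -> E -> R) I :
  (forall i, measurable_fun [set: E] (f i)) ->
  dominated q I (fun i x => `|f i x|%:E) (fun x => lq_norm q (fun i => (f i x)%:E)).
Proof.
move=> mf.
have mg i : measurable_fun [set: E] (fun x => `|f i x|%:E).
  by apply/measurable_EFinP; exact: (measurableT_comp (@normr_measurable R setT) (mf i)).
split.
- exact: mg.
- by move=> i x; rewrite lee_fin.
- apply: measurable_lq_norm => i; apply/measurable_EFinP; exact: mf.
- by move=> x; exact: poweR_ge0.
- by move=> x; exact: (lq_norm_sum_le (fun i => (f i x)%:E) I q0).
Qed.

Lemma weighted_norm_of_grids (C : R) : (0 < C)%R ->
  (forall tau K (f : nat -> E -> \bar R) F, dominated q K f F ->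
    \int[mu]_x (vv_maxlev (tgridK R tau K) q K f (2 * K) 0 x `^ (p / q) * (u x)%:E)
    <= C%:E * \int[mu]_x (F x `^ p * (v x)%:E)) ->
  exists2 C' : R, (0 < C')%R & forall f : nat -> E -> R,
    (forall i, measurable_fun [set: E] (f i)) ->
    weighted_norm p u (vv_maximal q f) <=
    C'%:E * weighted_norm p v (fun x => lq_norm q (fun i => (f i x)%:E)).
Proof.
move=> C0 HC; pose N : R := #|{: {ffun 'I_n -> bool}}|%:R.
have N0 : (0 < N)%R.
  by rewrite ltr0n; apply/card_gt0P; exists [ffun=> true].
pose C2 : R := (((6 ^+ n) `^ q) `^ (p / q) * (N `^ (p / q) * N))%R.
have C20 : (0 < C2)%R by rewrite !mulr_gt0 ?powR_gt0 ?exprn_gt0.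
exists ((C2 * C) `^ p^-1)%R; first by rewrite powR_gt0// mulr_gt0.
move=> f mf; rewrite /weighted_norm.
set X := \int[mu]_x (_ `^ p * (v x)%:E).
have X0 : 0 <= X.
  by apply: integral_ge0 => x _; rewrite mule_ge0 ?poweR_ge0 ?lee_fin.
rewrite -poweR_EFin -poweRM ?lee_fin ?(ltW (mulr_gt0 C20 C0))//.
apply: le_poweR.
- by rewrite invr_ge0 ltW.
- by apply: integral_ge0 => x _; rewrite mule_ge0 ?poweR_ge0 ?lee_fin.
rewrite EFinM -muleA.
apply: vv_maximal_integral_le => //; first by rewrite mule_ge0// lee_fin ltW.
move=> tau K; apply: le_trans (HC tau K _ _ (dominated_lq_norm K mf)) _.
rewrite lee_wpmul2l ?lee_fin ?(ltW C0)//; apply: le_integral_nonneg => x _.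
  by rewrite mule_ge0 ?poweR_ge0 ?lee_fin.
by rewrite gee0_abs ?poweR_ge0.
Qed.

End from_cubes_to_cells.

Theorem theorem1p13 (R : realType) (n : nat) (q : R) (u v : Rn R n -> R) :
  (0 < n)%N -> (1 < q)%R -> weight u -> weight v ->
  (forall (p : R) (B : R -> R),
    (1 < p)%R -> (p <= q)%R -> young B -> B_condition p (associate B) ->
    ereal_sup [set lp_norm_on p Q (wpow u p^-1) * luxemburg B Q (wpowN v p^-1)
      | Q in [set Q | is_cube Q]] < +oo ->
    exists2 C : R, (0 < C)%R &
      forall f : nat -> Rn R n -> R,
        (forall i, measurable_fun [set: Rn R n] (f i)) ->
        weighted_norm p u (vv_maximal q f) <=
          C%:E * weighted_norm p v (fun x => lq_norm q (fun i => (f i x)%:E)))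
  /\
  (forall (p : R) (A B : R -> R),
    (q < p)%R -> young A -> young B ->
    B_condition (conj_exponent (p / q)) (associate A) ->
    B_condition p (associate B) ->
    ereal_sup [set luxemburg A Q (wpow u (q / p)) `^ q^-1 *
        luxemburg B Q (wpowN v p^-1)
      | Q in [set Q | is_cube Q]] < +oo ->
    exists2 C : R, (0 < C)%R &
      forall f : nat -> Rn R n -> R,
        (forall i, measurable_fun [set: Rn R n] (f i)) ->
        weighted_norm p u (vv_maximal q f) <=
          C%:E * weighted_norm p v (fun x => lq_norm q (fun i => (f i x)%:E))).
Proof.
move=> _ q1 [mu_ u0 _] [mv v0 _]; have q0 := lt_trans ltr01 q1.
have b1 : (1 <= 3 ^+ n :> R)%R by rewrite exprn_ege1// ler1n.
have lux0 B' Q (h : Rn R n -> \bar R) : 0 <= luxemburg B' Q h.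
  by apply: le_ereal_inf_tmp => _ [l [l0 _] <-]; rewrite lee_fin ltW.
have pow0 (w : Rn R n -> R) r x : 0 <= wpow w r x by rewrite lee_fin powR_ge0.
have powN0 (w : Rn R n -> R) r x : 0 <= wpowN w r x by rewrite /wpowN inve_ge0.
split=> [p B p1 pq yB Bp|p A B qp yA yB Ar Bp] /ereal_sup_cubes_bound[|K K0 HK].
- by move=> Q; rewrite mule_ge0 ?poweR_ge0.
- have p0 := lt_trans ltr01 p1.
  have [C C0 HC] := two_weight_below (leb (R:=R) (n:=n)) b1 q1 p1 yB Bp mu_ u0 mv v0 K0 pq.
  apply: (weighted_norm_of_grids q1 p1 mu_ u0 v0 C0) => tau K' f F.
  apply: HC => k x; have [Q [cQ sQ mQ]] := cell_in_cube tau (triadic_gt0 R K') k x.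
  apply: le_trans (HK Q cQ); apply: lee_pmul.
  + exact: poweR_ge0.
  + exact: orlicz_ge0.
  + apply: le_poweR; first by rewrite invr_ge0 ltW.
      by apply: cavg_ge0 => y; rewrite lee_fin.
    apply: le_trans (mean_le_avg sQ mQ _) _; first by move=> y; rewrite lee_fin.
    rewrite le_eqVlt; apply/orP; left; apply/eqP; congr (_ * _).
    apply: eq_integral => y _; rewrite /wpow gee0_abs ?lee_fin ?powR_ge0//.
    by rewrite poweR_EFin -powRrM mulVf ?gt_eqF// powRr1.
  + exact: (orlicz_le_luxemburg yB sQ mQ (powN0 v p^-1)%R).
- by move=> Q; rewrite mule_ge0 ?poweR_ge0.
have p1 := lt_trans q1 qp.
have [C C0 HC] := two_weight_above b1 q1 p1 yB Bp mu_ u0 mv v0 K0 qp yA Ar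
  (@sigma_finiteT _ _ _ (leb (R:=R) (n:=n))).
apply: (weighted_norm_of_grids q1 p1 mu_ u0 v0 C0) => tau K' f F.
apply: HC => k x; have [Q [cQ sQ mQ]] := cell_in_cube tau (triadic_gt0 R K') k x.
apply: le_trans (HK Q cQ); apply: lee_pmul.
- exact: poweR_ge0.
- exact: orlicz_ge0.
- apply: le_poweR; [by rewrite invr_ge0 ltW|exact: orlicz_ge0|].
  exact: (orlicz_le_luxemburg yA sQ mQ (pow0 u (q / p))%R).
- exact: (orlicz_le_luxemburg yB sQ mQ (powN0 v p^-1)%R).
Qed.
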